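(* Let $\alpha\in(0,1)$ and let $\{Z(n),n\ge 0\}$ be a Galton-Watson branching process with $Z(0)=1$ whose offspring number $\xi$ has probability generating function $f(s)=\mathbf{E}s^{\xi}$ satisfying $$\mathbf{E}\xi=1,\qquad f(s)=s+(1-s)^{1+\alpha}L(1-s),\quad 0\le s\le 1,$$ where $L(z)$ is slowly varying as $z\downarrow 0$. Let $\varphi(n)>0$, $n=1,2,\ldots$, be a deterministic function such that $\varphi(n)\to\infty$ and $\varphi(n)/n\to 0$ as $n\to\infty$, and put $\mathcal{H}(n):=\{0<(1-f_{\varphi(n)}(0))Z(n)\le 1\}$, where $f_n$ is the $n$th iterate of $f$. For $0\le m\le n$ let $Z(m,n)$ be the number of particles of generation $m$ having a positive number of descendants in generation $n$, with $Z(n,n)=Z(n)$. Then, for any $x\in(0,\infty)$ and any integer $j\ge1$, $$\lim_{n\to\infty}\mathbf{P}\big(Z(n-x\varphi(n),n)=j\,\big|\,\mathcal{H}(n)\big)=\frac{\alpha\,\Gamma(j+\alpha)}{j!}\,x\,M^{*j}(x^{-1/\alpha}),$$ where $M$ is the probability distribution function on $[0,\infty)$ determined by $$\int_0^\infty e^{-\lambda y}\,dM(y)=1-\frac{1}{(1+\lambda^{-\alpha})^{1/\alpha}},\qquad \lambda>0,$$ and $M^{*j}$ is the $j$th convolution of $M$ with itself.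
   Context: The iterates are $f_0(s)=s$, $f_n(s)=f(f_{n-1}(s))$, $n\ge1$, so $\mathbf{E}s^{Z(n)}=f_n(s)$. A positive (measurable) function $L$ is slowly varying as $z\downarrow0$ if $L(cz)/L(z)\to1$ as $z\downarrow0$ for every $c>0$; at $s=1$ the term $(1-s)^{1+\alpha}L(1-s)$ is read as $0$. Non-integer indices are replaced by integers via integer parts: $f_{\varphi(n)}$ means $f_{\lfloor\varphi(n)\rfloor}$ and $Z(n-x\varphi(n),n)$ means $Z(n-\lfloor x\varphi(n)\rfloor,n)$ (for $n$ large enough that $x\varphi(n)\le n$). $M^{*j}$ is the distribution function of the sum of $j$ independent random variables each with distribution function $M$ ($M^{*1}=M$). It is known that $M$ is a proper nondegenerate distribution with $M(y)>0$ for all $y>0$; it is the limit law of $(1-f_n(0))Z(n)$ given $Z(n)>0$. $\Gamma$ is the Gamma function. *)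

(* Defs.v *)
From HB Require Import structures.
From mathcomp Require Import all_boot all_order all_algebra.
From mathcomp Require Import all_classical all_reals all_analysis.
From mathcomp Require Import measurable_realfun.

Set Implicit Arguments.
Unset Strict Implicit.
Unset Printing Implicit Defensive.

Import Order.TTheory GRing.Theory Num.Theory.
Import numFieldNormedType.Exports.

Local Open Scope classical_set_scope.
Local Open Scope ring_scope.

Section probability.
Context {d : measure_display} {T : measurableType d} {R : realType}.
Variable P : probability T R.

Definition cond_prob (A B : set T) : R := fine (P (A `&` B)) / fine (P B).

Context {d' : measure_display} {T' : measurableType d'}.

Definition mutually_independent (I : eqType) (X : I -> {RV P >-> T'}) : Prop :=
  forall (s : seq I) (B : I -> set T'), uniq s ->
    (forall i, measurable (B i)) ->
    P (\bigcap_(i in [set` s]) (X i @^-1` B i)) =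
    (\prod_(i <- s) P (X i @^-1` B i))%E.

Definition identically_distributed (I : Type) (X : I -> {RV P >-> T'}) : Prop :=
  forall (i k : I) (B : set T'), measurable B ->
    distribution P (X i) B = distribution P (X k) B.

(* The value s ^+ 0 = 1 also at s = 0, so pgf X 0 = P(X = 0). *)
Definition pgf (X : {RV P >-> nat}) (s : R) : R :=
  fine 'E_P[fun w => (s ^+ X w)%R]%E.

End probability.

(* Particles carry Ulam-Harris labels: the root is [::] and the children of u
   are rcons u 0, ..., rcons u (c u).-1, where c u is the number of children
   of u.  Descent is the prefix order, every particle being its own descendant
   in its own generation. *)
Fixpoint generation (c : seq nat -> nat) (n : nat) : seq (seq nat) :=
  if n is n'.+1 then
    [seq rcons u i | u <- generation c n', i <- iota 0 (c u)]
  else [:: [::]].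

Section galton_watson.
Context {d : measure_display} {T : measurableType d} {R : realType}.
Context {P : probability T R}.
Variable xi : seq nat -> {RV P >-> nat}.

Definition gw_size (n : nat) (w : T) : nat :=
  size (generation (fun u => xi u w) n).

Definition gw_reduced (m n : nat) (w : T) : nat :=
  let c := fun u => xi u w in
  count (fun u => has (prefix u) (generation c n)) (generation c m).

End galton_watson.

Section analysis.
Context {R : realType}.

(* Only z in ]0, 1] is constrained: L enters through L (1 - s), 0 <= s < 1. *)
Definition slowly_varying_at0 (L : R -> R) : Prop :=
  [/\ forall z, 0 < z <= 1 -> 0 < L z,
      measurable_fun `]0, 1 : R] L &
      forall c, 0 < c -> L (c * z) / L z @[z --> 0^'+] --> (1 : R)].

Definition Gamma (a : R) : R :=
  \int[lebesgue_measure]_(t in `]0, +oo[) (t `^ (a - 1) * expR (- t)).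

Local Notation TR := (measurableTypeR R).

Definition pair_sum (p : TR * TR) : TR := p.1 + p.2.

Lemma measurable_pair_sum : measurable_fun setT pair_sum.
Proof.
by apply: (@measurable_funD _ (TR * TR)%type R setT fst snd);
  [exact: measurable_fst | exact: measurable_snd].
Qed.

HB.instance Definition _ :=
  isMeasurableFun.Build _ _ _ _ pair_sum measurable_pair_sum.

(* The law of the sum of two independent variables of laws mu and nu. *)
Definition convolution (mu nu : probability TR R) : probability TR R :=
  distribution (mu \x nu)%E pair_sum.

(* Used for j >= 1; the value at j = 0 is irrelevant. *)
Definition convolution_pow (mu : probability TR R) (j : nat) :
    probability TR R :=
  iter j.-1 (convolution mu) mu.

Definition df_convolution_pow (M : cumulativeBounded (0 : R) (1 : R))
    (j : nat) (y : R) : R :=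
  fine (convolution_pow (lebesgue_stieltjes_measure M) j `]-oo, y]%classic).

End analysis.

(* Main.v *)
Require Import Defs.
From mathcomp Require Import all_boot all_order all_algebra.
From mathcomp Require Import all_classical all_reals all_analysis.
From mathcomp Require Import measurable_realfun ring lra zify.

Set Implicit Arguments.
Unset Strict Implicit.
Unset Printing Implicit Defensive.

Import Order.TTheory GRing.Theory Num.Theory.
Import numFieldNormedType.Exports.

Local Open Scope classical_set_scope.
Local Open Scope ring_scope.
(* With z = 1 - s the generating function f becomes g z = z - h z, where h z = z^(1 + alpha) L z is
   convex, and 1 - f_n(0) = Q n, the n-th iterate of g at 1. Convexity and regular variation of h
   give V (g z) - V z -> alpha for V z = z / h z, hence V (Q n) ~ alpha n; a starting point z n with
   V (z n) ~ alpha c phi(n) lies between consecutive Q k, and monotonicity of g yields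
   Q n - g^n (z n) ~ c phi(n) h (Q n). Conditioning on generation m gives
     E[t^Z(m,n) s^Z(n)] = f_m (f_(n-m)(0) + t (f_(n-m)(s) - f_(n-m)(0))),
   so for s = exp(- lambda Q(phi(n))) the limits of E[s^Z(n); Z(n) > 0] and
   E[t^Z(n-m,n) s^Z(n); Z(n) > 0], divided by phi(n) h (Q n), are explicit; the expansion in t
   isolates Z(n-m,n) = j. These are the moments of exp(- Q(phi(n)) Z(n)), a variable in [0, 1], and
   polynomial approximation of an indicator turns them into the limits of the probabilities,
   provided that the limit laws have no atom. M has no positive atom: l^(-a) is the transform of a
   positive density and the transform ell of M satisfies
     - ell'(l) (1 + l^(- alpha)) = l^(- 1 - alpha) (1 - ell(l)),
   which bounds the mass of an atom at y0 by integrals of polynomials concentrating at exp(- y0). *)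

(** * Iteration of a regularly varying perturbation of the identity *)

(** The denominator forces the detour through polynomials: [P(Z(n) > 0)] divided by [phi(n) h (Q n)]
    is [V (Q n) / phi n], about [alpha n / phi(n)], which diverges. The normalised laws tend to an
    infinite measure, a multiple of Lebesgue measure on the half line carried by [v -> v^(1/alpha)].
    So only moments of positive order converge, and test polynomials must vanish at 0. On the
    constants: [(1 - t ell)^(- alpha)] contributes the rising product of [alpha] over [j!] times
    [ell^j], the transform of the [j]-th convolution power; division by the limit
    [1 / Gamma(1 + alpha)] of the denominator turns this into [alpha Gamma(j + alpha) / j!]. Passing
    from [phi(n)] to [x phi(n)] generations multiplies the argument of the transform by
    [x^(1/alpha)], whence the point [x^(- 1/alpha)]. The event has its threshold exactly at
    [exp(- 1)], so no continuity point can be chosen; as [x] is arbitrary, atoms have to be excluded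
    at every positive point. *)

Lemma powR_slope1 {R : realType} (a e : R) : 0 < e -> exists2 d : R, 0 < d < 2^-1 &
  `|((1 + d) `^ a - 1) / d - a| < e /\ `|(1 - (1 - d) `^ a) / d - a| < e.
Proof.
move=> e0; have [der dE] := is_derive1_powR a (@ltr01 R).
rewrite powR1 mulr1 in dE.
have : (fun k : R => k^-1 *: ((((@powR R) ^~ a) \o shift 1) (k *: 1) - 1 `^ a)) @ 0^' --> a.
  by rewrite -[X in _ --> X]dE; exact: der.
move=> /cvgrPdist_lt /(_ e e0) [r /= r0 rP].
have d0 : 0 < Num.min (r / 2) (3^-1) by rewrite lt_min; apply/andP; split; lra.
have dr : Num.min (r / 2) (3^-1) < r by rewrite gt_min; apply/orP; left; lra.
have d2 : Num.min (r / 2) (3^-1) < 2^-1 by rewrite gt_min; apply/orP; right; lra.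
exists (Num.min (r / 2) 3^-1); first by rewrite d0.
move: (Num.min _ _) d0 dr d2 => d d0 dr d2; split.
- have := rP d; rewrite /ball_/= sub0r normrN gtr0_norm// => /(_ dr (lt0r_neq0 d0)).
  by rewrite powR1 distrC mulrC /GRing.scale/= mulr1 (addrC d).
- have := rP (- d); rewrite /ball_/= sub0r normrN normrN gtr0_norm// oppr_eq0.
  move=> /(_ dr (lt0r_neq0 d0)).
  rewrite powR1 distrC /GRing.scale/= mulr1 (addrC _ 1) invrN mulNr -mulrN opprB mulrC.
  by [].
Qed.

Section regular_variation.
Context {R : realType}.
Variables (alpha : R) (h : R -> R).
Hypothesis alpha_gt0 : 0 < alpha.
Hypothesis h0 : h 0 = 0.
Hypothesis h_gt0 : forall z : R, 0 < z <= 1 -> 0 < h z.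
Hypothesis h1 : h 1 < 1.
Hypothesis h_convex : forall a b c : R, 0 <= a <= b -> b <= c <= 1 ->
  h b * (c - a) <= h a * (c - b) + h c * (b - a).
Hypothesis g_homo : forall a b : R, 0 <= a <= b -> b <= 1 -> a - h a <= b - h b.
Hypothesis h_rv : forall c : R, 0 < c ->
  h (c * z) / h z @[z --> 0^'+] --> c `^ (1 + alpha).

Let g (z : R) := z - h z.
(** Up to the factor [alpha], [V z] is the number of steps of [g] that lead from 1 to about [z]: a
    clock along the orbit, regularly varying with index [- alpha]. *)
Let V (z : R) := z / h z.

(** Convexity and [h 0 = 0] make [h z / z] nondecreasing; the product form also covers [z = 0]. The
    monotonicity of [h] and of [V] comes from it. *)
Lemma h_slope z z' : 0 <= z <= z' -> z' <= 1 -> h z * z' <= h z' * z.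
Proof.
move=> zz' z'1; have /andP[z0 _] := zz'.
have := @h_convex 0 z z'; rewrite h0 mul0r add0r !subr0 lexx z0/= z'1 andbT.
by apply => //; case/andP: zz'.
Qed.

Lemma h_ge0 z : 0 <= z <= 1 -> 0 <= h z.
Proof.
move=> /andP[]; rewrite le_eqVlt => /predU1P[<- _|z0 z1]; first by rewrite h0.
by apply/ltW/h_gt0; rewrite z0.
Qed.

Lemma h_homo z z' : 0 <= z <= z' -> z' <= 1 -> h z <= h z'.
Proof.
move=> zz' z'1; have /andP[z0 lezz'] := zz'.
have [z'0|z'0] := ltP 0 z'.
  rewrite -(ler_pM2r z'0); apply: (le_trans (h_slope zz' z'1)).
  by apply: ler_wpM2l => //; apply: h_ge0; rewrite z'1 (le_trans z0).
by have -> : z = z' by apply/eqP; rewrite eq_le lezz' (le_trans z'0).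
Qed.

Lemma h_lt z : 0 < z <= 1 -> h z < z.
Proof.
move=> /andP[z0 z1]; have := @h_slope z 1; rewrite (ltW z0) z1 mulr1 => /(_ _ _).
move=> /(_ isT (lexx _)) hz; apply: (le_lt_trans hz).
by rewrite gtr_pMl.
Qed.

Lemma g_gt0 z : 0 < z <= 1 -> 0 < g z.
Proof. by move=> z01; rewrite subr_gt0 h_lt. Qed.

Lemma g_lt z : 0 < z <= 1 -> g z < z.
Proof. by move=> z01; rewrite ltrBlDr ltrDl h_gt0. Qed.

Lemma iter_g_itv n z : 0 < z <= 1 -> 0 < iter n g z <= z.
Proof.
move=> /andP[z0 z1]; elim: n => [|n /andP[IH0 IH1]] /=; first by rewrite z0 lexx.
have i1 : 0 < iter n g z <= 1 by rewrite IH0 (le_trans IH1).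
by rewrite g_gt0//= (le_trans _ IH1)// ltW// g_lt.
Qed.

Lemma iter_g_homo n a b : 0 < a <= b -> b <= 1 -> iter n g a <= iter n g b.
Proof.
move=> /andP[a0 ab] b1; elim: n => [//|n IH] /=.
have /andP[ia0 _] : 0 < iter n g a <= a by apply: iter_g_itv; rewrite a0 (le_trans ab).
have /andP[_ ib1] : 0 < iter n g b <= b by apply: iter_g_itv; rewrite b1 (lt_le_trans a0).
by apply: g_homo; rewrite ?(le_trans ib1)// (ltW ia0).
Qed.

Lemma V_gt0 z : 0 < z <= 1 -> 0 < V z.
Proof. by move=> z01; rewrite divr_gt0 ?h_gt0//; case/andP: z01. Qed.

Lemma V_homo z z' : 0 < z <= z' -> z' <= 1 -> V z' <= V z.
Proof.
move=> /andP[z0 zz'] z'1.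
rewrite ler_pdivrMr ?h_gt0 ?z'1 ?(lt_le_trans z0)//.
rewrite mulrAC ler_pdivlMr ?h_gt0 ?z0 ?(le_trans zz')//.
by rewrite mulrC [leRHS]mulrC h_slope// (ltW z0).
Qed.

Lemma near01 : \forall z \near (0 : R)^'+, 0 < z <= 1.
Proof.
near=> z; apply/andP; split; first by near: z; exact: nbhs_right_gt.
by near: z; exact: nbhs_right_le.
Unshelve. all: by end_near. Qed.

Lemma near_scale c : 0 < c -> \forall z \near (0 : R)^'+, 0 < c * z <= 1.
Proof.
move=> c0; near=> z; have z0 : 0 < z by near: z; exact: nbhs_right_gt.
rewrite mulr_gt0//= mulrC -ler_pdivlMr// mul1r.
by near: z; apply: nbhs_right_le; rewrite invr_gt0.
Unshelve. all: by end_near. Qed.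

Lemma V_rv c : 0 < c -> V (c * z) / V z @[z --> 0^'+] --> c `^ (- alpha).
Proof.
move=> c0.
have -> : c `^ (- alpha) = c * (c `^ (1 + alpha))^-1.
  rewrite -powRN opprD powRD ?(gt_eqF c0) ?implybT// powR_inv1 ?(ltW c0)//.
  by rewrite mulrA divff ?mul1r// gt_eqF.
have cc : c * (h (c * z) / h z)^-1 @[z --> 0^'+] --> c * (c `^ (1 + alpha))^-1.
  apply: cvgM; first exact: cvg_cst.
  by apply: cvgV; [rewrite gt_eqF// powR_gt0|exact: h_rv].
apply: cvg_trans cc; apply: near_eq_cvg; near=> z.
have z01 : 0 < z <= 1 by near: z; exact: near01.
have cz01 : 0 < c * z <= 1 by near: z; exact: near_scale.
have /andP[z0 _] := z01.
rewrite /V; field; rewrite !gt_eqF// ?h_gt0//.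
Unshelve. all: by end_near. Qed.

(** Near 0, halving the argument multiplies [V] by more than some [rho > 1], because [2^alpha > 1].
    So [V] grows geometrically along [2^-1 ^+ k * e], and monotonicity fills the gaps. *)
Lemma V_infty : V z @[z --> 0^'+] --> +oo.
Proof.
have rho1 : 1 < (2^-1 : R) `^ (- alpha).
  rewrite powRN -[X in _ `^ X]mulr1.
  rewrite invf_gt1 ?powR_gt0// ?mulr1.
  by have := @gt0_ltr_powR R alpha alpha_gt0 2^-1 1; rewrite powR1; apply; rewrite ?nnegrE; lra.
have [rho rho1' rhoP] : exists2 rho, 1 < rho & rho < (2^-1 : R) `^ (- alpha).
  by exists ((1 + (2^-1 : R) `^ (- alpha)) / 2); lra.
have [d /= d0 dP] : \forall z \near (0:R)^'+, rho < V (2^-1 * z) / V z.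
  by have /cvgr_gt := @V_rv 2^-1 ltac:(by lra); apply.
pose e := Num.min (d / 2) 1.
have e0 : 0 < e by rewrite /e lt_min; apply/andP; split; lra.
have e1 : e <= 1 by rewrite /e ge_min lexx orbT.
have ed : e < d by rewrite /e gt_min; apply/orP; left; lra.
have halfe k : 0 < 2^-1 ^+ k * e <= e.
  rewrite pmulr_rgt0 ?exprn_gt0//= ger_pMl// exprn_ile1//; lra.
have Vk k : rho ^+ k * V e <= V (2^-1 ^+ k * e).
  elim: k => [|k IH]; first by rewrite !expr0 !mul1r.
  have /andP[ke0 kee] := halfe k.
  have := dP (2^-1 ^+ k * e); rewrite /= sub0r normrN gtr0_norm// => /(_ (le_lt_trans kee ed) ke0).
  have Vk0 : 0 < V (2^-1 ^+ k * e) by apply: V_gt0; rewrite ke0 (le_trans kee).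
  rewrite ltr_pdivlMr// => /ltW H; rewrite !exprS -!mulrA.
  by apply: le_trans H; rewrite ler_pM2l// (lt_trans _ rho1').
apply/cvgryPge => A.
have [k kA] : exists k, A <= rho ^+ k * V e.
  have r0 : 0 < rho by rewrite (lt_trans _ rho1').
  have Ve0 : 0 < V e by rewrite V_gt0// e0.
  have rhoy : (rho^-1) ^+ k @[k --> \oo] --> 0.
    by apply: cvg_expr; rewrite gtr0_norm ?invr_gt0// invf_lt1.
  have rhoy2 : (fun k => (rho^-1 ^+ k)^-1) @ \oo --> +oo.
    by apply/cvgrVy => //; near=> k; rewrite exprn_gt0// invr_gt0.
  have /cvgryPge /(_ (A / V e)) [k _ /(_ k (leqnn k))] := rhoy2.
  by rewrite /= exprVn invrK ler_pdivrMr// => kA; exists k.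
near=> z.
have z0 : 0 < z by near: z; exact: nbhs_right_gt.
apply: (le_trans kA); apply: (le_trans (Vk k)); apply: V_homo.
  rewrite z0/=; near: z; apply: nbhs_right_le; by have /andP[] := halfe k.
by have /andP[_ h2] := halfe k; rewrite (le_trans h2).
Unshelve. all: by end_near. Qed.

Lemma near_le_right (P : R -> Prop) (u : R -> R) :
  (\forall z \near 0^'+, P z) -> (\forall z \near 0^'+, 0 < u z <= z) ->
  \forall z \near 0^'+, P (u z).
Proof.
move=> [e /= e0 eP] uz; near=> z.
have /andP[u0 uz1] : 0 < u z <= z by near: z.
apply: eP => //=; rewrite sub0r normrN gtr0_norm//.
by apply: (le_lt_trans uz1); near: z; exact: nbhs_right_lt.
Unshelve. all: by end_near. Qed.

Lemma near_g (P : R -> Prop) :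
  (\forall z \near 0^'+, P z) -> \forall z \near 0^'+, P (g z).
Proof.
move=> nP; apply: near_le_right nP _; near=> z.
have z01 : 0 < z <= 1 by near: z; exact: near01.
by rewrite g_gt0// ltW// g_lt.
Unshelve. all: by end_near. Qed.

Lemma near_h_le e : 0 < e -> \forall z \near 0^'+, h z <= e * z.
Proof.
move=> e0; near=> z.
have z01 : 0 < z <= 1 by near: z; exact: near01.
have : e^-1 <= V z by near: z; move/cvgryPge: V_infty; apply.
rewrite ler_pdivlMr ?h_gt0// mulrC ler_pdivrMr// mulrC.
by rewrite [leRHS]mulrC.
Unshelve. all: by end_near. Qed.

Lemma near_h_ratio (c e : R) : 0 < c -> 0 < e ->
  \forall z \near 0^'+, `|h (c * z) / h z - c `^ (1 + alpha)| < e.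
Proof.
by move=> c0 e0; have /cvgrPdist_lt /(_ _ e0) := h_rv c0;
  apply: filterS => z; rewrite distrC.
Qed.

(** As [h z = o(z)], the point [g z] lies between [c z] and [z] for each [c < 1]; monotonicity of
    [h] and regular variation at the constant [c] squeeze the ratio. *)
Lemma h_g_cvg : h (g z) / h z @[z --> 0^'+] --> (1 : R).
Proof.
apply/cvgrPdist_lt => e e0.
have [e2 e20 [e21 e2e]] : exists2 e2 : R, 0 < e2 & e2 < 1 /\ e2 <= e / 2.
  exists (Num.min (e / 2) (2^-1)); first by rewrite lt_min; apply/andP; split; lra.
  by rewrite gt_min ge_min lexx/=; split => //; apply/orP; right; lra.
have a0 : 0 < 1 + alpha by rewrite addr_gt0.
(* [c] is picked so that the limit [c^(1 + alpha)] of the lower bound is [1 - e2]. *)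
have [c /andP[c0 c1] cE] : exists2 c : R, 0 < c < 1 & c `^ (1 + alpha) = 1 - e2.
  exists ((1 - e2) `^ (1 + alpha)^-1).
    rewrite powR_gt0 ?subr_gt0//=.
    have := @gt0_ltr_powR R (1 + alpha)^-1 _ (1 - e2) 1; rewrite powR1.
    by apply; rewrite ?invr_gt0// ?nnegrE; lra.
  by rewrite -powRrM mulVf ?powRr1// ?gt_eqF// subr_ge0 ltW.
have Ng := near_g near01.
near=> z.
have z01 : 0 < z <= 1 by near: z; exact: near01.
have gz01 : 0 < g z <= 1 by near: z; exact: Ng.
have hz0 := h_gt0 z01.
have /andP[z0 z1] := z01; have /andP[gz0 gz1] := gz01.
have hle : h z <= (1 - c) * z by near: z; apply: near_h_le; rewrite subr_gt0.
have : `|h (c * z) / h z - c `^ (1 + alpha)| < e / 2.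
  by near: z; apply: near_h_ratio => //; lra.
rewrite cE ltr_distl => /andP[H1 _].
have H2 : h (c * z) / h z <= h (g z) / h z.
  rewrite ler_pM2r ?invr_gt0// h_homo// mulr_ge0 ?(ltW c0) ?(ltW z0)//=.
  by rewrite /g; lra.
have H3 : h (g z) / h z <= 1.
  by rewrite ler_pdivrMr// mul1r h_homo// (ltW gz0)/= ltW// g_lt.
rewrite ger0_norm ?subr_ge0//; lra.
Unshelve. all: by end_near. Qed.

Let upper_slope (s p a d e : R) : 0 < d -> `|s - p| < e / 4 * d ->
  `|(p - 1) / d - a| < e / 4 -> (s - 1) / d <= a + e / 2.
Proof.
move=> d0; rewrite !ltr_distl => /andP[_ sp] /andP[_].
by rewrite ltr_pdivrMr// ler_pdivrMr//; lra.
Qed.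

Let lower_slope (s p a d e : R) : 0 < d -> `|s - p| < e / 4 * d ->
  `|(1 - p) / d - a| < e / 4 -> a - e / 2 <= (1 - s) / d.
Proof.
move=> d0; rewrite !ltr_distl => /andP[_ sp] /andP[+ _].
by rewrite ltr_pdivlMr// ler_pdivlMr//; lra.
Qed.

(** For [V_step]: [X] is [z (h z - h (g z)) / (h z h (g z))] and [r] is [h z / h (g z)], so that
    [V (g z) - V z = X - r]. *)
Let step_estimate (a e r X : R) : 0 < a -> 0 < e -> 1 <= r -> (r - 1) * (1 + a + e) <= e / 4 ->
  1 + a - e / 2 <= X -> X <= r * (1 + a + e / 2) -> `|X - r - a| <= e.
Proof.
move=> a0 e0 r1 rK XL XU; rewrite ler_norml.
have ra : 0 <= (r - 1) * a by rewrite mulr_ge0 ?subr_ge0// ltW.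
have re : 0 <= (r - 1) * e by rewrite mulr_ge0 ?subr_ge0// ltW.
by apply/andP; split; lra.
Qed.

(* Slopes of h over [g z, z], compared with those over [z, (1 + d) z] and [(1 - d) g z, g z]. *)
Let slope_bounds (z d : R) : 0 < z <= 1 -> 0 < d < 1 -> (1 + d) * z <= 1 ->
  (1 - h ((1 - d) * g z) / h (g z)) / d <= z * (h z - h (g z)) / (h z * h (g z)) <=
  h z / h (g z) * ((h ((1 + d) * z) / h z - 1) / d).
Proof.
move=> z01 /andP[d0 d1] dz1; have gz0 := g_gt0 z01; have gz := g_lt z01.
have /andP[z0 z1] := z01; have gz01 : 0 < g z <= 1 by rewrite gz0 ltW// (lt_le_trans gz).
have hz0 := h_gt0 z01; have hg0 := h_gt0 gz01.
have gE : z - g z = h z by rewrite /g subKr.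
have zz : z <= (1 + d) * z by rewrite ler_peMl ?(ltW z0)// lerDl ltW.
have c0 : 0 <= 1 - d by rewrite subr_ge0 ltW.
have c1 : 1 - d <= 1 by rewrite lerBlDr lerDl ltW.
have D0 : 0 <= h z - h (g z) by rewrite subr_ge0 h_homo// (ltW gz0) ltW.
have SU := @h_convex (g z) z ((1 + d) * z); rewrite (ltW gz0) (ltW gz) zz dz1 gE in SU.
have SL := @h_convex ((1 - d) * g z) (g z) z.
rewrite (ltW gz) z1 gE (mulr_ge0 c0 (ltW gz0)) (ler_piMl (ltW gz0) c1) in SL.
have {}SU := SU isT isT; have {}SL := SL isT isT.
have E1 : (1 + d) * z - z = d * z by ring.
have E2 : (1 + d) * z - g z = d * z + h z by rewrite -gE; ring.
have E3 : z - (1 - d) * g z = h z + d * g z by rewrite -gE; ring.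
have E4 : g z - (1 - d) * g z = d * g z by ring.
rewrite E1 E2 in SU; rewrite E3 E4 in SL.
have -> : (1 - h ((1 - d) * g z) / h (g z)) / d =
    (h (g z) - h ((1 - d) * g z)) * h z / d / (h z * h (g z)) by field; rewrite !gt_eqF.
have -> : h z / h (g z) * ((h ((1 + d) * z) / h z - 1) / d) =
    (h ((1 + d) * z) - h z) * h z / d / (h z * h (g z)) by field; rewrite !gt_eqF.
rewrite !ler_pM2r ?invr_gt0 ?mulr_gt0// ler_pdivrMr// ler_pdivlMr//.
have dD : (h z - h (g z)) * (d * g z) <= (h z - h (g z)) * (d * z).
  by rewrite ler_wpM2l// ler_pM2l// ltW.
move: SU SL dD; move: (h ((1 + d) * z)) (h ((1 - d) * g z)) (h z) (h (g z)) (g z) => A B C D G.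
by move=> SU SL dD; apply/andP; split; lra.
Qed.

(** With [X] and [r] as in [step_estimate], [r] tends to 1 by [h_g_cvg]. [X] tends to [1 + alpha]
    because the slopes of the convex [h] are monotone: those over steps of relative size [d] on
    either side control the slope over [[g z, z]]. *)
Lemma V_step : V (g z) - V z @[z --> 0^'+] --> alpha.
Proof.
apply/cvgrPdist_le => e e0.
have [d /andP[d0 d1] [dU dL]] := @powR_slope1 R (1 + alpha) (e / 4) ltac:(by lra).
have d01 : 0 < d < 1 by rewrite d0; lra.
have e40 : 0 < e / 4 * d by rewrite mulr_gt0//; lra.
have K0 : 0 < 1 + alpha + e by rewrite !addr_gt0.
(* Bounding [r - 1] by this constant makes [(r - 1) * (1 + alpha + e)] at most [e / 4], as
   [step_estimate] asks. *)
have eK : 0 < e / (4 * (1 + alpha + e)) by rewrite divr_gt0// mulr_gt0.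
have c0 : 0 < 1 + d by lra.
have c1 : 0 < 1 - d by lra.
have i1 : (1 + e / (4 * (1 + alpha + e)))^-1 < 1 by rewrite invf_lt1; lra.
have NL := near_g (near_h_ratio c1 e40).
have Ng := near_g near01.
near=> z.
have z01 : 0 < z <= 1 by near: z; exact: near01.
have gz01 : 0 < g z <= 1 by near: z; exact: Ng.
have /andP[_ dz1] : 0 < (1 + d) * z <= 1 by near: z; exact: near_scale.
have hz0 := h_gt0 z01; have hg0 := h_gt0 gz01.
have U : `|h ((1 + d) * z) / h z - (1 + d) `^ (1 + alpha)| < e / 4 * d.
  by near: z; exact: near_h_ratio.
have L : `|h ((1 - d) * g z) / h (g z) - (1 - d) `^ (1 + alpha)| < e / 4 * d.
  by near: z; exact: NL.
have r1 : 1 <= h z / h (g z).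
  rewrite ler_pdivlMr// mul1r h_homo//; last by case/andP: z01.
  by case/andP: gz01 => /ltW -> _; rewrite ltW// g_lt.
have r2 : h z / h (g z) <= 1 + e / (4 * (1 + alpha + e)).
  have : h (g z) / h z > (1 + e / (4 * (1 + alpha + e)))^-1.
    by near: z; move/cvgr_gt: h_g_cvg; apply.
  by rewrite -(invf_div (h z)) ltf_pV2 ?qualifE/= ?divr_gt0 ?addr_gt0// => /ltW.
have -> : V (g z) - V z = z * (h z - h (g z)) / (h z * h (g z)) - h z / h (g z).
  by rewrite /V {1}/g; field; rewrite !gt_eqF.
have /andP[XL XU] := slope_bounds z01 d01 dz1.
rewrite distrC; apply: step_estimate => //.
- have -> : e / 4 = e / (4 * (1 + alpha + e)) * (1 + alpha + e) by field; rewrite gt_eqF.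
  by rewrite ler_pM2r// lerBlDl.
- exact: le_trans (lower_slope d0 L dL) XL.
- by apply: le_trans XU _; rewrite ler_pM2l ?(lt_le_trans ltr01)// (upper_slope d0 U dU).
Unshelve. all: by end_near. Qed.

(** The orbit of [z] stays in []0, z]], so the one-step bound holds along it with the same [e], and
    the errors add up. The range of [z] does not depend on [m]. *)
Lemma V_iter e : 0 < e -> \forall z \near 0^'+, forall m : nat,
  `|V (iter m g z) - V z - alpha * m%:R| <= e * m%:R.
Proof.
move=> e0; have /cvgrPdist_le /(_ _ e0) [d /= d0 dP] := V_step.
near=> z => m.
have z01 : 0 < z <= 1 by near: z; exact: near01.
have zd : z < d by near: z; exact: nbhs_right_lt.
elim: m => [|m IH] /=; first by rewrite !mulr0 subrr subr0 normr0.
have /andP[i0 iz] := iter_g_itv m z01.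
have := dP (iter m g z).
rewrite /ball_/= sub0r normrN gtr0_norm// => /(_ (le_lt_trans iz zd) i0) H.
rewrite -/g -natr1 !mulrDr !mulr1.
move: IH H; rewrite !ler_norml => /andP[A B] /andP[C D]; apply/andP; split; lra.
Unshelve. all: by end_near. Qed.

Lemma iter_g_leq z m n : 0 < z <= 1 -> (m <= n)%N -> iter n g z <= iter m g z.
Proof.
move=> z01 mn; rewrite -(subnK mn) iterD.
have /andP[i0 iz] := iter_g_itv m z01; have /andP[_ z1] := z01.
by have /andP[] := @iter_g_itv (n - m)%N (iter m g z) ltac:(by rewrite i0 (le_trans iz)).
Qed.

Lemma cvg_to_right0 (u : R^nat) : (\forall n \near \oo, 0 < u n) ->
  u @ \oo --> 0 -> u @ \oo --> 0^'+.
Proof.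
move=> u0 /cvgrPdist_lt uc A [e /= e0 eA].
near=> n; apply: eA; last by near: n.
by near: n; exact: uc.
Unshelve. all: by end_near. Qed.

(** * The orbit of 1 under [g] *)

Let Q n := iter n g 1.

Lemma Q_itv n : 0 < Q n <= 1.
Proof. by apply: iter_g_itv; rewrite ltr01/=. Qed.

Lemma Q_cvg : Q @ \oo --> 0^'+.
Proof.
apply: cvg_to_right0; first by apply: nearW => n; case/andP: (Q_itv n).
apply/cvgrPdist_lt => e e0.
have [n ne] : exists n, Q n < e.
  apply/not_existsP => H.
  have He n : e <= Q n by rewrite leNgt; apply/negP/H.
  have e1 : e <= 1 by exact: He 0%N.
  have he0 : 0 < h e by rewrite h_gt0 ?e0.
  (* As long as [Q] stays above [e], each step subtracts at least [h e > 0]. *)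
  have Hn n : Q n <= 1 - n%:R * h e.
    elim: n => [|n IH]; first by rewrite mul0r subr0.
    have /andP[_ Q1] := Q_itv n.
    have := @h_homo e (Q n); rewrite (ltW e0) He => /(_ isT Q1) hQ.
    rewrite -natr1 mulrDl mul1r; move: IH hQ.
    have -> : Q n.+1 = Q n - h (Q n) by [].
    by lra.
  have [n nP] : exists n : nat, (h e)^-1 < n%:R.
    by exists (Num.truncn (h e)^-1).+1; rewrite truncnS_gt.
  move: nP; rewrite -div1r ltr_pdivrMr// => nP.
  have := Hn n; have := He n; lra.
near=> m; have /andP[Qm0 _] := Q_itv m.
rewrite sub0r normrN gtr0_norm//.
apply: le_lt_trans ne; apply: iter_g_leq; first exact: (Q_itv 0).
by near: m; exact: nbhs_infty_ge.
Unshelve. all: by end_near. Qed.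

(** [V_iter] applies only from some [Q n0] on; the contribution of the first [n0] steps is fixed and
    vanishes after division by [n]. *)
Lemma V_Q_cvg : V (Q n) / n%:R @[n --> \oo] --> alpha.
Proof.
apply/cvgrPdist_le => e e0.
have e20 : 0 < e / 2 by lra.
have [n0 _ /(_ n0 (leqnn n0)) n0P] := Q_cvg (V_iter e20).
near=> n.
have nn0 : (n0 <= n)%N by near: n; exact: nbhs_infty_ge.
have n_gt0 : 0 < n%:R :> R.
  by rewrite ltr0n; near: n; exact: nbhs_infty_gt.
have nK : `|V (Q n0)| + alpha * n0%:R <= e / 2 * n%:R.
  rewrite -ler_pdivrMl//; near: n; exact: nbhs_infty_ger.
have := n0P (n - n0)%N.
rewrite -iterD subnK// -/(Q n) natrB// => H.
have : `|alpha * n%:R - V (Q n)| <= e * n%:R.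
  have n00 : 0 <= n0%:R :> R by [].
  have H1 : `|V (Q n) - V (Q n0) - alpha * (n%:R - n0%:R)| <= e / 2 * n%:R.
    apply: (le_trans H); rewrite ler_pM2l// lerBlDr lerDl//.
  have := ler_normD (V (Q n) - V (Q n0) - alpha * (n%:R - n0%:R)) (V (Q n0) - alpha * n0%:R).
  have := ler_normB (V (Q n0)) (alpha * n0%:R).
  rewrite (ger0_norm (mulr_ge0 (ltW alpha_gt0) n00)).
  have -> : V (Q n) - V (Q n0) - alpha * (n%:R - n0%:R) + (V (Q n0) - alpha * n0%:R) =
    - (alpha * n%:R - V (Q n)) by ring.
  rewrite normrN; lra.
move=> H2.
have -> : alpha - V (Q n) / n%:R = (alpha * n%:R - V (Q n)) / n%:R.
  by field; rewrite gt_eqF.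
by rewrite normrM normfV (gtr0_norm n_gt0) ler_pdivrMr.
Unshelve. all: by end_near. Qed.

(** * Regular variation along sequences *)

Lemma powRVK (x p : R) : 0 <= x -> p != 0 -> (x `^ p^-1) `^ p = x.
Proof. by move=> x0 p0; rewrite -powRrM mulVf// powRr1. Qed.

Lemma alphaN0 : - alpha != 0.
Proof. by rewrite oppr_eq0 gt_eqF. Qed.

Lemma powRN_lt (a b : R) : 0 < a -> a < b -> b `^ (- alpha) < a `^ (- alpha).
Proof.
move=> a0 ab; have b0 := lt_trans a0 ab.
rewrite !powRN ltf_pV2 ?qualifE/= ?powR_gt0//.
by rewrite gt0_ltr_powR// ?nnegrE ltW.
Qed.

Lemma V_ratio_le (u v : R^nat) (rho c : R) : u @ \oo --> 0^'+ -> v @ \oo --> 0^'+ ->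
  0 < c -> c `^ (- alpha) < rho ->
  \forall n \near \oo, c * v n <= u n -> V (u n) / V (v n) < rho.
Proof.
move=> u0 v0 c0 crho.
have /cvgr_lt /(_ _ crho) near_V := V_rv c0.
have near_V' := v0 _ near_V.
have ncv := v0 _ (near_scale c0).
have nu := u0 _ near01.
have nv := v0 _ near01.
near=> n => cvu.
have H : V (c * v n) / V (v n) < rho by near: n; exact: near_V'.
apply: le_lt_trans H.
have v01 : 0 < v n <= 1 by near: n; exact: nv.
have u01 : 0 < u n <= 1 by near: n; exact: nu.
have cv01 : 0 < c * v n <= 1 by near: n; exact: ncv.
rewrite ler_pM2r ?invr_gt0 ?V_gt0//; apply: V_homo; last by case/andP: u01.
by rewrite cvu andbT; case/andP: cv01.
Unshelve. all: by end_near. Qed.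

Lemma V_ratio_ge (u v : R^nat) (rho c : R) : u @ \oo --> 0^'+ -> v @ \oo --> 0^'+ ->
  0 < c -> rho < c `^ (- alpha) ->
  \forall n \near \oo, u n <= c * v n -> rho < V (u n) / V (v n).
Proof.
move=> u0 v0 c0 crho.
have /cvgr_gt /(_ _ crho) near_V := V_rv c0.
have near_V' := v0 _ near_V.
have ncv := v0 _ (near_scale c0).
have nu := u0 _ near01.
have nv := v0 _ near01.
near=> n => cvu.
have H : rho < V (c * v n) / V (v n) by near: n; exact: near_V'.
apply: (lt_le_trans H).
have v01 : 0 < v n <= 1 by near: n; exact: nv.
have u01 : 0 < u n <= 1 by near: n; exact: nu.
have cv01 : 0 < c * v n <= 1 by near: n; exact: ncv.
rewrite ler_pM2r ?invr_gt0 ?V_gt0//; apply: V_homo; last by case/andP: cv01.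
by rewrite cvu andbT; case/andP: u01.
Unshelve. all: by end_near. Qed.

Lemma cvg_gt0_sandwich (u : R^nat) (l : R) : 0 < l ->
  (forall r, l < r -> \forall n \near \oo, u n < r) ->
  (forall r, 0 < r < l -> \forall n \near \oo, r < u n) -> u @ \oo --> l.
Proof.
move=> l0 upper lower; apply/cvgrPdist_lt => e e0.
have nU := upper (l + e) ltac:(by lra).
have m0 : 0 < Num.max (l - e) (l / 2) < l.
  by rewrite lt_max gt_max; apply/andP; split; [apply/orP; right|apply/andP; split]; lra.
have nL := lower _ m0.
near=> n; rewrite ltr_distlC; apply/andP; split; last by near: n; exact: nU.
apply: (@le_lt_trans _ _ (Num.max (l - e) (l / 2))); first by rewrite le_max lexx.
by near: n; exact: nL.
Unshelve. all: by end_near. Qed.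

(** Regular variation is given for fixed factors only. Monotonicity of [V] passes from [c' * v n],
    with [c'] slightly off [c], to any [u n] with [u n / v n] close to [c], and so replaces uniform
    convergence. *)
Lemma V_ratio (u v : R^nat) (c : R) : u @ \oo --> 0^'+ -> v @ \oo --> 0^'+ ->
  0 < c -> u n / v n @[n --> \oo] --> c ->
  V (u n) / V (v n) @[n --> \oo] --> c `^ (- alpha).
Proof.
move=> u0 v0 c0 uv.
have nv := v0 _ near01.
have cc (r : R) : 0 < r -> exists2 c', 0 < c' & c' `^ (- alpha) = r.
  by move=> r0; exists (r `^ (- alpha)^-1); rewrite ?powR_gt0// powRVK ?alphaN0// ltW.
have upper r : c `^ (- alpha) < r -> \forall n \near \oo, V (u n) / V (v n) < r.
  move=> cr; pose r' := (c `^ (- alpha) + r) / 2.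
  have r'0 : 0 < r' by have := powR_gt0 (- alpha) c0; rewrite /r'; lra.
  have [c' c'0 c'E] := cc r' r'0.
  have c'c : c' < c.
    rewrite ltNge le_eqVlt; apply/negP => /predU1P[ceq|cc'].
      by move: c'E; rewrite -ceq /r'; lra.
    by have := powRN_lt c0 cc'; rewrite c'E /r'; lra.
  have H := @V_ratio_le u v r c' u0 v0 c'0 ltac:(by rewrite c'E /r'; lra).
  have /cvgr_gt /(_ _ c'c) near_uv := uv.
  near=> n; have v01 : 0 < v n <= 1 by near: n; exact: nv.
  have /andP[vn0 _] := v01.
  have : c' * v n <= u n.
    by rewrite -ler_pdivlMr// ltW//; near: n; exact: near_uv.
  by near: n; exact: H.
have lower r : 0 < r -> r < c `^ (- alpha) -> \forall n \near \oo, r < V (u n) / V (v n).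
  move=> r0 cr; pose r' := (c `^ (- alpha) + r) / 2.
  have r'0 : 0 < r' by have := powR_gt0 (- alpha) c0; rewrite /r'; lra.
  have [c' c'0 c'E] := cc r' r'0.
  have c'c : c < c'.
    rewrite ltNge le_eqVlt; apply/negP => /predU1P[ceq|cc'].
      by move: c'E; rewrite ceq /r'; lra.
    by have := powRN_lt c'0 cc'; rewrite c'E /r'; lra.
  have H := @V_ratio_ge u v r c' u0 v0 c'0 ltac:(by rewrite c'E /r'; lra).
  have /cvgr_lt /(_ _ c'c) near_uv := uv.
  near=> n; have v01 : 0 < v n <= 1 by near: n; exact: nv.
  have /andP[vn0 _] := v01.
  have : u n <= c' * v n.
    by rewrite -ler_pdivrMr// ltW//; near: n; exact: near_uv.
  by near: n; exact: H.
apply: cvg_gt0_sandwich => [||r /andP[]]; [exact: powR_gt0|exact: upper|exact: lower].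
Unshelve. all: by end_near. Qed.

(** If [u n] were on the wrong side of [c' * v n], monotonicity would push the ratio of [V] beyond
    the midpoint of [c'^(- alpha)] and [rho]. This converts a comparison of times into a comparison
    of points. *)
Lemma V_ratio_inv (u v : R^nat) (rho : R) : u @ \oo --> 0^'+ -> v @ \oo --> 0^'+ ->
  0 < rho -> V (u n) / V (v n) @[n --> \oo] --> rho ->
  u n / v n @[n --> \oo] --> rho `^ (- alpha^-1).
Proof.
move=> u0 v0 rho0 uv.
have nv := v0 _ near01; have nu := u0 _ near01.
set c := rho `^ _.
have c0 : 0 < c by rewrite powR_gt0.
have cE : c `^ (- alpha) = rho by rewrite /c -invrN powRVK ?alphaN0// ltW.
have upper c' : c < c' -> \forall n \near \oo, u n / v n < c'.
  move=> cc'; have c'0 := lt_trans c0 cc'; have := powRN_lt c0 cc'; rewrite cE => cr.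
  pose r' := (c' `^ (- alpha) + rho) / 2.
  have H := @V_ratio_le u v r' c' u0 v0 c'0 ltac:(by rewrite /r'; lra).
  have r'rho : r' < rho by rewrite /r'; lra.
  have /cvgr_gt /(_ _ r'rho) near_uv := uv.
  near=> n; have v01 : 0 < v n <= 1 by near: n; exact: nv.
  have /andP[vn0 _] := v01.
  have H1 : r' < V (u n) / V (v n) by near: n; exact: near_uv.
  have H2 : c' * v n <= u n -> V (u n) / V (v n) < r' by near: n; exact: H.
  rewrite ltr_pdivrMr// ltNge; apply/negP => /H2 H3.
  by have := lt_trans H1 H3; rewrite ltxx.
have lower c' : 0 < c' -> c' < c -> \forall n \near \oo, c' < u n / v n.
  move=> c'0 cc'; have := powRN_lt c'0 cc'; rewrite cE => cr.
  pose r' := (c' `^ (- alpha) + rho) / 2.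
  have H := @V_ratio_ge u v r' c' u0 v0 c'0 ltac:(by rewrite /r'; lra).
  have r'rho : rho < r' by rewrite /r'; lra.
  have /cvgr_lt /(_ _ r'rho) near_uv := uv.
  near=> n; have v01 : 0 < v n <= 1 by near: n; exact: nv.
  have /andP[vn0 _] := v01.
  have H1 : V (u n) / V (v n) < r' by near: n; exact: near_uv.
  have H2 : u n <= c' * v n -> r' < V (u n) / V (v n) by near: n; exact: H.
  rewrite ltr_pdivlMr// ltNge; apply/negP => /H2 H3.
  by have := lt_trans H1 H3; rewrite ltxx.
by apply: cvg_gt0_sandwich => // c' /andP[]; exact: lower.
Unshelve. all: by end_near. Qed.

Lemma V_Q_along (k : nat -> nat) : k @ \oo --> \oo ->
  V (Q (k n)) / (k n)%:R @[n --> \oo] --> alpha.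
Proof. by move=> kc; apply: (cvg_comp k (fun n => V (Q n) / n%:R) kc); exact: V_Q_cvg. Qed.

Lemma Q_along (k : nat -> nat) : k @ \oo --> \oo -> Q (k n) @[n --> \oo] --> 0^'+.
Proof. by move=> kc; apply: (cvg_comp k Q kc); exact: Q_cvg. Qed.

Lemma near_pos_along (k : nat -> nat) : k @ \oo --> \oo ->
  \forall n \near \oo, 0 < (k n)%:R :> R.
Proof.
move=> kc; have H : \forall n \near \oo, (0 < k n)%N := kc _ (nbhs_infty_gt 0).
by apply: filterS H => n; rewrite ltr0n.
Qed.

Lemma hQ_gt0 n : 0 < h (Q n).
Proof. by apply: h_gt0; exact: Q_itv. Qed.

Lemma VQ_gt0 n : 0 < V (Q n).
Proof. by apply: V_gt0; exact: Q_itv. Qed.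

(** [V (Q k)] is about [alpha k], so [V] is asymptotically equal at the two points; [V_ratio_inv]
    gives the same for the points, and [h z = z / V z] for [h]. *)
Lemma h_Q_ratio (N M : nat -> nat) : N @ \oo --> \oo -> M @ \oo --> \oo ->
  (N n)%:R / (M n)%:R @[n --> \oo] --> (1 : R) ->
  h (Q (N n)) / h (Q (M n)) @[n --> \oo] --> (1 : R).
Proof.
move=> Ny My NM.
have VNM : V (Q (N n)) / V (Q (M n)) @[n --> \oo] --> (1 : R).
  have H : V (Q (N n)) / (N n)%:R * ((N n)%:R / (M n)%:R) * (V (Q (M n)) / (M n)%:R)^-1
      @[n --> \oo] --> alpha * 1 * alpha^-1.
    apply: cvgM; first by apply: cvgM => //; exact: V_Q_along.
    by apply: cvgV; [exact: lt0r_neq0|exact: V_Q_along].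
  rewrite mulr1 mulfV ?gt_eqF// in H.
  apply: cvg_trans H; apply: near_eq_cvg; near=> n.
  have N0 : 0 < (N n)%:R :> R by near: n; exact: near_pos_along.
  have M0 : 0 < (M n)%:R :> R by near: n; exact: near_pos_along.
  by field; rewrite !gt_eqF ?VQ_gt0.
have QNM : Q (N n) / Q (M n) @[n --> \oo] --> (1 : R).
  have := V_ratio_inv (Q_along Ny) (Q_along My) ltr01 VNM.
  by rewrite powR1.
have H : Q (N n) / Q (M n) * (V (Q (N n)) / V (Q (M n)))^-1 @[n --> \oo] --> (1 : R) * 1^-1.
  by apply: cvgM => //; apply: cvgV => //; rewrite oner_neq0.
rewrite invr1 mulr1 in H.
apply: cvg_trans H; apply: near_eq_cvg; near=> n.
rewrite /V; field.
have /andP[QN _] := Q_itv (N n); have /andP[QM _] := Q_itv (M n).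
by rewrite !gt_eqF ?hQ_gt0.
Unshelve. all: by end_near. Qed.

Lemma exists_bracket z : 0 < z <= 1 -> exists k, Q k.+1 <= z <= Q k.
Proof.
move=> /andP[z0 z1].
have [n0 nP] : exists n, Q n.+1 <= z.
  have [n _ /(_ n (leqnn n)) /= H] := Q_cvg (nbhs_right_le z0).
  by exists n; apply: le_trans H; exact: (@iter_g_leq 1 n n.+1 (Q_itv 0) (leqnSn n)).
have ex : exists n, (fun n => Q n.+1 <= z) n by exists n0.
exists (ex_minn ex); case: ex_minnP => -[|k] kz kmin; first by rewrite kz.
rewrite kz/= leNgt; apply/negP => Qz.
by have := kmin k (ltW Qz); rewrite ltnn.
Qed.

(** Each of the [k] steps subtracts [h (Q i)] with [N <= i < N + k], and [h] decreases along the
    orbit. *)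
Lemma Q_diff N k :
  k%:R * h (Q (N + k)) <= Q N - Q (N + k) <= k%:R * h (Q N).
Proof.
have /andP[QN0 QN1] := Q_itv N.
elim: k => [|k IH]; first by rewrite addn0 subrr !mul0r lexx.
rewrite addnS -natr1 !mulrDl !mul1r.
have /andP[Qk0 Qk1] := Q_itv (N + k); have /andP[QSk0 QSk1] := Q_itv (N + k).+1.
have E : Q (N + k).+1 = Q (N + k) - h (Q (N + k)) by [].
have le1 : Q (N + k).+1 <= Q (N + k) by rewrite E lerBlDr lerDl ltW// hQ_gt0.
have le2 : Q (N + k) <= Q N by apply: iter_g_leq; [exact: (Q_itv 0)|exact: leq_addr].
have h1' : h (Q (N + k).+1) <= h (Q (N + k)) by rewrite h_homo// ltW.
have h2 : h (Q (N + k)) <= h (Q N) by rewrite h_homo// ltW.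
have k0 : 0 <= k%:R :> R by [].
have h3 : k%:R * h (Q (N + k).+1) <= k%:R * h (Q (N + k)) by rewrite ler_wpM2l.
by case/andP: IH => A B; apply/andP; split; lra.
Qed.

(** If [Q k.+1 <= z n <= Q k], the [N n]-th iterate of [z n] lies between [Q (N n + k.+1)] and
    [Q (N n + k)]. As [k] is about [c phi n], negligible against [n], the values of [h] in [Q_diff]
    are all equivalent to [h (Q n)]. *)
Lemma diff_asymp (phi z : R^nat) (N : nat -> nat) (c : R) : 0 < c ->
  phi n @[n --> \oo] --> +oo -> phi n / n%:R @[n --> \oo] --> (0 : R) ->
  N @ \oo --> \oo -> (N n)%:R / n%:R @[n --> \oo] --> (1 : R) ->
  z @ \oo --> 0^'+ -> V (z n) / phi n @[n --> \oo] --> alpha * c ->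
  (Q (N n) - iter (N n) g (z n)) / (phi n * h (Q n)) @[n --> \oo] --> c.
Proof.
move=> c0 phiy phin Ny Nn z0 Vz.
have nz := z0 _ near01.
(* The index 0 is a mere default for [z n] outside []0, 1]], which happens for finitely many [n]
   only. *)
have /choice[k kP] : forall n, exists k, 0 < z n <= 1 -> Q k.+1 <= z n <= Q k.
  move=> n; have [z01|_] := boolP (0 < z n <= 1); last by exists 0%N.
  by have [k kP] := exists_bracket z01; exists k.
have ky : k @ \oo --> \oo.
  apply/cvgnyPge => K.
  have QK : 0 < Q K by case/andP: (Q_itv K).
  have zK := z0 _ (nbhs_right_lt QK).
  near=> n.
  have z01 : 0 < z n <= 1 by near: n.
  rewrite leqNgt; apply/negP => kK; have /andP[Qz _] := kP _ z01.
  have : z n < Q K.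
    by near: n; exact: zK.
  rewrite ltNge; apply/negP/negPn; apply: le_trans Qz.
  by apply: iter_g_leq; [exact: (Q_itv 0)|].
have kSy : (fun n => (k n).+1) @ \oo --> \oo.
  by apply/cvgnyPge => K; move/cvgnyPge: ky => /(_ K); apply: filterS => n /leqW.
have phiV : (phi n)^-1 @[n --> \oo] --> (0 : R).
  apply/gtr0_cvgV0 => //; near=> n; near: n; move/cvgryPgt: phiy; exact.
have phi_pos : \forall n \near \oo, 0 < phi n by move/cvgryPgt: phiy; exact.
have kphi : (k n)%:R / phi n @[n --> \oo] --> c.
  have Hu : V (z n) / phi n * (V (Q (k n)) / (k n)%:R)^-1 @[n --> \oo] --> alpha * c * alpha^-1.
    by apply: cvgM => //; apply: cvgV; [exact: lt0r_neq0|exact: V_Q_along].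
  (* The lower end of the bracket bounds [(k n).+1]; the subtracted [(phi n)^-1] accounts for the
     extra unit. *)
  have Hl : V (z n) / phi n * (V (Q (k n).+1) / (k n).+1%:R)^-1 - (phi n)^-1
      @[n --> \oo] --> alpha * c * alpha^-1 - 0.
    apply: cvgB => //; apply: cvgM => //.
    by apply: cvgV; [exact: lt0r_neq0|exact: (V_Q_along kSy)].
  have E : alpha * c * alpha^-1 = c by rewrite mulrAC mulfV ?mul1r// gt_eqF.
  rewrite E in Hu; rewrite subr0 E in Hl.
  apply: squeeze_cvgr Hl Hu; near=> n.
  have z01 : 0 < z n <= 1 by near: n.
  have kn0 : 0 < (k n)%:R :> R by near: n; exact: near_pos_along.
  have ph0 : 0 < phi n by near: n.
  have /andP[Qz zQ] := kP _ z01.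
  have /andP[zn0 zn1] := z01.
  have V1 : V (Q (k n)) <= V (z n).
    by apply: V_homo; [rewrite zn0 zQ|case/andP: (Q_itv (k n))].
  have V2 : V (z n) <= V (Q (k n).+1).
    by apply: V_homo => //; rewrite Qz andbT; case/andP: (Q_itv (k n).+1).
  have VQ1 := VQ_gt0 (k n); have VQ2 := VQ_gt0 (k n).+1.
  have kS0 : 0 < (k n).+1%:R :> R by [].
  apply/andP; split.
    have -> : V (z n) / phi n * (V (Q (k n).+1) / (k n).+1%:R)^-1 - (phi n)^-1 =
      (V (z n) / V (Q (k n).+1) * (k n).+1%:R - 1) / phi n.
      by field; rewrite !gt_eqF.
    rewrite ler_pM2r ?invr_gt0// lerBlDr natr1.
    by rewrite ler_piMl// ler_pdivrMr// mul1r.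
  have -> : V (z n) / phi n * (V (Q (k n)) / (k n)%:R)^-1 =
    V (z n) / V (Q (k n)) * (k n)%:R / phi n.
    by field; rewrite !gt_eqF.
  rewrite ler_pM2r ?invr_gt0//.
  by rewrite ler_peMl// ler_pdivlMr// mul1r.
have NkN : (fun n => (N n + k n)%N) @ \oo --> \oo.
  apply/cvgnyPge => K; have NyK := Ny _ (nbhs_infty_ge K).
  near=> n; by apply: (@leq_trans (N n)); [near: n; exact: NyK|exact: leq_addr].
have idy : (fun n : nat => n) @ \oo --> \oo by exact: cvg_id.
have NkSN : (N n + k n)%:R / n%:R @[n --> \oo] --> (1 : R).
  have H : (N n)%:R / n%:R + (k n)%:R / phi n * (phi n / n%:R) @[n --> \oo] --> 1 + c * 0.
    by apply: cvgD => //; exact: cvgM.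
  rewrite mulr0 addr0 in H; apply: cvg_trans H; apply: near_eq_cvg; near=> n.
  have ph0 : 0 < phi n by near: n.
  have n_gt0 : 0 < n%:R :> R by near: n; exact: (near_pos_along idy).
  by rewrite natrD; field; rewrite !gt_eqF.
have hN := h_Q_ratio Ny idy Nn.
have hNk := h_Q_ratio NkN idy NkSN.
have Hl : (k n)%:R / phi n * (h (Q (N n + k n)) / h (Q n)) @[n --> \oo] --> c * 1 by exact: cvgM.
have Hu : ((k n)%:R / phi n + (phi n)^-1) * (h (Q (N n)) / h (Q n)) @[n --> \oo] --> (c + 0) * 1.
  by apply: cvgM => //; exact: cvgD.
rewrite addr0 mulr1 in Hu; rewrite mulr1 in Hl.
apply: squeeze_cvgr Hl Hu; near=> n.
have z01 : 0 < z n <= 1 by near: n.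
have ph0 : 0 < phi n by near: n.
have hQ0 := hQ_gt0 n.
have /andP[Qz zQ] := kP _ z01.
have /andP[zn0 zn1] := z01.
have g1 : iter (N n) g (z n) <= Q (N n + k n).
  rewrite /Q iterD; apply: iter_g_homo; first by rewrite zn0.
  by case/andP: (Q_itv (k n)).
have g2 : Q (N n + (k n).+1) <= iter (N n) g (z n).
  rewrite /Q iterD; apply: iter_g_homo => //.
  by rewrite Qz andbT; case/andP: (Q_itv (k n).+1).
have /andP[d1 _] := Q_diff (N n) (k n); have /andP[_ d2] := Q_diff (N n) (k n).+1.
have -> : (k n)%:R / phi n * (h (Q (N n + k n)) / h (Q n)) =
  ((k n)%:R * h (Q (N n + k n))) / (phi n * h (Q n)) by field; rewrite !gt_eqF.
have -> : ((k n)%:R / phi n + (phi n)^-1) * (h (Q (N n)) / h (Q n)) =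
  ((k n).+1%:R * h (Q (N n))) / (phi n * h (Q n)).
  by rewrite -natr1; field; rewrite !gt_eqF.
rewrite !ler_pM2r ?invr_gt0 ?mulr_gt0//; apply/andP; split; lra.
Unshelve. all: by end_near. Qed.

(** * The time scale [phi] and the two families of starting points *)

Variable phi : R^nat.
Hypothesis phi_infty : phi n @[n --> \oo] --> +oo.
Hypothesis phi_small : phi n / n%:R @[n --> \oo] --> (0 : R).

Lemma near_phi_gt0 : \forall n \near \oo, 0 < phi n.
Proof. by move/cvgryPgt: phi_infty; exact. Qed.

Lemma phi_inv_cvg : (phi n)^-1 @[n --> \oo] --> (0 : R).
Proof. by apply/gtr0_cvgV0 => //; exact: near_phi_gt0. Qed.

Lemma truncn_phi_ratio x : 0 < x ->
  (Num.truncn (x * phi n))%:R / phi n @[n --> \oo] --> x.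
Proof.
move=> x0.
have Hl : x - (phi n)^-1 @[n --> \oo] --> x - 0.
  by apply: cvgB; [exact: cvg_cst|exact: phi_inv_cvg].
have Hu : (fun _ : nat => x) @ \oo --> x by exact: cvg_cst.
rewrite subr0 in Hl; apply: squeeze_cvgr Hl Hu.
near=> n; have ph0 : 0 < phi n by near: n; exact: near_phi_gt0.
have xph0 : 0 <= x * phi n by rewrite mulr_ge0// ltW.
have /andP[t1 t2] := truncn_itv xph0.
apply/andP; split; last by rewrite ler_pdivrMr.
rewrite ler_pdivlMr// mulrBl mulVf ?gt_eqF// lerBlDr.
by rewrite natr1; exact: ltW.
Unshelve. all: by end_near. Qed.

Lemma truncn_phi_infty x : 0 < x -> (fun n => Num.truncn (x * phi n)) @ \oo --> \oo.
Proof.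
move=> x0; apply/cvgnyPge => K; near=> n.
have ph0 : 0 < phi n by near: n; exact: near_phi_gt0.
rewrite (truncn_ge_nat _ (mulr_ge0 (ltW x0) (ltW ph0))).
rewrite -ler_pdivrMl//; near: n; move/cvgryPge: phi_infty; exact.
Unshelve. all: by end_near. Qed.

Lemma V_Q_phi x : 0 < x ->
  V (Q (Num.truncn (x * phi n))) / phi n @[n --> \oo] --> alpha * x.
Proof.
move=> x0; have my := truncn_phi_infty x0.
have H : V (Q (Num.truncn (x * phi n))) / (Num.truncn (x * phi n))%:R *
    ((Num.truncn (x * phi n))%:R / phi n) @[n --> \oo] --> alpha * x.
  by apply: cvgM; [exact: (V_Q_along my)|exact: truncn_phi_ratio].
apply: cvg_trans H; apply: near_eq_cvg; near=> n.
have m0 : 0 < (Num.truncn (x * phi n))%:R :> R.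
  by near: n; exact: (near_pos_along my).
have ph0 : 0 < phi n by near: n; exact: near_phi_gt0.
by field; rewrite !gt_eqF.
Unshelve. all: by end_near. Qed.

Lemma V_along_ratio (z w : R^nat) (c l : R) : 0 < l ->
  z @ \oo --> 0^'+ -> w @ \oo --> 0^'+ -> z n / w n @[n --> \oo] --> l ->
  V (w n) / phi n @[n --> \oo] --> c -> V (z n) / phi n @[n --> \oo] --> l `^ (- alpha) * c.
Proof.
move=> l0 z0 w0 zw wc.
have H : V (z n) / V (w n) * (V (w n) / phi n) @[n --> \oo] --> l `^ (- alpha) * c.
  by apply: cvgM => //; exact: V_ratio.
apply: cvg_trans H; apply: near_eq_cvg; have nw := w0 _ near01; near=> n.
have ph0 : 0 < phi n by near: n; exact: near_phi_gt0.
have wn01 : 0 < w n <= 1 by near: n.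
by field; rewrite !gt_eqF ?V_gt0.
Unshelve. all: by end_near. Qed.

Variables (z : R^nat) (lambda : R).
Hypothesis lambda_gt0 : 0 < lambda.
Hypothesis z_cvg0 : z @ \oo --> 0^'+.
Hypothesis z_ratio : z n / Q (Num.truncn (phi n)) @[n --> \oo] --> lambda.

Lemma V_z_phi : V (z n) / phi n @[n --> \oo] --> alpha * lambda `^ (- alpha).
Proof.
have E : (fun n => Num.truncn (1 * phi n)) = (fun n => Num.truncn (phi n)).
  by apply/funext => n; rewrite mul1r.
have py := truncn_phi_infty ltr01; rewrite E in py.
rewrite mulrC; apply: (V_along_ratio _ _ (Q_along py)) => //.
rewrite -[alpha]mulr1; have := V_Q_phi ltr01.
by under eq_fun do rewrite mul1r.
Qed.

(** With [z n = 1 - s] the numerator is [f_n(s) - f_n(0)], the expectation of [s^Z(n)] on survival;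
    this is [diff_asymp] for [N n = n]. *)
Lemma iter_diff_cvg :
  (Q n - iter n g (z n)) / (phi n * h (Q n)) @[n --> \oo] --> lambda `^ (- alpha).
Proof.
apply: (@diff_asymp phi z id) => //; first exact: powR_gt0.
- have H : (fun _ : nat => 1 : R) @ \oo --> (1 : R) by exact: cvg_cst.
  apply: cvg_trans H; apply: near_eq_cvg; near=> n.
  by rewrite divff// pnatr_eq0 -lt0n; near: n; exact: nbhs_infty_gt.
- exact: V_z_phi.
Unshelve. all: by end_near. Qed.

Variable x : R.
Hypothesis x_gt0 : 0 < x.
Let m n := Num.truncn (x * phi n).

Lemma m_infty : m @ \oo --> \oo.
Proof. exact: truncn_phi_infty. Qed.

Lemma m_small : (m n)%:R / n%:R @[n --> \oo] --> (0 : R).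
Proof.
have H : (m n)%:R / phi n * (phi n / n%:R) @[n --> \oo] --> x * 0.
  by apply: cvgM; [exact: truncn_phi_ratio|exact: phi_small].
rewrite mulr0 in H; apply: cvg_trans H; apply: near_eq_cvg; near=> n.
have ph0 : 0 < phi n by near: n; exact: near_phi_gt0.
have n0 : 0 < n%:R :> R by rewrite ltr0n; near: n; exact: nbhs_infty_gt.
by rewrite /m; field; rewrite !gt_eqF.
Unshelve. all: by end_near. Qed.

Lemma near_m_half : \forall n \near \oo, (2 * m n <= n)%N.
Proof.
have /cvgr_lt /(_ (2^-1)) := m_small; rewrite invr_gt0 => /(_ (ltr0Sn _ _)).
apply: filter_app; near=> n.
have n0 : 0 < n%:R :> R by rewrite ltr0n; near: n; exact: nbhs_infty_gt.
rewrite ltr_pdivrMr// ltr_pdivlMl// -natrM ltr_nat => ?; exact: ltnW.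
Unshelve. all: by end_near. Qed.

Let N n := (n - m n)%N.

Lemma N_infty : N @ \oo --> \oo.
Proof.
apply/cvgnyPge => K; near=> n.
have h2 : (2 * m n <= n)%N by near: n; exact: near_m_half.
have hn : (2 * K <= n)%N by near: n; exact: nbhs_infty_ge.
rewrite /N; lia.
Unshelve. all: by end_near. Qed.

Lemma N_ratio : (N n)%:R / n%:R @[n --> \oo] --> (1 : R).
Proof.
have H : 1 - (m n)%:R / n%:R @[n --> \oo] --> (1 : R) - 0.
  by apply: cvgB; [exact: cvg_cst|exact: m_small].
rewrite subr0 in H; apply: cvg_trans H; apply: near_eq_cvg; near=> n.
have h2 : (2 * m n <= n)%N by near: n; exact: near_m_half.
have n0 : 0 < n%:R :> R by rewrite ltr0n; near: n; exact: nbhs_infty_gt.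
rewrite /N natrB; last by apply: leq_trans h2; rewrite leq_pmull.
by field; rewrite gt_eqF.
Unshelve. all: by end_near. Qed.

Lemma g_m_cvg0 : iter (m n) g (z n) @[n --> \oo] --> 0^'+.
Proof.
have nz := z_cvg0 near01.
apply: cvg_to_right0.
  near=> n; have z01 : 0 < z n <= 1 by near: n.
  by have /andP[] := iter_g_itv (m n) z01.
apply/cvgrPdist_lt => e e0; have ne := z_cvg0 (nbhs_right_lt e0).
near=> n; have z01 : 0 < z n <= 1 by near: n.
have ze : z n < e by near: n; exact: ne.
have /andP[i0 i1] := iter_g_itv (m n) z01.
by rewrite sub0r normrN gtr0_norm// (le_lt_trans i1).
Unshelve. all: by end_near. Qed.

(** [m n] steps of [g] add about [alpha x phi n] to [V]. The uniformity in [m] of [V_iter] is what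
    allows the number of steps to grow with [n]. *)
Lemma V_g_m : V (iter (m n) g (z n)) / phi n @[n --> \oo] -->
  alpha * (lambda `^ (- alpha) + x).
Proof.
have H : V (z n) / phi n + alpha * ((m n)%:R / phi n) @[n --> \oo] -->
    alpha * lambda `^ (- alpha) + alpha * x.
  apply: cvgD; first exact: V_z_phi.
  by apply: cvgM; [exact: cvg_cst|exact: truncn_phi_ratio].
rewrite mulrDr; apply/cvgrPdist_le => e e0.
have e20 : 0 < e / 2 by lra.
have e2x : 0 < e / (2 * (x + 1)) by rewrite divr_gt0// mulr_gt0// addr_gt0.
have nH : \forall n \near \oo, `|alpha * lambda `^ (- alpha) + alpha * x -
   (V (z n) / phi n + alpha * ((m n)%:R / phi n))| <= e / 2.
  by move/cvgrPdist_le: H; exact.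
have nV : \forall n \near \oo, forall k : nat,
    `|V (iter k g (z n)) - V (z n) - alpha * k%:R| <= e / (2 * (x + 1)) * k%:R.
  exact: z_cvg0 (V_iter e2x).
have nmx : \forall n \near \oo, (m n)%:R / phi n < x + 1.
  by move/cvgr_lt: (truncn_phi_ratio x_gt0); apply; rewrite ltrDl.
near=> n.
have ph0 : 0 < phi n by near: n; exact: near_phi_gt0.
have H1 : `|V (iter (m n) g (z n)) - V (z n) - alpha * (m n)%:R| <= e / (2 * (x + 1)) * (m n)%:R.
  by move: (m n); near: n.
have H2 : `|alpha * lambda `^ (- alpha) + alpha * x -
   (V (z n) / phi n + alpha * ((m n)%:R / phi n))| <= e / 2 by near: n.
have H3 : (m n)%:R / phi n < x + 1 by near: n.
have H4 : `|V (iter (m n) g (z n)) / phi n - (V (z n) / phi n + alpha * ((m n)%:R / phi n))| <= e / 2.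
  have -> : V (iter (m n) g (z n)) / phi n - (V (z n) / phi n + alpha * ((m n)%:R / phi n)) =
    (V (iter (m n) g (z n)) - V (z n) - alpha * (m n)%:R) / phi n.
    by field; rewrite gt_eqF.
  rewrite normrM normfV (gtr0_norm ph0) ler_pdivrMr//; apply: (le_trans H1).
  have -> : e / 2 * phi n = e / (2 * (x + 1)) * ((x + 1) * phi n).
    by field; rewrite gt_eqF// addr_gt0.
  rewrite ler_pM2l//; move: H3; rewrite ltr_pdivrMr//; exact: ltW.
move: H2 H4; rewrite !ler_norml => /andP[a b] /andP[c d]; apply/andP; split; lra.
Unshelve. all: by end_near. Qed.

(** The transform of [M] at [lambda x^(1/alpha)], since [(lambda x^(1/alpha))^(- alpha) = lambda^(-
    alpha) / x]. *)
Let ell := 1 - ((1 + lambda `^ (- alpha) / x) `^ alpha^-1)^-1.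

Lemma right0_cvg (u : R^nat) : u @ \oo --> 0^'+ -> u @ \oo --> (0 : R).
Proof.
move=> u0; apply/cvgrPdist_lt => e e0.
have H1 := u0 _ (nbhs_right_lt e0); have H2 := u0 _ (nbhs_right_gt 0).
near=> n; have un0 : 0 < u n by near: n; exact: H2.
by rewrite sub0r normrN gtr0_norm//; near: n; exact: H1.
Unshelve. all: by end_near. Qed.

Lemma ell_lt1 : 0 < ell < 1.
Proof.
have l0 : 0 < lambda `^ (- alpha) / x by rewrite divr_gt0// powR_gt0.
have p0 : 0 < (1 + lambda `^ (- alpha) / x) `^ alpha^-1 by rewrite powR_gt0// addr_gt0.
rewrite /ell; apply/andP; split; last by rewrite ltrBlDr ltrDl invr_gt0.
rewrite subr_gt0 invf_lt1//.
have := @gt0_ltr_powR R alpha^-1 _ 1 (1 + lambda `^ (- alpha) / x); rewrite powR1.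
by apply; rewrite ?invr_gt0// ?nnegrE; lra.
Qed.

(** The two values of [V] are about [alpha (lambda^(- alpha) + x) phi n] and [alpha x phi n];
    [V_ratio_inv] takes the root of their quotient. With [s = 1 - z n], one minus the ratio is the
    expectation of [s^Z(m)] given [Z(m) > 0]: this is where the limit law [M] enters. *)
Lemma g_m_ratio : iter (m n) g (z n) / Q (m n) @[n --> \oo] --> 1 - ell.
Proof.
have -> : 1 - ell = (1 + lambda `^ (- alpha) / x) `^ (- alpha^-1).
  by rewrite /ell subKr -powRN.
apply: V_ratio_inv; [exact: g_m_cvg0|exact: (Q_along m_infty)| |].
  by rewrite addr_gt0// divr_gt0// powR_gt0.
have H : V (iter (m n) g (z n)) / phi n * (V (Q (m n)) / phi n)^-1 @[n --> \oo] -->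
    alpha * (lambda `^ (- alpha) + x) * (alpha * x)^-1.
  apply: cvgM; first exact: V_g_m.
  by apply: cvgV; [rewrite mulf_neq0 ?gt_eqF|exact: V_Q_phi].
have -> : 1 + lambda `^ (- alpha) / x = alpha * (lambda `^ (- alpha) + x) * (alpha * x)^-1.
  by field; rewrite !gt_eqF.
apply: cvg_trans H; apply: near_eq_cvg; near=> n.
have ph0 : 0 < phi n by near: n; exact: near_phi_gt0.
by field; rewrite !gt_eqF ?VQ_gt0.
Unshelve. all: by end_near. Qed.

(** The starting point is [1 - (f_m(0) + t (f_m(s) - f_m(0)))], asymptotic to [(1 - t ell) Q m];
    regular variation of [V] turns this factor into [(1 - t ell)^(- alpha)]. *)
Lemma iter_mix_diff_cvg0 (t : R) : 0 <= t <= 1 ->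
  (Q (N n) - iter (N n) g ((1 - t) * Q (m n) + t * iter (m n) g (z n))) /
    (phi n * h (Q n)) @[n --> \oo] --> x * (1 - t * ell) `^ (- alpha).
Proof.
move=> /andP[t0 t1]; have /andP[l0 l1] := ell_lt1.
have tl : 0 < 1 - t * ell by rewrite subr_gt0; nra.
have nz := z_cvg0 near01.
have mixr : ((1 - t) * Q (m n) + t * iter (m n) g (z n)) / Q (m n) @[n --> \oo] --> 1 - t * ell.
  have H : (1 - t) + t * (iter (m n) g (z n) / Q (m n)) @[n --> \oo] --> 1 - t + t * (1 - ell).
    by apply: cvgD; [exact: cvg_cst|apply: cvgM; [exact: cvg_cst|exact: g_m_ratio]].
  have -> : 1 - t * ell = 1 - t + t * (1 - ell) by ring.
  apply: cvg_trans H; apply: near_eq_cvg; near=> n.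
  by field; rewrite gt_eqF//; case/andP: (Q_itv (m n)).
have mix0 : (1 - t) * Q (m n) + t * iter (m n) g (z n) @[n --> \oo] --> 0^'+.
  apply: cvg_to_right0.
    near=> n; have z01 : 0 < z n <= 1 by near: n.
    have /andP[i0 _] := iter_g_itv (m n) z01; have /andP[Q0 _] := Q_itv (m n).
    have [->|t0'] := eqVneq t 0; first by rewrite subr0 mul1r mul0r addr0.
    have tp : 0 < t by rewrite lt_neqAle eq_sym t0'.
    by apply: ltr_wpDl; [rewrite mulr_ge0 ?subr_ge0// ltW|rewrite mulr_gt0].
  have H : (1 - t) * Q (m n) + t * iter (m n) g (z n) @[n --> \oo] --> (1 - t) * 0 + t * 0.
    apply: cvgD; (apply: cvgM; first exact: cvg_cst); apply: right0_cvg.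
      exact: (Q_along m_infty).
    exact: g_m_cvg0.
  by rewrite !mulr0 addr0 in H.
apply: diff_asymp => //.
- by rewrite mulr_gt0// powR_gt0.
- exact: N_infty.
- exact: N_ratio.
have -> : alpha * (x * (1 - t * ell) `^ (- alpha)) = (1 - t * ell) `^ (- alpha) * (alpha * x) by ring.
apply: V_along_ratio mixr _ => //; [exact: (Q_along m_infty)|exact: V_Q_phi].
Unshelve. all: by end_near. Qed.

(** At [t = 0] the starting point is [Q (m n)], whose [N n]-th iterate is [Q n]. Subtracting that
    case replaces [Q (N n)] by [Q n], that is, removes the contribution of extinction. *)
Lemma iter_mix_diff_cvg (t : R) : 0 <= t <= 1 ->
  (iter n g 1 - iter (N n) g ((1 - t) * Q (m n) + t * iter (m n) g (z n))) /
    (phi n * h (Q n)) @[n --> \oo] --> x * ((1 - t * ell) `^ (- alpha) - 1).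
Proof.
move=> t01; have H1 := iter_mix_diff_cvg0 t01.
have := @iter_mix_diff_cvg0 0; rewrite lexx ler01 mul0r subr0 powR1 mulr1 => /(_ isT) H0.
have H : (Q (N n) - iter (N n) g ((1 - t) * Q (m n) + t * iter (m n) g (z n))) /
      (phi n * h (Q n)) -
    (Q (N n) - iter (N n) g (1 * Q (m n) + 0 * iter (m n) g (z n))) / (phi n * h (Q n))
    @[n --> \oo] --> x * (1 - t * ell) `^ (- alpha) - x.
  by apply: cvgB => //; exact: H0.
rewrite mulrBr mulr1; apply: cvg_trans H; apply: near_eq_cvg; near=> n.
have h2 : (2 * m n <= n)%N by near: n; exact: near_m_half.
have ph0 : 0 < phi n by near: n; exact: near_phi_gt0.
have E : iter (N n) g (Q (m n)) = iter n g 1.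
  rewrite /Q -iterD /N subnK//; apply: leq_trans h2; rewrite leq_pmull//.
rewrite /= !mul0r addr0 mul1r -mulrBl E; congr (_ / _); ring.
Unshelve. all: by end_near. Qed.

End regular_variation.

(** * Convergence of moments *)

Section step_polynomial.
Context {R : realType}.

Lemma bernoulli_ge (v : R) r : 0 <= v <= 1 -> 1 - r%:R * v <= (1 - v) ^+ r.
Proof.
move=> /andP[v0 v1]; elim: r => [|r IH]; first by rewrite mul0r subr0 expr0.
have h0 : 0 <= 1 - v by rewrite subr_ge0.
have := ler_wpM2l h0 IH; rewrite -exprS; apply: le_trans.
have r0 : 0 <= r%:R * (v * v) by rewrite mulr_ge0// mulr_ge0.
rewrite -natr1; nra.
Qed.

(** The companion of Bernoulli's inequality, [(1 - v)^r <= 1 / (1 + r v)]. It keeps [step_poly]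
    close to 1 above [b], as [bernoulli_ge] keeps it close to 0 below [b]. *)
Lemma bernoulli_le (v : R) r : 0 <= v <= 1 -> (1 - v) ^+ r * (1 + r%:R * v) <= 1.
Proof.
move=> /andP[v0 v1]; elim: r => [|r IH]; first by rewrite mul0r addr0 expr0 mul1r.
apply: le_trans IH; rewrite exprSr -mulrA ler_wpM2l ?exprn_ge0 ?subr_ge0//.
have r0 : 0 <= r%:R * (v * v) by rewrite mulr_ge0// mulr_ge0.
have v2 : 0 <= v * v by rewrite mulr_ge0.
rewrite -natr1; nra.
Qed.

(* With r ~ b^(-k), 1 - (1 - u^k)^r tends to the indicator of u > b; being divisible by u^k, it is
   integrable against the infinite limit measure of the denominator. *)
Definition step_poly (b : R) (k : nat) : {poly R} :=
  1 - (1 - 'X^k) ^+ (Num.truncn (b^-1 ^+ k)).+1.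

Variables (b : R) (k : nat).
Hypothesis b01 : 0 < b < 1.
Hypothesis k0 : (0 < k)%N.

Let r := (Num.truncn (b^-1 ^+ k)).+1.

Lemma step_polyE u : (step_poly b k).[u] = 1 - (1 - u ^+ k) ^+ r.
Proof. by rewrite /step_poly !hornerE. Qed.

Lemma step_poly_coef0 : (step_poly b k)`_0 = 0.
Proof. by rewrite -horner_coef0 step_polyE expr0n eqn0Ngt k0 /= subr0 expr1n subrr. Qed.

Lemma r_ge : b^-1 ^+ k <= r%:R :> R.
Proof. by rewrite ltW// truncnS_gt. Qed.

(** Rounding up adds at most 1, and [b^(- k) >= 1]. *)
Lemma r_le : r%:R <= 2 * b^-1 ^+ k.
Proof.
have /andP[b0 b1] := b01.
have b11 : 1 <= b^-1 ^+ k by rewrite exprn_ege1// -invr1 lef_pV2 ?posrE// ltW.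
have : (Num.truncn (b^-1 ^+ k))%:R <= b^-1 ^+ k by rewrite truncn_le ?(le_trans _ b11).
by rewrite /r -natr1; lra.
Qed.

Lemma pow01 (u : R) : 0 <= u <= 1 -> 0 <= u ^+ k <= 1.
Proof. by move=> /andP[u0 u1]; rewrite exprn_ge0//= exprn_ile1. Qed.

Lemma step_poly_ge0 u : 0 <= u <= 1 -> 0 <= (step_poly b k).[u].
Proof.
move=> /pow01/andP[u0 u1].
by rewrite step_polyE subr_ge0 exprn_ile1// ?subr_ge0// lerBlDr lerDl.
Qed.

Lemma step_poly_le1 u : 0 <= u <= 1 -> (step_poly b k).[u] <= 1.
Proof. by move=> /pow01/andP[u0 u1]; rewrite step_polyE lerBlDr lerDl exprn_ge0// subr_ge0. Qed.

Lemma step_poly_le u : 0 <= u <= 1 -> (step_poly b k).[u] <= 2 * (u / b) ^+ k.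
Proof.
move=> u01; have /andP[v0 v1] := pow01 u01.
have := bernoulli_ge r (pow01 u01); rewrite step_polyE => H.
apply: (@le_trans _ _ (r%:R * u ^+ k)); first by lra.
have -> : 2 * (u / b) ^+ k = 2 * b^-1 ^+ k * u ^+ k by rewrite exprMn; ring.
by rewrite ler_wpM2r// r_le.
Qed.

Lemma step_poly_ge u : 0 < u <= 1 -> 1 - (b / u) ^+ k <= (step_poly b k).[u].
Proof.
move=> /andP[u0 u1]; have u01 : 0 <= u <= 1 by rewrite ltW.
have /andP[b0 b1] := b01.
have := bernoulli_le r (pow01 u01); rewrite step_polyE => H.
rewrite lerD2l lerN2.
have uk0 : 0 < u ^+ k by rewrite exprn_gt0.
have bk0 : 0 < b ^+ k by rewrite exprn_gt0.
have B : 1 <= b ^+ k * r%:R by rewrite mulrC -ler_pdivrMr// div1r -exprVn; exact: r_ge.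
rewrite expr_div_n ler_pdivlMr//.
have A0 : 0 <= (1 - u ^+ k) ^+ r.
  by rewrite exprn_ge0// subr_ge0; case/andP: (pow01 u01).
have H2 : (1 - u ^+ k) ^+ r * (r%:R * u ^+ k) <= 1.
  apply: le_trans H; rewrite ler_wpM2l//; lra.
have : (1 - u ^+ k) ^+ r * u ^+ k * (b ^+ k * r%:R) <= b ^+ k.
  have -> : (1 - u ^+ k) ^+ r * u ^+ k * (b ^+ k * r%:R) =
    b ^+ k * ((1 - u ^+ k) ^+ r * (r%:R * u ^+ k)) by ring.
  by rewrite ler_piMr// ltW.
by apply: le_trans; apply: ler_peMr => //; rewrite mulr_ge0// ltW.
Qed.

End step_polynomial.

(** * From moments to masses above a threshold *)

Section moment_convergence.
Context {R : realType}.
Variables (Lam : nat -> {poly R} -> R) (lam : {poly R} -> R) (F : R^nat) (G : R -> R) (a : R).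
Hypothesis a01 : 0 < a < 1.
Hypothesis Lam_cvg : forall p : {poly R}, p`_0 = 0 -> Lam n p @[n --> \oo] --> lam p.
Hypothesis lamB : forall p q : {poly R}, p`_0 = 0 -> q`_0 = 0 -> lam (p - q) = lam p - lam q.
Hypothesis lamZ : forall (c : R) (p : {poly R}), p`_0 = 0 -> lam (c *: p) = c * lam p.
Hypothesis F_le : forall n (p : {poly R}), p`_0 = 0 ->
  (forall u : R, 0 <= u <= 1 -> (a <= u)%R%:R <= p.[u]) -> F n <= Lam n p.
Hypothesis F_ge : forall n (p : {poly R}), p`_0 = 0 ->
  (forall u : R, 0 <= u <= 1 -> p.[u] <= (a <= u)%R%:R) -> Lam n p <= F n.
Hypothesis lam_step : forall b : R, 0 < b < 1 -> lam (step_poly b k) @[k --> \oo] --> G b.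
Hypothesis G_cont : forall b : R^nat, (forall n, 0 < b n < 1) -> b @ \oo --> a ->
  G (b n) @[n --> \oo] --> G a.

(** In the application [Lam n] and [lam] integrate polynomials against the [n]-th law and the limit
    measure; [F] and [G b] are the masses above [a] and [b]. A step at [b < a] is at least
    [1 - (b / a)^k] above [a]; divided by this it majorises the indicator, at a cost that vanishes
    as [k] grows. *)
Lemma F_limsup (e b : R) : 0 < e -> 0 < b < a -> \forall n \near \oo, F n <= G b + e.
Proof.
move=> e0 /andP[b0 ba]; have /andP[a0 a1] := a01.
have b01 : 0 < b < 1 by rewrite b0 (lt_trans ba).
have q01 : `|b / a| < 1 by rewrite gtr0_norm ?divr_gt0// ltr_pdivrMr// mul1r.
have qc : (1 - (b / a) ^+ k)^-1 @[k --> \oo] --> (1 : R).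
  have H : (1 - (b / a) ^+ k)^-1 @[k --> \oo] --> (1 - 0 : R)^-1.
    apply: cvgV; first by rewrite subr0 oner_neq0.
    by apply: cvgB; [exact: cvg_cst|exact: cvg_expr].
  by rewrite subr0 invr1 in H.
have H : (1 - (b / a) ^+ k)^-1 * lam (step_poly b k) @[k --> \oo] --> 1 * G b.
  by apply: cvgM => //; exact: lam_step.
rewrite mul1r in H.
have Ge : G b < G b + e / 2 by rewrite ltrDl; lra.
have nH : \forall k \near \oo, (1 - (b / a) ^+ k)^-1 * lam (step_poly b k) < G b + e / 2.
  by move/cvgr_lt: H; exact.
have [k /= [k0 kH]] : exists k, (0 < k)%N /\ (1 - (b / a) ^+ k)^-1 * lam (step_poly b k) < G b + e / 2.
  have [K _ KP] := filterI nH (nbhs_infty_gt 0).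
  by exists K; have [] := KP K (leqnn K).
pose c := (1 - (b / a) ^+ k)^-1.
have c0 : 0 < c.
  rewrite invr_gt0 subr_gt0 exprn_ilt1 -?lt0n//; first by rewrite divr_ge0// ltW.
  by move: q01; rewrite gtr0_norm// divr_gt0.
have cp0 : (c *: step_poly b k)`_0 = 0 by rewrite coefZ step_poly_coef0// mulr0.
have Fle n : F n <= Lam n (c *: step_poly b k).
  apply: F_le => // u u01; rewrite hornerZ.
  have [au|au] := leP a u; last by rewrite mulr_ge0// ?step_poly_ge0// ltW.
  have u0 : 0 < u by rewrite (lt_le_trans a0).
  rewrite /c -ler_pdivrMl// invrK mulr1.
  have := @step_poly_ge _ b k b01 u; rewrite u0; case/andP: u01 => _ -> /(_ isT).
  apply: le_trans; rewrite lerD2l lerN2 lerXn2r ?nnegrE ?divr_ge0 ?(ltW b0) ?(ltW u0) ?(ltW a0)//.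
  by rewrite ler_pM2l// lef_pV2.
have := Lam_cvg cp0; rewrite lamZ ?step_poly_coef0// => /cvgr_lt /(_ (G b + e)).
move=> /(_ _)/filterS; apply; last by rewrite (lt_trans kH)// ltrD2l; lra.
by move=> n /ltW; exact: le_trans.
Qed.

(** A step at [b > a] exceeds the indicator on [[0, a[] by at most [2 (u / b)^k]. A constant may not
    be subtracted, as the polynomial must vanish at 0, so a multiple of ['X] absorbs the excess. *)
Lemma F_liminf (e b : R) : 0 < e -> a < b < 1 -> \forall n \near \oo, G b - e <= F n.
Proof.
move=> e0 /andP[ab b1]; have /andP[a0 a1] := a01.
have b0 : 0 < b by rewrite (lt_trans a0).
have b01 : 0 < b < 1 by rewrite b0.
have q01 : `|a / b| < 1 by rewrite gtr0_norm ?divr_gt0// ltr_pdivrMr// mul1r.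
have H : lam (step_poly b k) - 2 / b * (b / a) * (a / b) ^+ k * lam 'X @[k --> \oo] -->
    G b - 2 / b * (b / a) * 0 * lam 'X.
  apply: cvgB; first exact: lam_step.
  apply: cvgM; last exact: cvg_cst.
  by apply: cvgM; [exact: cvg_cst|exact: cvg_expr].
rewrite mulr0 mul0r subr0 in H.
have Ge : G b - e / 2 < G b by rewrite ltrBlDr ltrDl; lra.
have nH : \forall k \near \oo, G b - e / 2 < lam (step_poly b k) - 2 / b * (b / a) * (a / b) ^+ k * lam 'X.
  by move/cvgr_gt: H; exact.
have [k /= [k0 kH]] : exists k, (0 < k)%N /\
    G b - e / 2 < lam (step_poly b k) - 2 / b * (b / a) * (a / b) ^+ k * lam 'X.
  have [K _ KP] := filterI nH (nbhs_infty_gt 0).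
  by exists K; have [] := KP K (leqnn K).
(* For [u < a]: [2 (u / b)^k <= 2 (u / b) (a / b)^(k - 1) = c u]. *)
pose c := 2 / b * (b / a) * (a / b) ^+ k.
have p0 : (step_poly b k - c *: 'X)`_0 = 0.
  by rewrite coefB coefZ coefX mulr0 subr0 step_poly_coef0.
have Fge n : Lam n (step_poly b k - c *: 'X) <= F n.
  apply: F_ge => // u u01; rewrite hornerD hornerN hornerZ hornerX.
  have c0 : 0 <= c by rewrite /c !mulr_ge0// ?invr_ge0 ?exprn_ge0 ?mulr_ge0 ?invr_ge0// ltW.
  have /andP[u0 u1] := u01.
  have [au|au] := leP a u.
    have := @step_poly_le1 _ b k u u01; have : 0 <= c * u by rewrite mulr_ge0.
    by rewrite /= mulr1n; lra.
  rewrite subr_le0; apply: (le_trans (step_poly_le _ _ u01)) => //.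
  have -> : c * u = 2 * ((u / b) * (a / b) ^+ k.-1).
    rewrite /c -{1}(prednK k0) exprS; field.
    by rewrite !gt_eqF.
  rewrite ler_pM2l// -{1}(prednK k0) exprS ler_wpM2l ?divr_ge0 ?(ltW b0)//.
  by rewrite lerXn2r ?nnegrE ?divr_ge0 ?(ltW b0) ?(ltW a0)// ler_pM2r ?invr_gt0// ltW.
have X0 : ('X : {poly R})`_0 = 0 by rewrite coefX.
have cX0 : (c *: 'X : {poly R})`_0 = 0 by rewrite coefZ X0 mulr0.
have := Lam_cvg p0; rewrite lamB ?step_poly_coef0// lamZ// => /cvgr_gt /(_ (G b - e)).
move=> /(_ _)/filterS; apply; last first.
  by apply: lt_trans kH; rewrite ltrD2l ltrN2; lra.
by move=> n /ltW /le_trans; apply.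
Qed.

Lemma moment_cvg : F @ \oo --> G a.
Proof.
have /andP[a0 a1] := a01.
apply/cvgrPdist_le => e e0.
have e20 : 0 < e / 2 by lra.
pose bl (n : nat) := a - a / 2 / n.+1%:R.
pose bu (n : nat) := a + (1 - a) / 2 / n.+1%:R.
have ninv n : 0 < (n.+1%:R : R)^-1 <= 1.
  by rewrite invr_gt0 ltr0n/= invf_le1 ?ltr0n// ler1n.
have blP n : 0 < bl n < a.
  by have := ninv n; rewrite /bl; move: (n.+1%:R^-1) => y /andP[y0 y1]; apply/andP; split; nra.
have buP n : a < bu n < 1.
  by have := ninv n; rewrite /bu; move: (n.+1%:R^-1) => y /andP[y0 y1]; apply/andP; split; nra.
have inv0 : (n.+1%:R : R)^-1 @[n --> \oo] --> (0 : R) by exact: cvg_harmonic.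
have blc : G (bl n) @[n --> \oo] --> G a.
  apply: G_cont => [n|]; first by have /andP[-> /lt_trans ->] := blP n.
  rewrite -[X in _ --> X](subr0 a) -(mulr0 (a / 2)); apply: cvgB; first exact: cvg_cst.
  by apply: cvgM => //; exact: cvg_cst.
have buc : G (bu n) @[n --> \oo] --> G a.
  apply: G_cont => [n|]; first by have /andP[/(lt_trans a0) -> ->] := buP n.
  rewrite -[X in _ --> X](addr0 a) -(mulr0 ((1 - a) / 2)); apply: cvgD; first exact: cvg_cst.
  by apply: cvgM => //; exact: cvg_cst.
have [N1 _ /(_ N1 (leqnn N1)) /= H1] : \forall n \near \oo, `|G a - G (bl n)| <= e / 2.
  by move/cvgrPdist_le: blc; exact.
have [N2 _ /(_ N2 (leqnn N2)) /= H2] : \forall n \near \oo, `|G a - G (bu n)| <= e / 2.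
  by move/cvgrPdist_le: buc; exact.
have nU := F_limsup e20 (blP N1); have nL := F_liminf e20 (buP N2).
near=> n.
have U : F n <= G (bl N1) + e / 2 by near: n.
have L : G (bu N2) - e / 2 <= F n by near: n.
move: H1 H2; rewrite !ler_norml => /andP[A B] /andP[C D]; apply/andP; split; lra.
Unshelve. all: by end_near. Qed.

End moment_convergence.

(** * Integration of polynomials against a possibly infinite measure *)

Section limit_functional.
Context {R : realType} {d : measure_display} {T : measurableType d}.
Variables (mu : {measure set T -> \bar R}) (D : set T) (U : T -> R).
Hypothesis mD : measurable D.
Hypothesis mU : measurable_fun D U.
Hypothesis U01 : forall x, D x -> 0 <= U x <= 1.
Hypothesis intU : mu.-integrable D (EFin \o U).
Hypothesis U_null : forall b : R, 0 < b < 1 -> mu (D `&` U @^-1` [set b]) = 0%E.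

Let lam (p : {poly R}) : R := \int[mu]_(x in D) p.[U x].
Let G (b : R) : R := \int[mu]_(x in D) (b <= U x)%R%:R.

Lemma measurable_poly (p : {poly R}) : measurable_fun D (fun x => p.[U x]).
Proof.
apply: measurableT_comp mU; apply: continuous_measurable_fun; exact: continuous_horner.
Qed.

Lemma integrable_monomial (c : R) i : (i == 0%N) ==> (c == 0) ->
  mu.-integrable D (fun x => (c * U x ^+ i)%:E).
Proof.
case: i => [/= /eqP ->|i _].
  by under eq_fun do rewrite mul0r; exact: integrable0.
under eq_fun do rewrite EFinM; apply: integrableZl => //.
apply: le_integrable intU => //.
  by apply/measurable_EFinP; exact: measurable_funX.
move=> x Dx /=; have /andP[u0 u1] := U01 Dx.
by rewrite lee_fin !ger0_norm ?exprn_ge0// exprS ler_piMr// exprn_ile1.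
Qed.

Lemma coef_cond (p : {poly R}) i : p`_0 = 0 -> (i == 0%N) ==> (p`_i == 0).
Proof. by move=> p0; case: i => [|//]; rewrite p0 !eqxx. Qed.

Lemma integrable_poly (p : {poly R}) : p`_0 = 0 -> mu.-integrable D (fun x => p.[U x]%:E).
Proof.
move=> p0.
have -> : (fun x => p.[U x]%:E) = (fun x => \sum_(i < size p) (p`_i * U x ^+ i)%:E)%E.
  by apply/funext => x; rewrite horner_coef sumEFin.
by apply: integrable_sum => // i _; apply: integrable_monomial; exact: coef_cond.
Qed.

Lemma limit_functional_monomials (p : {poly R}) : p`_0 = 0 ->
  lam p = \sum_(i < size p) p`_i * \int[mu]_(x in D) (U x ^+ i).
Proof.
move=> p0; rewrite /lam /Rintegral.
have -> : (\int[mu]_(x in D) (p.[U x])%:E = \sum_(i < size p) \int[mu]_(x in D) (p`_i * U x ^+ i)%:E)%E.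
  rewrite -integral_sum//; last by move=> i; apply: integrable_monomial; exact: coef_cond.
  by apply: eq_integral => x _; rewrite horner_coef sumEFin.
rewrite (eq_bigr (fun i : 'I_(size p) => (p`_i * \int[mu]_(x in D) (U x ^+ i))%:E)).
  by rewrite sumEFin.
move=> i _; have [->|pi0] := eqVneq p`_i 0.
  by rewrite mul0r; under eq_integral do rewrite mul0r; rewrite integral0.
have i0 : (val i == 0%N) ==> ((1 : R) == 0).
  by apply/implyP => /eqP i0; rewrite i0 p0 eqxx in pi0.
have := @integrable_monomial 1 i i0; under eq_fun do rewrite mul1r; move=> intUi.
rewrite -(RintegralZl _ mD intUi) /Rintegral fineK//.
by apply: integrable_fin_num => //; apply: integrable_monomial; exact: coef_cond.
Qed.

Lemma limit_functionalB (p q : {poly R}) : p`_0 = 0 -> q`_0 = 0 -> lam (p - q) = lam p - lam q.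
Proof.
move=> p0 q0; rewrite /lam -RintegralB//; [|exact: integrable_poly|exact: integrable_poly].
by apply: eq_Rintegral => x _; rewrite hornerD hornerN.
Qed.

Lemma limit_functionalZ (c : R) (p : {poly R}) : p`_0 = 0 -> lam (c *: p) = c * lam p.
Proof.
move=> p0; rewrite /lam -RintegralZl//; last exact: integrable_poly.
by apply: eq_Rintegral => x _; rewrite hornerZ.
Qed.

Lemma measurable_step (b : R) : measurable_fun D (fun x => (b <= U x)%R%:R : R).
Proof.
have -> : (fun x => (b <= U x)%R%:R : R) = \1_(`[b, +oo[%classic) \o U.
  by apply/funext => x /=; rewrite indicE mem_setE/= in_itv/= andbT.
by apply: measurableT_comp mU; exact: measurable_indic.
Qed.

(** [mu] may be infinite on [D], where constants are not integrable; domination is therefore by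
    multiples of [U]. The exceptional set [U = b] covers the jump of a limiting indicator. *)
Lemma Rintegral_dominated (C : R) (F : nat -> T -> R) (f : T -> R) (b : R) : 0 < b < 1 ->
  (forall n, measurable_fun D (F n)) -> measurable_fun D f ->
  (forall n x, D x -> `|F n x| <= C * U x) ->
  (forall x, D x -> U x != b -> F ^~ x @ \oo --> f x) ->
  \int[mu]_(x in D) F n x @[n --> \oo] --> \int[mu]_(x in D) f x.
Proof.
move=> b01 mF mf FC Ff.
have [|||||intf _ H] := @dominated_convergence _ _ _ mu D mD (fun n => EFin \o F n) (EFin \o f)
  (fun x => (C * U x)%:E).
- by move=> n; apply/measurable_EFinP.
- by apply/measurable_EFinP.
- exists (D `&` U @^-1` [set b]); split; first exact: mU.
    exact: U_null.
  move=> x /= /not_implyP[Dx xb]; split=> //; apply/eqP; apply: contra_notT xb => xb.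
  by apply/fine_cvgP; split; [exact: nearW|exact: Ff].
- by under eq_fun do rewrite EFinM; exact: integrableZl.
- by apply: aeW => x n Dx; rewrite lee_fin; exact: FC.
rewrite /Rintegral; apply: fine_cvg.
by rewrite fineK//; exact: integrable_fin_num.
Qed.

Lemma limit_functional_step (b : R) : 0 < b < 1 -> lam (step_poly b k) @[k --> \oo] --> G b.
Proof.
move=> b01; have /andP[b0 b1] := b01.
(* At [k = 0] the polynomial is 1 everywhere on the range of [U], which no multiple of [U]
   dominates; exponents start at 1. *)
rewrite -cvg_shiftS /=.
apply: (@Rintegral_dominated (2 / b) (fun n x => (step_poly b n.+1).[U x]) _ b) => //.
- by move=> n; exact: measurable_poly.
- exact: measurable_step.
- move=> n x Dx; have u01 := U01 Dx; have /andP[u0 u1] := u01.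
  rewrite ger0_norm ?step_poly_ge0//.
  have [ub|ub] := leP (U x) b.
    apply: (le_trans (step_poly_le n.+1 b01 u01)).
    rewrite mulrAC -mulrA ler_pM2l// exprS ler_piMr ?divr_ge0 ?(ltW b0)//.
    by rewrite exprn_ile1 ?divr_ge0 ?(ltW b0)// ler_pdivrMr// mul1r.
  apply: (le_trans (step_poly_le1 _ _ u01)) => //.
  by rewrite mulrAC ler_pdivlMr// mul1r; lra.
- move=> x Dx Ub; have u01 := U01 Dx; have /andP[u0 u1] := u01.
  have [ub|ub|ub] := ltgtP (U x) b; last by rewrite ub eqxx in Ub.
    have q1 : `|U x / b| < 1 by rewrite ger0_norm ?divr_ge0 ?(ltW b0)// ltr_pdivrMr// mul1r.
    have H : 2 * (U x / b) ^+ n.+1 @[n --> \oo] --> 2 * (0 : R).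
      by apply: cvgM; [exact: cvg_cst|rewrite (cvg_shiftS (fun n => (U x / b) ^+ n)); exact: cvg_expr].
    have Z : (fun _ : nat => 0 : R) @ \oo --> (0 : R) by exact: cvg_cst.
    rewrite mulr0 in H; apply: squeeze_cvgr Z H; near=> n.
    by rewrite step_poly_ge0//= step_poly_le.
  have q1 : `|b / U x| < 1.
    by rewrite ger0_norm ?divr_ge0 ?(ltW b0)// ltr_pdivrMr ?mul1r// (lt_trans b0).
  have H : 1 - (b / U x) ^+ n.+1 @[n --> \oo] --> 1 - (0 : R).
    by apply: cvgB; [exact: cvg_cst|rewrite (cvg_shiftS (fun n => (b / U x) ^+ n)); exact: cvg_expr].
  have Z : (fun _ : nat => 1 : R) @ \oo --> (1 : R) by exact: cvg_cst.
  rewrite subr0 in H; rewrite /= mulr1n; apply: squeeze_cvgr H Z; near=> n.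
  by rewrite step_poly_le1// andbT step_poly_ge// u1 (lt_trans b0).
Unshelve. all: by end_near. Qed.

Lemma limit_functional_cont (a : R) (b : R^nat) : 0 < a < 1 -> b @ \oo --> a ->
  G (b n) @[n --> \oo] --> G a.
Proof.
move=> a01 ba; have /andP[a0 a1] := a01.
(* Flooring the threshold at [a / 2] keeps the indicators below [(2 / a) U]; eventually the floor is
   inactive. *)
have H : \int[mu]_(x in D) (Num.max (b n) (a / 2) <= U x)%R%:R @[n --> \oo] --> G a.
  apply: (@Rintegral_dominated (2 / a) (fun n x => (Num.max (b n) (a / 2) <= U x)%R%:R) _ a) => //.
  - by move=> n; exact: measurable_step.
  - exact: measurable_step.
  - move=> n x Dx; have /andP[u0 u1] := U01 Dx.
    rewrite ger0_norm//; have [bu|bu] := leP (Num.max (b n) (a / 2)) (U x); last first.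
      by rewrite mulr_ge0// divr_ge0// ltW.
    rewrite /= mulr1n mulrAC ler_pdivlMr// mul1r.
    by move: bu; rewrite ge_max => /andP[_]; lra.
  - move=> x Dx Ua.
    have Z (c : R) : (fun _ : nat => c) @ \oo --> c by exact: cvg_cst.
    have [ua|ua|ua] := ltgtP (U x) a; last by rewrite ua eqxx in Ua.
      apply: cvg_trans (Z _); apply: near_eq_cvg; near=> n.
      have : U x < b n by near: n; move/cvgr_gt: ba; exact.
      by move=> h; rewrite leNgt lt_max h.
    apply: cvg_trans (Z _); apply: near_eq_cvg; near=> n.
    have : b n < U x by near: n; move/cvgr_lt: ba; exact.
    by move=> h; rewrite ge_max (ltW h)/= (_ : a / 2 <= U x)//; lra.
apply: cvg_trans H; apply: near_eq_cvg; near=> n.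
have h : a / 2 < b n by near: n; move/cvgr_gt: ba; apply; lra.
by rewrite (max_idPl (ltW h)).
Unshelve. all: by end_near. Qed.

End limit_functional.

Lemma cvg_sum_nat {R : realType} (I : Type) (r : seq I) (Q : pred I) (F : I -> R^nat) (l : I -> R) :
  (forall i, F i @ \oo --> l i) -> \sum_(i <- r | Q i) F i n @[n --> \oo] --> \sum_(i <- r | Q i) l i.
Proof.
move=> Fl; elim: r => [|i r IH].
  by rewrite big_nil; under eq_fun do rewrite big_nil; exact: cvg_cst.
rewrite big_cons; under eq_fun do rewrite big_cons; case: (Q i) => //.
by apply: cvgD.
Qed.

Section bounded_expectation.
Context {R : realType} {d : measure_display} {T : measurableType d}.
Variable P : probability T R.

Lemma bounded_integrable (f : T -> R) (K : R) : measurable_fun setT f ->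
  (forall w, `|f w| <= K) -> P.-integrable setT (EFin \o f).
Proof.
move=> mf fK; apply: measurable_bounded_integrable => //.
  exact: (le_lt_trans (probability_le1 P measurableT) (ltry _)).
exists K; split; first exact: num_real.
by move=> M KM w _; exact: le_trans (fK w) (ltW KM).
Qed.

Lemma horner_bound (p : {poly R}) u : 0 <= u <= 1 -> `|p.[u]| <= \sum_(i < size p) `|p`_i|.
Proof.
move=> /andP[u0 u1]; rewrite horner_coef; apply: (le_trans (ler_norm_sum _ _ _)).
apply: ler_sum => i _; rewrite normrM ler_piMr// ger0_norm ?exprn_ge0// exprn_ile1//.
Qed.

Variables (W U : nat -> T -> R) (K : R^nat).
Hypothesis mW : forall n, measurable_fun setT (W n).
Hypothesis W_itv : forall n w, 0 <= W n w <= K n.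
Hypothesis mU : forall n, measurable_fun setT (U n).
Hypothesis U01 : forall n w, 0 <= U n w <= 1.

Let mpoly n (p : {poly R}) : measurable_fun setT (fun w => W n w * p.[U n w]).
Proof.
apply: measurable_funM => //; apply: measurableT_comp (mU n).
by apply: continuous_measurable_fun; exact: continuous_horner.
Qed.

Let ipoly n (p : {poly R}) : P.-integrable setT (EFin \o (fun w => W n w * p.[U n w])).
Proof.
apply: (@bounded_integrable _ (K n * \sum_(i < size p) `|p`_i|)) => // w.
have /andP[w0 w1] := W_itv n w.
by rewrite normrM ler_pM// ?horner_bound// ger0_norm.
Qed.

Let istep n (a : R) : P.-integrable setT (EFin \o (fun w => W n w * (a <= U n w)%R%:R)).
Proof.
apply: (@bounded_integrable _ (K n * 1)) => [|w].
  apply: measurable_funM => //.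
  have -> : (fun w => (a <= U n w)%R%:R : R) = \1_(`[a, +oo[%classic) \o U n.
    by apply/funext => x /=; rewrite indicE mem_setE/= in_itv/= andbT.
  by apply: measurableT_comp (mU n); exact: measurable_indic.
have /andP[w0 w1] := W_itv n w.
rewrite normrM ler_pM//; first by rewrite ger0_norm.
by have [_|_] := leP a (U n w); rewrite ?normr1 ?normr0.
Qed.

Context {d' : measure_display} {T' : measurableType d'}.
Variables (mu : {measure set T' -> \bar R}) (D : set T') (V : T' -> R) (C : R).
Hypothesis mD : measurable D.
Hypothesis mV : measurable_fun D V.
Hypothesis V01 : forall x, D x -> 0 <= V x <= 1.
Hypothesis intV : mu.-integrable D (EFin \o V).
Hypothesis V_null : forall b : R, 0 < b < 1 -> mu (D `&` V @^-1` [set b]) = 0%E.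
Hypothesis moments : forall i, (0 < i)%N ->
  \int[P]_w (W n w * U n w ^+ i) @[n --> \oo] --> C * \int[mu]_(x in D) (V x ^+ i).

(** [W] will be a normalising factor times an indicator. Convergence is assumed for moments of
    positive order only, so the total mass on the left may diverge and [mu] may be infinite. *)
Lemma moment_convergence (a : R) : 0 < a < 1 ->
  \int[P]_w (W n w * (a <= U n w)%R%:R) @[n --> \oo] -->
    C * \int[mu]_(x in D) (a <= V x)%R%:R.
Proof.
move=> a01.
apply: (@moment_cvg R (fun n p => \int[P]_w (W n w * p.[U n w]))
  (fun p => C * \int[mu]_(x in D) p.[V x]) _
  (fun b => C * \int[mu]_(x in D) (b <= V x)%R%:R)) => //.
- move=> p p0.
  rewrite (limit_functional_monomials mD mV V01 intV p0) mulr_sumr.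
  have -> : (fun n => \int[P]_w (W n w * p.[U n w])) =
      (fun n => \sum_(i < size p) p`_i * \int[P]_w (W n w * U n w ^+ i)).
    apply/funext => n.
    have iX i : P.-integrable setT (EFin \o (fun w => W n w * U n w ^+ i)).
      have := ipoly n ('X^i); congr (_.-integrable _ _).
      by apply/funext => w /=; rewrite hornerXn.
    have iX' i : P.-integrable setT (EFin \o (fun w => p`_i * (W n w * U n w ^+ i))).
      rewrite (_ : EFin \o _ = (fun w => (p`_i)%:E * (W n w * U n w ^+ i)%R%:E)%E).
        by apply: integrableZl => //; exact: iX.
      by apply/funext => w.
    transitivity (\int[P]_w (\sum_(i < size p) p`_i * (W n w * U n w ^+ i))).
      apply: eq_Rintegral => w _; rewrite horner_coef mulr_sumr.
      by apply: eq_bigr => i _; ring.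
    rewrite /Rintegral; under eq_integral do rewrite -sumEFin.
    rewrite (integral_sum measurableT (fun i : 'I_(size p) => iX' i)).
    rewrite (eq_bigr (fun i : 'I_(size p) => (p`_i * \int[P]_w (W n w * U n w ^+ i))%:E)).
      by rewrite sumEFin.
    move=> i _; rewrite -(RintegralZl _ _ (iX i))// fineK//.
    by apply: integrable_fin_num => //; exact: iX'.
  apply: (@cvg_sum_nat _ _ _ _ (fun (i : 'I_(size p)) n => p`_i * \int[P]_w (W n w * U n w ^+ i))
    (fun i : 'I_(size p) => C * (p`_i * \int[mu]_(x in D) (V x ^+ i)))) => i; have [i0|i0] := posnP i.
    by rewrite i0 p0 mul0r mulr0; under eq_fun do rewrite mul0r; exact: cvg_cst.
  by rewrite mulrCA; apply: cvgM; [exact: cvg_cst|exact: moments].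
- by move=> p q p0 q0; rewrite (limit_functionalB mD mV V01 intV p0 q0) mulrBr.
- by move=> c p p0; rewrite (limit_functionalZ mD mV V01 intV _ p0) mulrCA.
- move=> n p p0 H; apply: le_Rintegral => // w _.
  by rewrite ler_wpM2l ?H//; case/andP: (W_itv n w).
- move=> n p p0 H; apply: le_Rintegral => // w _.
  by rewrite ler_wpM2l ?H//; case/andP: (W_itv n w).
- move=> b b01; apply: cvgM; first exact: cvg_cst.
  exact: (limit_functional_step mD mV V01 intV V_null b01).
- move=> b b01 ba; apply: cvgM; first exact: cvg_cst.
  exact: (limit_functional_cont mD mV V01 intV V_null a01 ba).
Qed.

End bounded_expectation.

(** * Extraction of the coefficients in [t] *)

Section binomial_series.
Context {R : realType}.

Definition rising (a : R) (i : nat) : R := \prod_(k < i) (a + k%:R).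

(** The coefficient of [u^i] in the power series of [(1 - u)^(- a)]. *)
Definition neg_binomial (a : R) (i : nat) : R := rising a i / i`!%:R.

Lemma neg_binomialS (a : R) i :
  i.+1%:R * neg_binomial a i.+1 = a * neg_binomial (a + 1) i.
Proof.
rewrite /neg_binomial /rising big_ord_recl factS natrM.
have -> : \prod_(k < i) (a + (lift ord0 k)%:R) = \prod_(k < i) (a + 1 + k%:R).
  by apply: eq_bigr => k _; rewrite /= /bump/= natrD addrA.
rewrite addr0; field.
by rewrite pnatr_eq0 -lt0n fact_gt0 nat1r pnatr_eq0.
Qed.

(** Induction on [j] for all [a] at once: the derivative of the remainder is [a] times the remainder
    of order [j] for the exponent [a + 1], and the mean value theorem gains one power of [u]. The
    bound 1/2 keeps away from the singularity at 1. *)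
Lemma neg_binomial_taylor j (a : R) : 0 < a -> exists2 K : R, 0 <= K &
  forall u, 0 <= u <= 2^-1 ->
    `|(1 - u) `^ (- a) - \sum_(i < j) neg_binomial a i * u ^+ i| <= K * u ^+ j.
Proof.
elim: j a => [|j IH] a a0.
  exists (2 `^ a); first exact: powR_ge0.
  move=> u /andP[u0 u1]; rewrite big_ord0 subr0 expr0 mulr1 ger0_norm ?powR_ge0//.
  have u2 : 0 < 1 - u by lra.
  rewrite powRN -[leLHS]mul1r ler_pdivrMr ?powR_gt0// -powRM ?(ltW u2)//.
  have := @ge0_ler_powR R a (ltW a0) 1 (2 * (1 - u)); rewrite powR1.
  by apply; rewrite ?nnegrE; lra.
have [K K0 HK] := IH (a + 1) ltac:(by rewrite addr_gt0).
exists (a * K); first by rewrite mulr_ge0// ltW.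
move=> u /andP[u0 u1].
pose p := \poly_(i < j.+1) neg_binomial a i.
have pE x : p.[x] = \sum_(i < j.+1) neg_binomial a i * x ^+ i by rewrite horner_poly.
have dpE x : p^`().[x] = \sum_(i < j) a * (neg_binomial (a + 1) i * x ^+ i).
  have -> : p^`() = \poly_(i < j) (a * neg_binomial (a + 1) i).
    apply/polyP => i; rewrite coef_deriv !coef_poly ltnS; case: ifP => _; last by rewrite mul0rn.
    by rewrite -neg_binomialS mulr_natl.
  by rewrite horner_poly; apply: eq_bigr => i _; rewrite mulrA.
pose f x := (1 - x) `^ (- a) - p.[x].
pose df (x : R) : R := - a * (1 - x) `^ (- a - 1) * - 1 - p^`().[x].
have fd (x : R) : x < 1 -> is_derive x 1 f (df x).
  move=> x1.
  have d1 : is_derive x 1 (fun x : R => 1 - x) (- 1).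
    by rewrite -[- 1]add0r; apply: is_deriveB.
  have x0 : 0 < 1 - x by rewrite subr_gt0.
  have d2 := @is_derive1_comp _ (@powR R ^~ (- a)) (fun x => 1 - x) x _ _ (is_derive1_powR (- a) x0) d1.
  have := @is_deriveB _ _ _ _ _ x 1 _ _ d2 (is_derive_poly p x).
  by [].
have fc : {within `[0, u], continuous f}.
  apply: derivable_within_continuous => x; rewrite in_itv/= => /andP[x0 xu].
  by have [] := fd x ltac:(by lra).
have fd' x : x \in `]0, u[ -> is_derive x 1 f (df x).
  by rewrite in_itv/= => /andP[x0 xu]; apply: fd; lra.
have [c] := MVT_segment u0 fd' fc.
rewrite in_itv/= => /andP[c0 cu].
have f0 : f 0 = 0.
  rewrite /f subr0 powR1 pE big_ord_recl expr0 mulr1 big1 ?addr0.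
    by rewrite /neg_binomial /rising big_ord0 fact0 divr1 subrr.
  by move=> i _; rewrite expr0n mulr0.
rewrite f0 !subr0 /f pE => ->.
have -> : df c = a * ((1 - c) `^ (- (a + 1)) - \sum_(i < j) neg_binomial (a + 1) i * c ^+ i).
  by rewrite /df dpE -mulr_sumr mulrN1 mulNr opprK opprD mulrBr.
rewrite normrM (ger0_norm u0) normrM gtr0_norm// exprSr !mulrA ler_wpM2r// -!mulrA ler_pM2l//.
apply: (le_trans (HK _ _)); first by rewrite c0; lra.
by rewrite ler_wpM2l// lerXn2r// nnegrE.
Qed.

Variables (a : nat -> nat -> R) (A : nat -> R -> R) (Alim : R -> R) (c : nat -> R) (t0 : R).
Hypothesis t0_gt0 : 0 < t0.
Hypothesis a_partial : forall n (t : R) j, 0 < t <= t0 ->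
  \sum_(i < j.+1) a n i * t ^+ i <= A n t <=
  \sum_(i < j.+1) a n i * t ^+ i + (t / t0) ^+ j.+1 * A n t0.
Hypothesis A_cvg : forall t : R, 0 < t <= t0 -> A n t @[n --> \oo] --> Alim t.
Hypothesis Alim_taylor : forall j, exists2 K : R, 0 <= K & forall t : R, 0 < t <= t0 ->
  `|Alim t - \sum_(i < j.+1) c i * t ^+ i| <= K * t ^+ j.+1.

(** Once the coefficients below [j] converge, they can be subtracted from [A n t]; after division by
    [t^j] what remains is [a n j] up to an error of order [t], uniform in large [n]. So [t] is fixed
    first, and [n] tends to infinity afterwards. *)
Lemma coef_extraction j : a n j @[n --> \oo] --> c j.
Proof.
elim/ltn_ind: j => j IH.
apply/cvgrPdist_le => e e0.
have [K K0 HK] := Alim_taylor j.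
pose B := `|Alim t0| + 1.
have B0 : 0 < B by rewrite /B ltr_wpDl.
have K1 : 0 < K + 1 by lra.
have Bt : 0 < B / t0 ^+ j.+1 by rewrite divr_gt0// exprn_gt0.
(* [K * t] bounds the Taylor error of the limit, the other term the tail of the series of [A n]
   beyond [j]; [K + 1] avoids a division by 0. *)
have [t /andP[t_gt0 tt0] [tK tB]] : exists2 t, 0 < t <= t0 & K * t <= e / 4 /\ t / t0 ^+ j.+1 * B <= e / 4.
  exists (Num.min t0 (Num.min (e / (4 * (K + 1))) (e / (4 * (B / t0 ^+ j.+1))))).
    apply/andP; split; last by rewrite ge_min lexx.
    by rewrite !lt_min t0_gt0/= !(divr_gt0 e0)// mulr_gt0.
  split.
    apply: (@le_trans _ _ (K * (e / (4 * (K + 1))))).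
      by rewrite ler_wpM2l// !ge_min lexx !orbT.
    have -> : K * (e / (4 * (K + 1))) = e / 4 * (K / (K + 1)) by field; rewrite gt_eqF.
    by rewrite ler_piMr ?ler_pdivrMr//; lra.
  rewrite mulrAC -mulrA.
  apply: (@le_trans _ _ (e / (4 * (B / t0 ^+ j.+1)) * (B / t0 ^+ j.+1))).
    by rewrite ler_pM2r// !ge_min lexx !orbT.
  by move: (B / t0 ^+ j.+1) Bt => Y Y0; have -> : e / (4 * Y) * Y = e / 4 by field; rewrite gt_eqF.
pose S n := \sum_(i < j) a n i * t ^+ i.
pose X n := (A n t - S n) / t ^+ j.
have tj0 : 0 < t ^+ j by rewrite exprn_gt0.
have Xc : X @ \oo --> (Alim t - \sum_(i < j) c i * t ^+ i) / t ^+ j.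
  apply: cvgM; last exact: cvg_cst.
  apply: cvgB; first by apply: A_cvg; rewrite t_gt0.
  apply: (@cvg_sum_nat _ _ _ _ (fun (i : 'I_j) n => a n i * t ^+ i) (fun i : 'I_j => c i * t ^+ i)) => i.
  by apply: cvgM; [exact: IH|exact: cvg_cst].
have XK : `|(Alim t - \sum_(i < j) c i * t ^+ i) / t ^+ j - c j| <= e / 4.
  have := HK t; rewrite t_gt0 tt0 big_ord_recr/= => /(_ isT) H.
  have -> : (Alim t - \sum_(i < j) c i * t ^+ i) / t ^+ j - c j =
      (Alim t - (\sum_(i < j) c i * t ^+ i + c j * t ^+ j)) / t ^+ j.
    by field; rewrite gt_eqF.
  rewrite normrM normfV (gtr0_norm tj0) ler_pdivrMr//; apply: (le_trans H).
  by rewrite exprS mulrA ler_pM2r.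
have nX : \forall n \near \oo, `|(Alim t - \sum_(i < j) c i * t ^+ i) / t ^+ j - X n| <= e / 4.
  by move/cvgrPdist_le: Xc; apply; lra.
have nA : \forall n \near \oo, A n t0 < B.
  have : Alim t0 < B by rewrite /B (le_lt_trans (ler_norm _))// ltrDl.
  have t00 : 0 < t0 <= t0 by rewrite t0_gt0 lexx.
  by move/cvgr_lt: (A_cvg t00); apply.
near=> n.
have H1 : `|(Alim t - \sum_(i < j) c i * t ^+ i) / t ^+ j - X n| <= e / 4 by near: n.
have H2 : A n t0 < B by near: n.
have := a_partial n (t := t) j; rewrite t_gt0 tt0 big_ord_recr/= -/(S n) => /(_ isT)/andP[H3 H4].
have H5 : a n j <= X n by rewrite /X ler_pdivlMr//; lra.
have H6 : X n <= a n j + t / t0 ^+ j.+1 * B.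
  rewrite /X ler_pdivrMr// mulrDl.
  have : (t / t0) ^+ j.+1 * A n t0 <= t / t0 ^+ j.+1 * B * t ^+ j.
    have -> : t / t0 ^+ j.+1 * B * t ^+ j = (t / t0) ^+ j.+1 * B.
      by rewrite expr_div_n (exprS t); move: (t0 ^+ j.+1)^-1 => y; ring.
    by rewrite ler_wpM2l ?exprn_ge0 ?divr_ge0 ?(ltW t_gt0) ?(ltW t0_gt0)// ltW.
  by lra.
move: XK H1; rewrite !ler_norml => /andP[C D] /andP[E F]; apply/andP; split; lra.
Unshelve. all: by end_near. Qed.

End binomial_series.

(** * The Gamma function and Laplace transforms *)

Section exponential_integrals.
Context {R : realType}.
Local Notation mu := (@lebesgue_measure R).

Let measurable_natr_bool d (T : measurableType d) (b : T -> bool) : measurable_fun setT b ->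
  measurable_fun setT (fun z => (b z)%:R : R).
Proof. by move=> mb; apply: (measurableT_comp (f := fun b : bool => b%:R : R)) mb. Qed.

Let measurable_gamma (a : R) : measurable_fun setT (fun t : R => expR (- t) * t `^ a).
Proof. by apply: measurable_funM; [exact: measurableT_comp|exact: (measurable_powR _)]. Qed.

Lemma continuous_expNM (l : R) : continuous (fun t : R => expR (- l * t)).
Proof.
move=> x; apply: (continuous_comp (f := fun t : R => - l * t)); last exact: continuous_expR.
by apply: cvgM; [exact: cvg_cst|exact: cvg_id].
Qed.

Lemma integral_exp_tail (l c : R) : 0 < l ->
  (\int[mu]_(t in `[c, +oo[) (l * expR (- l * t))%:E = (expR (- l * c))%:E)%E.
Proof.
move=> l0.
have dF (x : R) : is_derive x 1 (fun t => - expR (- l * t)) (l * expR (- l * x)).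
  have d1 : is_derive x 1 (fun t : R => - l * t) (- l).
    have := @is_deriveZ _ _ _ id (- l) x 1 1 (is_derive_id x 1).
    by rewrite scaler1.
  have d2 := is_deriveN (@is_derive1_comp _ expR (fun t => - l * t) x _ _ (is_derive_expR _) d1).
  by rewrite mulrN opprK mulrC in d2.
have cE := @continuous_expNM l.
have cexp : continuous (fun t : R => l * expR (- l * t)).
  by move=> x; apply: cvgM; [exact: cvg_cst|exact: cE].
rewrite (@ge0_continuous_FTC2y _ _ (fun t => - expR (- l * t)) _ 0).
- by rewrite -EFinB sub0r opprK.
- by move=> x _; rewrite mulr_ge0 ?expR_ge0// ltW.
- by apply: continuous_subspaceT.
- rewrite -[X in _ --> X]oppr0; apply: cvgN.
  rewrite (_ : (fun t => expR (- l * t)) = (fun z => expR (- z)) \o (fun z => l * z)).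
    by apply: (@cvg_comp _ _ _ _ _ _ (pinfty_nbhs R)); [exact: gt0_cvgMry|exact: cvgr_expR].
  by apply/funext => t /=; rewrite mulNr.
- by move=> x _; have [] := dF x.
- by apply: cvg_at_right_filter; apply: cvgN; exact: cE.
- by move=> x _; rewrite derive1E; have [_] := dF x.
Qed.

(** Write [expR (- l * T v)] as the integral of [l * expR (- l * t)] over [t >= T v] and exchange
    the integrals. This serves as a change of variables when [T] is a power, and as an integration
    by parts when [T] is the identity. *)
Lemma tonelli_exp (l : R) (w T : R -> R) : 0 < l ->
  measurable_fun setT w -> measurable_fun setT T -> (forall v, 0 <= w v) ->
  (\int[mu]_v (w v * expR (- l * T v))%:E =
   \int[mu]_t ((l * expR (- l * t))%:E * \int[mu]_v (w v * (T v <= t)%R%:R)%:E))%E.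
Proof.
move=> l0 mw mT w0.
pose f (z : measurableTypeR R * measurableTypeR R) : \bar R :=
  (w z.1 * (l * expR (- l * z.2)) * (T z.1 <= z.2)%R%:R)%:E.
have mexp : measurable_fun setT (fun t : R => l * expR (- l * t)).
  by apply: measurable_funM => //; exact: continuous_measurable_fun (@continuous_expNM l).
have mle : measurable_fun setT (fun z : measurableTypeR R * measurableTypeR R => (T z.1 <= z.2)%R%:R : R).
  apply: measurable_natr_bool.
  by apply: measurable_fun_ler; [exact: measurableT_comp mT measurable_fst|exact: measurable_snd].
have mf : measurable_fun setT f.
  apply/measurable_EFinP; apply: measurable_funM => //; apply: measurable_funM.
    exact: (measurableT_comp mw measurable_fst).
  exact: (measurableT_comp mexp measurable_snd).
have f0 z : (0 <= f z)%E.
  by rewrite lee_fin !mulr_ge0 ?expR_ge0// ltW.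
transitivity (\int[mu]_v \int[mu]_t f (v, t))%E.
  apply: eq_integral => v _.
  rewrite EFinM -integral_exp_tail//.
  rewrite -ge0_integralZl_EFin//; last 2 first.
  - by move=> t _; rewrite lee_fin mulr_ge0 ?expR_ge0// ltW.
  - by apply/measurable_EFinP; exact: measurable_funTS.
  rewrite integral_mkcond; apply: eq_integral => t _.
  rewrite /restrict/= mem_setE/= in_itv/= andbT /f /=.
  by case: (T v <= t) => /=; rewrite ?mulr1// mulr0.
rewrite (@fubini_tonelli _ _ _ _ _ mu mu f mf f0).
apply: eq_integral => t _.
rewrite -ge0_integralZl_EFin//.
- by apply: eq_integral => v _; rewrite /f /= -EFinM; congr EFin; ring.
- by move=> v _; rewrite lee_fin mulr_ge0.
- apply/measurable_EFinP; apply: measurable_funM => //.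
  by apply: measurable_natr_bool; exact: measurable_fun_ler.
- by rewrite mulr_ge0 ?expR_ge0// ltW.
Qed.

Lemma continuous_powR (a x : R) : 0 < x -> {for x, continuous (fun v : R => v `^ a)}.
Proof.
move=> x0; apply: differentiable_continuous; apply/derivable1_diffP.
by have [] := is_derive1_powR a x0.
Qed.

(** For [a < 1] the integrand is unbounded at 0: the fundamental theorem is applied on
    [[t / i.+2, t]], and these intervals increase to []0, t]]. *)
Lemma integral_powR (a t : R) : 0 < a -> 0 < t ->
  (\int[mu]_(v in `]0%R, t]) (a * v `^ (a - 1))%:E = (t `^ a)%:E)%E.
Proof.
move=> a0 t0.
have e0 (i : nat) : 0 < t / i.+2%:R < t.
  by rewrite divr_gt0//= ltr_pdivrMr// ltr_pMr// ltr1n.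
pose F (i : nat) := `[t / i.+2%:R, t]%classic : set R.
have UF : \bigcup_i F i = `]0, t]%classic.
  apply/seteqP; split => [v [i _]|v] /=; rewrite /F/= !in_itv/= => /andP[v0 vt].
    by rewrite vt andbT (lt_le_trans _ v0)//; case/andP: (e0 i).
  exists (Num.truncn (t / v)) => //=; rewrite in_itv/= vt andbT.
  rewrite ler_pdivrMr// -ler_pdivrMl// mulrC ltW// (lt_trans (truncnS_gt _))//.
  by rewrite ltr_nat.
have H : (\int[mu]_(v in F i) (a * v `^ (a - 1))%:E @[i --> \oo] -->
    \int[mu]_(v in `]0%R, t]) (a * v `^ (a - 1))%:E)%E.
  rewrite -UF; apply: ge0_nondecreasing_set_cvg_integral.
  - move=> m n mn; apply/subsetPset => v /=; rewrite /F/= !in_itv/= => /andP[h ->].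
    rewrite andbT (le_trans _ h)// ler_pM2l// lef_pV2 ?posrE// ler_nat.
    by rewrite !ltnS.
  - by move=> i; exact: measurable_itv.
  - move=> i; apply/measurable_EFinP; apply: measurable_funTS.
    by apply: measurable_funM => //; exact: (measurable_powR _).
  - by move=> i v _; rewrite lee_fin mulr_ge0 ?powR_ge0// ltW.
have E i : (\int[mu]_(v in F i) (a * v `^ (a - 1))%:E = (t `^ a)%:E - ((t / i.+2%:R) `^ a)%:E)%E.
  have /andP[ei0 eit] := e0 i.
  apply: (@continuous_FTC2 _ (fun v => a * v `^ (a - 1)) (fun v => v `^ a)) => //.
  - apply: continuous_in_subspaceT => v; rewrite mem_setE/= in_itv/= => /andP[v0 _].
    by apply: cvgM; [exact: cvg_cst|apply: continuous_powR; exact: lt_le_trans v0].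
  - split.
    + move=> v; rewrite in_itv/= => /andP[v0 _].
      by have [] := is_derive1_powR a (lt_trans ei0 v0).
    + by apply: cvg_at_right_filter; exact: continuous_powR.
    + by apply: cvg_at_left_filter; exact: continuous_powR.
  - move=> v; rewrite in_itv/= => /andP[v0 _].
    by rewrite powR_derive1// in_itv/= andbT (lt_trans ei0 v0).
have H2 : ((t `^ a)%:E - ((t / i.+2%:R) `^ a)%:E @[i --> \oo] --> (t `^ a)%:E - 0%:E)%E.
  apply: cvgeB => //; first exact: cvg_cst.
  apply/fine_cvgP; split; first exact: nearW.
  have h0 : t / i.+2%:R @[i --> \oo] --> 0^'+.
    apply: cvg_to_right0; first by apply: nearW => i; case/andP: (e0 i).
    rewrite -(mulr0 t); apply: cvgM; first exact: cvg_cst.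
    by rewrite (cvg_shiftS (fun i => (i.+1%:R : R)^-1)); exact: cvg_harmonic.
  exact: (cvg_comp (fun i => t / i.+2%:R) (fun v => v `^ a) h0 (powR_cvg0 a0)).
rewrite sube0 in H2; rewrite (funext E) in H.
exact: (cvg_unique _ H H2).
Qed.

(** [tonelli_exp] for [T v = v^(1/a)]: among positive [v], the level set below [t] is []0, t^a]], of
    length [t^a]. *)
Lemma integral_exp_powR_inv (l a : R) : 0 < l -> 0 < a ->
  (\int[mu]_(v in `]0%R, +oo[) (expR (- l * v `^ a^-1))%:E =
   \int[mu]_(t in `]0%R, +oo[) (l * expR (- l * t) * t `^ a)%:E)%E.
Proof.
move=> l0 a0.
have mw : measurable_fun setT (fun v : R => (0 < v)%R%:R : R).
  by apply: measurable_natr_bool; exact: measurable_fun_ltr.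
transitivity (\int[mu]_v ((0 < v)%R%:R * expR (- l * v `^ a^-1))%:E)%E.
  rewrite [LHS]integral_mkcond; apply: eq_integral => v _.
  rewrite /restrict/= mem_setE/= in_itv/= andbT.
  by case: (0 < v) => /=; rewrite ?mul1r ?mul0r.
rewrite (@tonelli_exp l (fun v => (0 < v)%R%:R) (fun v => v `^ a^-1) l0 mw (measurable_powR _))//.
rewrite [RHS]integral_mkcond; apply: eq_integral => t _.
rewrite /restrict/= mem_setE/= in_itv/= andbT.
have [t0|t0] := ltP 0 t; last first.
  rewrite (_ : \int[mu]_v _ = 0)%E ?mule0//.
  rewrite integral0_eq// => v _; have [v0|] := ltP 0 v; last by rewrite mul0r.
  rewrite mul1r (_ : _ <= t = false)//; apply/negbTE; rewrite -ltNge.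
  by apply: le_lt_trans t0 _; rewrite powR_gt0.
rewrite [in RHS]EFinM; congr (_ * _)%E.
transitivity (\int[mu]_v (\1_(`]0%R, t `^ a]%classic : set R) v)%:E)%E; last first.
  rewrite integral_indic//= setIT lebesgue_measure_itv/= lte_fin powR_gt0//.
  by rewrite sube0.
apply: eq_integral => v _; rewrite indicE mem_setE/= in_itv/=; congr EFin.
have [v0|] := ltP 0 v; last by rewrite mul0r.
rewrite mul1r; congr (_%:R); congr nat_of_bool; apply/idP/idP => H.
  have := ge0_ler_powR (ltW a0) (powR_ge0 _ _) (ltW t0) H.
  by rewrite -powRrM mulVf ?gt_eqF// powRr1// ltW.
have ai0 : 0 <= a^-1 by rewrite invr_ge0 ltW.
have := ge0_ler_powR ai0 (ltW v0) (powR_ge0 _ _) H.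
by rewrite -powRrM mulfV ?gt_eqF// powRr1// ltW.
Qed.

(** The integration by parts behind [Gamma1]: the weight [a v^(a - 1)] has integral [t^a] over []0,
    t]]. *)
Lemma integral_gamma_step (a : R) : 0 < a ->
  (\int[mu]_(v in `]0%R, +oo[) (a * v `^ (a - 1) * expR (- v))%:E =
   \int[mu]_(t in `]0%R, +oo[) (expR (- t) * t `^ a)%:E)%E.
Proof.
move=> a0.
have mw : measurable_fun setT (fun v : R => (0 < v)%R%:R * (a * v `^ (a - 1)) : R).
  apply: measurable_funM; last by apply: measurable_funM => //; exact: (measurable_powR _).
  by apply: measurable_natr_bool; exact: measurable_fun_ltr.
have w0 v : 0 <= (0 < v)%R%:R * (a * v `^ (a - 1)).
  by rewrite !mulr_ge0 ?powR_ge0// ltW.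
transitivity (\int[mu]_v ((0 < v)%R%:R * (a * v `^ (a - 1)) * expR (- 1 * v))%:E)%E.
  rewrite [LHS]integral_mkcond; apply: eq_integral => v _.
  rewrite /restrict/= mem_setE/= in_itv/= andbT mulN1r.
  by case: (0 < v) => /=; rewrite ?mul1r ?mul0r.
rewrite (tonelli_exp ltr01 mw (@measurable_id _ _ setT) w0).
rewrite [RHS]integral_mkcond; apply: eq_integral => t _.
rewrite /restrict/= mem_setE/= in_itv/= andbT mul1r mulN1r.
have [t0|t0] := ltP 0 t; last first.
  rewrite (_ : \int[mu]_v _ = 0)%E ?mule0//.
  rewrite integral0_eq// => v _; have [v0|] := ltP 0 v; last by rewrite !mul0r.
  rewrite (_ : v <= t = false) ?mulr0//; apply/negbTE; rewrite -ltNge.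
  exact: le_lt_trans t0 _.
rewrite [in RHS]EFinM -(integral_powR a0 t0); congr (_ * _)%E.
rewrite [RHS]integral_mkcond; apply: eq_integral => v _.
rewrite /restrict/= mem_setE/= in_itv/=.
by case: (0 < v); case: (v <= t); rewrite /= ?mul0r ?mulr0 ?mul1r ?mulr1.
Qed.

Lemma integral_exp_powR_scale (l a : R) : 0 < l -> 0 < a ->
  (\int[mu]_(t in `]0%R, +oo[) (l * expR (- l * t) * t `^ a)%:E =
   (l `^ (- a))%:E * \int[mu]_(t in `]0%R, +oo[) (expR (- t) * t `^ a)%:E)%E.
Proof.
move=> l0 a0.
pose G (s : R) := l `^ (- a) * (expR (- s) * s `^ a).
have mG : measurable_fun setT G.
  by apply: measurable_funM => //; exact: measurable_gamma.
have dF (x : R) : is_derive x 1 (fun t => l * t) l.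
  by have := @is_deriveZ _ _ _ id l x 1 1 (is_derive_id x 1); rewrite scaler1.
have dF1 : (fun t => l * t)^`()%classic = fun=> l.
  by apply/funext => x; rewrite derive1E; have [] := dF x.
have := @increasing_ge0_integration_by_substitutiony R (fun t => l * t) G 0.
rewrite mulr0 dF1 => H.
transitivity (\int[mu]_(t in `[0%R, +oo[) (((G \o (fun t => l * t)) * (fun=> l)) t)%:E)%E.
  rewrite integral_itv_obnd_cbnd; last first.
    apply/measurable_EFinP; apply: measurable_funTS; apply: measurable_funM; last exact: (measurable_powR _).
    by apply: measurable_funM => //; exact: continuous_measurable_fun (@continuous_expNM l).
  apply: eq_integral => t; rewrite inE/= in_itv/= andbT => t0.
  rewrite fctE/= /G; congr EFin.
  rewrite mulNr powRM ?(ltW l0)// powRN; field.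
  by rewrite gt_eqF ?powR_gt0.
rewrite -H.
- rewrite -integral_itv_obnd_cbnd; last by apply/measurable_EFinP; exact: measurable_funTS.
  rewrite -ge0_integralZl_EFin ?powR_ge0//.
  + by move=> t _; rewrite lee_fin mulr_ge0 ?expR_ge0 ?powR_ge0.
  + by apply/measurable_EFinP; apply: measurable_funTS; exact: measurable_gamma.
- by move=> x y _ _ xy; rewrite ltr_pM2l.
- by move=> x _; exact: cvg_cst.
- exact: is_cvg_cst.
- exact: is_cvg_cst.
- split; first by move=> x _; have [] := dF x.
  apply: cvg_at_right_filter; apply: cvgM; [exact: cvg_cst|exact: cvg_id].
- by apply: gt0_cvgMry => //; exact: cvg_id.
- apply/continuous_within_itvcyP; split.
    move=> x; rewrite in_itv/= andbT => x0; apply: cvgM; first exact: cvg_cst.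
    apply: cvgM; last exact: continuous_powR.
    apply: (continuous_comp (f := fun t : R => - t)); last exact: continuous_expR.
    by apply: cvgN; exact: cvg_id.
  rewrite /G powR0 ?gt_eqF// ; apply: cvgM; first exact: cvg_cst.
  apply: cvgM; last exact: powR_cvg0.
  apply: cvg_at_right_filter; apply: (continuous_comp (f := fun t : R => - t)); last exact: continuous_expR.
  by apply: cvgN; exact: cvg_id.
- by move=> x _; rewrite /G !mulr_ge0 ?expR_ge0 ?powR_ge0.
Qed.

Lemma powR_le_exp (a : R) : 0 < a -> exists2 C : R, 0 < C &
  forall t, 0 <= t -> t `^ a <= C * expR (t / 2).
Proof.
move=> a0; pose n := (Num.truncn a).+1.
have an : a <= n%:R by rewrite ltW// truncnS_gt.
have n0 : 0 < n%:R :> R by [].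
(* From [1 + t <= 2 n (1 + t / (2 n)) <= 2 n exp(t / (2 n))], raised to the power [n >= a]. *)
exists ((2 * n%:R) ^+ n); first by rewrite exprn_gt0// mulr_gt0.
move=> t t0.
have t1 : 1 <= 1 + t by rewrite lerDl.
have H1 : t `^ a <= (1 + t) ^+ n.
  rewrite -powR_mulrn ?addr_ge0//.
  apply: (@le_trans _ _ ((1 + t) `^ a)); last exact: ler_powR.
  by apply: ge0_ler_powR; rewrite ?nnegrE ?(ltW a0) ?addr_ge0// lerDr.
apply: (le_trans H1).
have -> : expR (t / 2) = expR (t / (2 * n%:R)) ^+ n.
  by rewrite -expRM_natr; congr expR; field; rewrite gt_eqF.
rewrite -exprMn lerXn2r ?nnegrE ?addr_ge0// ?mulr_ge0 ?expR_ge0//.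
apply: (@le_trans _ _ (2 * n%:R * (1 + t / (2 * n%:R)))).
  rewrite mulrDr mulr1 mulrC [X in _ <= _ + X]mulrC divfK ?gt_eqF ?mulr_gt0//.
  have : (1 : R) <= n%:R by rewrite ler1n.
  by lra.
by rewrite ler_pM2l ?mulr_gt0// expR_ge1Dx.
Qed.

Lemma integral_exp_powR_fin (a : R) : 0 < a ->
  (\int[mu]_(t in `]0%R, +oo[) (expR (- t) * t `^ a)%:E < +oo)%E.
Proof.
move=> a0; have [C C0 HC] := powR_le_exp a0.
have h2 : 0 < (2^-1 : R) by [].
have mexp : measurable_fun setT (fun t : R => 2^-1 * expR (- 2^-1 * t) : R).
  by apply: measurable_funM => //; exact: continuous_measurable_fun (@continuous_expNM _).
have e0 (t : R) : (0 <= (2^-1 * expR (- 2^-1 * t))%:E :> \bar R)%E.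
  by rewrite lee_fin mulr_ge0 ?expR_ge0.
apply: (@le_lt_trans _ _ (\int[mu]_(t in `]0%R, +oo[)
    ((2 * C)%:E * (2^-1 * expR (- 2^-1 * t))%:E))%E).
  apply: ge0_le_integral => //.
  - by move=> t _; rewrite lee_fin mulr_ge0 ?expR_ge0 ?powR_ge0.
  - by apply/measurable_EFinP; apply: measurable_funTS; exact: measurable_gamma.
  - by apply/measurable_EFinP; apply: measurable_funTS; exact: measurable_funM.
  - move=> t /=; rewrite in_itv/= andbT => t0; rewrite -EFinM lee_fin.
    have -> : 2 * C * (2^-1 * expR (- 2^-1 * t)) = expR (- t) * (C * expR (t / 2)).
      have -> : expR (- 2^-1 * t) = expR (- t) * expR (t / 2).
        by rewrite -expRD; congr expR; field.
      by field.
    by rewrite ler_wpM2l ?expR_ge0// HC// ltW.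
rewrite ge0_integralZl_EFin//; last 2 first.
- by apply/measurable_EFinP; exact: measurable_funTS.
- by rewrite mulr_ge0// ltW.
rewrite integral_itv_obnd_cbnd; last by apply/measurable_EFinP; exact: measurable_funTS.
by rewrite integral_exp_tail// -EFinM ltry.
Qed.

Lemma Gamma1_integral (a : R) : 0 < a ->
  (\int[mu]_(t in `]0%R, +oo[) (expR (- t) * t `^ a)%:E = (Gamma (1 + a))%:E)%E.
Proof.
move=> a0; rewrite /Gamma /Rintegral.
have -> : (\int[mu]_(t in `]0%R, +oo[) (t `^ (1 + a - 1) * expR (- t))%:E =
    \int[mu]_(t in `]0%R, +oo[) (expR (- t) * t `^ a)%:E)%E.
  by apply: eq_integral => t _; rewrite addrAC subrr add0r mulrC.
(* [Gamma] is the [fine] part of the integral, hence the need for finiteness. *)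
rewrite fineK// ge0_fin_numE ?integral_exp_powR_fin//.
by apply: integral_ge0 => t _; rewrite lee_fin mulr_ge0 ?expR_ge0 ?powR_ge0.
Qed.

(** Lebesgue measure on the half line, carried by [v -> v^(1/a)], thus has transform
    [Gamma (1 + a) l^(- a)]. For [a = alpha] this is, up to a constant, the limit measure of the
    denominator; for [a = alpha] and [a = 1 + alpha] it represents the weights in the bound on
    atoms. *)
Lemma integral_exp_powR (l a : R) : 0 < l -> 0 < a ->
  (\int[mu]_(v in `]0%R, +oo[) (expR (- l * v `^ a^-1))%:E = (l `^ (- a) * Gamma (1 + a))%:E)%E.
Proof.
by move=> l0 a0; rewrite integral_exp_powR_inv// integral_exp_powR_scale// Gamma1_integral.
Qed.

Lemma Gamma1_gt0 (a : R) : 0 < a -> 0 < Gamma (1 + a).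
Proof.
move=> a0; apply: (lt_le_trans (expR_gt0 (- 1 * 1))).
rewrite -lee_fin -integral_exp_tail// -Gamma1_integral//.
have mG := measurable_gamma a.
apply: (@le_trans _ _ (\int[mu]_(t in `[1%R, +oo[) (expR (- t) * t `^ a)%:E)%E).
  apply: ge0_le_integral => //.
  - apply/measurable_EFinP; apply: measurable_funTS; apply: measurable_funM => //.
    exact: continuous_measurable_fun (@continuous_expNM _).
  - by apply/measurable_EFinP; exact: measurable_funTS.
  - move=> t /=; rewrite in_itv/= andbT mul1r mulN1r lee_fin => t1.
    by rewrite ler_peMr ?expR_ge0// -(powRr0 t) ler_powR// ltW.
apply: ge0_subset_integral => //.
- by apply/measurable_EFinP; exact: measurable_funTS.
- by move=> t _; rewrite lee_fin mulr_ge0 ?expR_ge0 ?powR_ge0.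
- by move=> t /=; rewrite !in_itv/= !andbT; exact: lt_le_trans.
Qed.

Lemma Gamma1 (a : R) : 0 < a -> Gamma (1 + a) = a * Gamma a.
Proof.
move=> a0; have := Gamma1_integral a0; rewrite -integral_gamma_step// => E.
have m0 : measurable_fun setT (fun v : R => v `^ (a - 1) * expR (- v) : R).
  by apply: measurable_funM; [exact: (measurable_powR _)|exact: measurableT_comp].
have E2 : (\int[mu]_(v in `]0%R, +oo[) (a * v `^ (a - 1) * expR (- v))%:E =
    a%:E * \int[mu]_(v in `]0%R, +oo[) (v `^ (a - 1) * expR (- v))%:E)%E.
  rewrite -ge0_integralZl_EFin ?(ltW a0)//.
  - by apply: eq_integral => v _; rewrite -EFinM mulrA.
  - by move=> v _; rewrite lee_fin mulr_ge0 ?powR_ge0 ?expR_ge0.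
  - by apply/measurable_EFinP; exact: measurable_funTS.
rewrite E2 in E; have := congr1 (fun z => (a^-1)%:E * z)%E E.
rewrite muleA -EFinM mulVf ?gt_eqF// mul1e -EFinM => X.
by rewrite [in RHS]/Gamma /Rintegral X /= mulrA mulfV ?gt_eqF// mul1r.
Qed.

End exponential_integrals.

Section stretched_exponential.
Context {R : realType}.
Local Notation mu := (@lebesgue_measure R).
Variable a : R.
Hypothesis a_gt0 : 0 < a.
Let D := `]0%R, +oo[%classic : set R.

Lemma measurable_strexp (l : R) : measurable_fun setT (fun v : R => expR (- l * v `^ a^-1)).
Proof.
apply: measurableT_comp => //; apply: measurable_funM => //; exact: (measurable_powR _).
Qed.

Lemma integrable_strexp (l : R) : 0 < l ->
  mu.-integrable D (fun v : R => (expR (- l * v `^ a^-1))%:E).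
Proof.
move=> l0; apply/integrableP; split.
  by apply/measurable_EFinP; apply: measurable_funTS; exact: measurable_strexp.
under eq_integral do rewrite /= ger0_norm ?expR_ge0//.
by rewrite integral_exp_powR// ltry.
Qed.

Lemma Rintegral_strexp (l : R) : 0 < l ->
  \int[mu]_(v in D) expR (- l * v `^ a^-1) = l `^ (- a) * Gamma (1 + a).
Proof. by move=> l0; rewrite /Rintegral integral_exp_powR. Qed.

Lemma strexp_pow (v : R) i : expR (- v `^ a^-1) ^+ i = expR (- i%:R * v `^ a^-1).
Proof. by rewrite -expRM_natr mulrC mulNr mulrN. Qed.

Lemma strexp_itv (v : R) : D v -> 0 <= expR (- v `^ a^-1) <= 1.
Proof. by move=> _; rewrite expR_ge0 -[leRHS]expR0 ler_expR oppr_le0 powR_ge0. Qed.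

Lemma strexp_null (b : R) : 0 < b < 1 ->
  mu (D `&` (fun v => expR (- v `^ a^-1)) @^-1` [set b]) = 0%E.
Proof.
move=> /andP[b0 b1]; apply: countable_lebesgue_measure0.
apply: (@sub_countable _ _ _ [set (- ln b) `^ a]); last first.
  exact: finite_set_countable.
apply: subset_card_le => v [/= + E]; rewrite /D/= in_itv/= andbT => v0.
by rewrite -E expRK opprK -powRrM mulVf ?gt_eqF// powRr1// ltW.
Qed.

End stretched_exponential.

(** * Absence of positive atoms *)

Section laplace_atoms.
Context {R : realType}.
Local Notation TR := (measurableTypeR R).
Variables (mu : probability TR R) (alpha : R).
Hypothesis alpha_gt0 : 0 < alpha.
Hypothesis mu_neg : mu `]-oo, 0%R[%classic = 0%E.
Let D := `[0%R, +oo[%classic : set R.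
Variable ell : R -> R.
Hypothesis ellE : forall l, ell l = 1 - ((1 + l `^ (- alpha)) `^ alpha^-1)^-1.
Hypothesis mu_laplace : forall l : R, 0 < l -> \int[mu]_(y in D) expR (- l * y) = ell l.

Lemma integrable_bounded_on (f : R -> R) (K : R) : measurable_fun setT f ->
  (forall y, D y -> `|f y| <= K) -> mu.-integrable D (EFin \o f).
Proof.
move=> mf fK; apply: measurable_bounded_integrable.
- exact: measurable_itv.
- by apply: le_lt_trans (probability_le1 mu (measurable_itv _)) (ltry _).
- exact: measurable_funTS.
exists K; split; first exact: num_real.
by move=> M KM y Dy; exact: le_trans (fK _ Dy) (ltW KM).
Qed.

Lemma integrable_exp_on (l : R) : 0 <= l -> mu.-integrable D (fun y => (expR (- l * y))%:E).
Proof.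
move=> l0; apply: (@integrable_bounded_on _ 1).
  by apply: continuous_measurable_fun; exact: continuous_expNM.
move=> y; rewrite /D/= in_itv/= andbT => y0.
by rewrite ger0_norm ?expR_ge0// -[leRHS]expR0 ler_expR mulNr oppr_le0 mulr_ge0.
Qed.

Lemma laplace_sum (n : nat) (w l : nat -> R) : (forall i, 0 < l i) ->
  \sum_(i < n) w i * ell (l i) = \int[mu]_(y in D) (\sum_(i < n) w i * expR (- l i * y)).
Proof.
move=> l0; have mD : measurable (D : set TR) by exact: measurable_itv.
have iw i : mu.-integrable D (fun y => (w i * expR (- l i * y))%:E).
  by under eq_fun do rewrite EFinM; apply: integrableZl => //; apply: integrable_exp_on; exact: ltW.
rewrite /Rintegral; under [in RHS]eq_integral do rewrite -sumEFin.
rewrite (integral_sum mD (fun i : 'I_n => iw i)).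
rewrite (eq_bigr (fun i : 'I_n => (w i * ell (l i))%:E)); first by rewrite sumEFin.
move=> i _; rewrite -mu_laplace// -(RintegralZl _ mD) ?fineK//.
  by apply: integrable_fin_num.
by apply: integrable_exp_on; exact: ltW.
Qed.

(** [Gamma (1 + a) (k + 1)^(- a)] is the integral of the power [k + 1] of [exp(- v^(1/a))], so the
    weighted sum is the integral of [w * q.[w]] with [w = exp(- v^(1/a) - y)]. *)
Lemma weighted_poly_integral (a y : R) (q : {poly R}) : 0 < a -> 0 <= y ->
  Gamma (1 + a) * \sum_(k < size q) q`_k * k.+1%:R `^ (- a) * expR (- k.+1%:R * y) =
  \int[lebesgue_measure]_(v in `]0%R, +oo[)
    (expR (- v `^ a^-1) * expR (- y) * q.[expR (- v `^ a^-1) * expR (- y)]).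
Proof.
move=> a0 y0.
have E v : expR (- v `^ a^-1) * expR (- y) * q.[expR (- v `^ a^-1) * expR (- y)] =
    \sum_(k < size q) q`_k * expR (- k.+1%:R * y) * expR (- k.+1%:R * v `^ a^-1).
  rewrite horner_coef mulr_sumr; apply: eq_bigr => k _.
  rewrite mulrCA -exprS exprMn strexp_pow -expRM_natr.
  by rewrite (_ : - y * k.+1%:R = - k.+1%:R * y) ?mulNr 1?mulrC// -mulNr; ring.
under eq_Rintegral do rewrite E.
have ik (k : 'I_(size q)) : (@lebesgue_measure R).-integrable `]0%R, +oo[
    (fun v => (q`_k * expR (- k.+1%:R * y) * expR (- k.+1%:R * v `^ a^-1))%:E).
  have H := @integrable_strexp _ a a0 k.+1%:R (ltr0Sn _ k).
  exact: (@integrableZl _ _ _ lebesgue_measure _ (measurable_itv _) (q`_k * expR (- k.+1%:R * y)) _ H).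
rewrite /Rintegral; under [in RHS]eq_integral do rewrite -sumEFin.
rewrite (integral_sum _ ik)//.
rewrite (eq_bigr (fun k : 'I_(size q) =>
    (q`_k * expR (- k.+1%:R * y) * (k.+1%:R `^ (- a) * Gamma (1 + a)))%:E)).
  rewrite sumEFin /= mulr_sumr; apply: eq_bigr => k _; ring.
move=> k _; rewrite -Rintegral_strexp// -RintegralZl//; last exact: integrable_strexp.
by rewrite fineK//; apply: integrable_fin_num.
Qed.

(** The coefficients of [q] may have any sign; positivity is visible only in the integral, where [w
    * q.[w] >= 0] for [w] in [[0, 1]]. *)
Lemma weighted_poly_ge0 (a y : R) (q : {poly R}) : 0 < a -> 0 <= y ->
  (forall u, 0 <= u <= 1 -> 0 <= q.[u]) ->
  0 <= \sum_(k < size q) q`_k * k.+1%:R `^ (- a) * expR (- k.+1%:R * y).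
Proof.
move=> a0 y0 q0; rewrite -(pmulr_rge0 _ (Gamma1_gt0 a0)) weighted_poly_integral//.
apply: Rintegral_ge0 => v Dv; have /andP[v0 v1] := strexp_itv a Dv.
have ey : expR (- y) <= 1 by rewrite -[leRHS]expR0 ler_expR oppr_le0.
rewrite mulr_ge0 ?mulr_ge0 ?expR_ge0// q0// mulr_ge0 ?expR_ge0//=.
by rewrite mulr_ile1 ?expR_ge0.
Qed.

Lemma derive_right_quotient (f : R -> R) (x df : R) : is_derive x 1 f df ->
  (f (x + k) - f x) / k @[k --> 0^'+] --> df.
Proof.
move=> [der dE].
have H : (fun k : R => k^-1 *: ((f \o shift x) (k *: 1) - f x)) @ 0^' --> df by rewrite -dE; exact: der.
apply: cvg_trans (cvg_dnbhs_at_right H); apply: near_eq_cvg; near=> k.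
by rewrite /= [k *: 1]mulr1 (addrC k) mulrC.
Unshelve. all: by end_near. Qed.

(* - psi' is the derivative of ell. *)
Let psi' (l : R) : R := (1 + l `^ alpha) `^ (- (1 + alpha^-1)).

Lemma ell_is_derive (l : R) : 0 < l ->
  (ell l - ell (l + k)) / k @[k --> 0^'+] --> psi' l.
Proof.
move=> l0.
have la0 : 0 < l `^ alpha by rewrite powR_gt0.
have B0 (x : R) : 0 < x -> 0 < 1 + x `^ alpha by move=> x0; rewrite addr_gt0// powR_gt0.
(* [1 + x^(- alpha) = x^(- alpha) (1 + x^alpha)], which turns [1 - ell] into [F]. *)
pose F (x : R) := x * (1 + x `^ alpha) `^ (- alpha^-1).
have ellF x : 0 < x -> ell x = 1 - F x.
  move=> x0; rewrite ellE /F; congr (_ - _); have xa0 : 0 < x `^ alpha by rewrite powR_gt0.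
  have -> : 1 + x `^ (- alpha) = x `^ (- alpha) * (1 + x `^ alpha).
    by rewrite mulrDr mulr1 powRN mulVf ?gt_eqF// addrC.
  rewrite powRM ?powR_ge0 ?(ltW (B0 _ x0))// -powRrM mulNr mulfV ?gt_eqF//.
  by rewrite powR_inv1 ?(ltW x0)// invfM invrK -powRN.
have dF : is_derive l 1 F (psi' l).
  have d1 := is_derive1_powR alpha l0.
  have d2 := is_deriveD (is_derive_cst (1 : R) l 1) d1.
  have d3 := is_derive1_powR (- alpha^-1) (B0 _ l0).
  have d4 := @is_derive1_comp _ (@powR R ^~ (- alpha^-1)) _ l _ _ d3 d2.
  apply: (is_derive_eq (is_deriveM (is_derive_id l 1) d4)).
  rewrite /psi' opprD powRD ?(gt_eqF (B0 _ l0)) ?implybT// powR_inv1 ?(ltW (B0 _ l0))//.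
  rewrite /= /GRing.scale/= fctE add0r mulr1.
  have B0' := B0 _ l0; have E1 : l * l `^ (alpha - 1) = l `^ alpha by rewrite mulr_powRB1// ltW.
  rewrite [in RHS]powRD ?(gt_eqF (B0 _ l0)) ?implybT// powR_inv1 ?(ltW (B0 _ l0))// /cst.
  have -> : l * (- alpha^-1 * ((1 + l `^ alpha) `^ (- alpha^-1) * (1 + l `^ alpha)^-1) * (alpha * l `^ (alpha - 1))) =
    - ((1 + l `^ alpha) `^ (- alpha^-1) * (1 + l `^ alpha)^-1) * (l * l `^ (alpha - 1)).
    by move: (_ `^ (- alpha^-1)) (_ `^ (alpha - 1)) => A1 A2; field; rewrite !gt_eqF.
  rewrite E1; move: (_ `^ (- alpha^-1)) => A1; move: (l `^ alpha) B0' => A2 B0'.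
  by field; rewrite gt_eqF.
have := derive_right_quotient dF; apply: cvg_trans; apply: near_eq_cvg; near=> k.
have k0 : 0 < k by near: k; exact: nbhs_right_gt.
rewrite !ellF ?addr_gt0//; congr (_ / _); move: (F (l + k)) (F l) => A1 A2; ring.
Unshelve. all: by end_near. Qed.

(** Both sides equal [l^(- alpha) (1 + l^alpha)^(- 1/alpha)]. *)
Lemma psi'E (l : R) : 0 < l ->
  psi' l * (1 + l `^ (- alpha)) = l `^ (- (1 + alpha)) * (1 - ell l).
Proof.
move=> l0.
have la0 : 0 < l `^ alpha by rewrite powR_gt0.
have E : 1 + l `^ (- alpha) = l `^ (- alpha) * (1 + l `^ alpha).
  by rewrite mulrDr mulr1 powRN mulVf ?gt_eqF// addrC.
rewrite ellE subKr E powRM ?powR_ge0 ?addr_ge0 ?ltW//.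
have B0 : 0 < 1 + l `^ alpha by rewrite addr_gt0.
have e1 : (l `^ (- alpha)) `^ alpha^-1 = l^-1.
  by rewrite -powRrM mulNr mulfV ?gt_eqF// powR_inv1// ltW.
have e2 (b c : R) : 0 < b -> b `^ (- (1 + c)) = b^-1 * (b `^ c)^-1.
  by move=> b0; rewrite opprD powRD ?(gt_eqF b0) ?implybT// powR_inv1 ?(ltW b0)// powRN.
rewrite /psi' e1 !e2// powRN.
have C0 := powR_gt0 alpha^-1 B0.
by field; rewrite !gt_eqF.
Qed.

(* Differentiating the transform at 1, 2, ... shows that the integral against mu of
   y (u q(u) + \sum_i q_i (i + 1)^(- alpha) u^(i + 1)), u = e^(- y), is
   \sum_i q_i (i + 1)^(- 1 - alpha) (1 - ell (i + 1)), and both sums over i against q are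
   nonnegative by weighted_poly_ge0. *)
Lemma laplace_atom_bound (y0 : R) (q : {poly R}) : 0 < y0 ->
  (forall u, 0 <= u <= 1 -> 0 <= q.[u]) ->
  fine (mu [set y0]) * (expR (- y0) * q.[expR (- y0)]) * y0 <=
  \sum_(k < size q) q`_k * k.+1%:R `^ (- (1 + alpha)).
Proof.
move=> y00 q0.
have mD : measurable (D : set TR) by exact: measurable_itv.
have a10 : 0 < 1 + alpha by rewrite addr_gt0.
pose W (l : R) := 1 + l `^ (- alpha).
pose u (y : R) := expR (- y).
have u01 y : D y -> 0 <= u y <= 1.
  by rewrite /D/= in_itv/= andbT => y1; rewrite expR_ge0 -[leRHS]expR0 ler_expR oppr_le0.
have uq y : \sum_(k < size q) q`_k * expR (- k.+1%:R * y) = u y * q.[u y].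
  rewrite horner_coef mulr_sumr; apply: eq_bigr => k _.
  by rewrite mulrCA -exprS /u -expRM_natr; congr (_ * expR _); ring.
(* A difference quotient of step [k] stands for the derivative; under the integral it becomes the
   nonnegative factor [(1 - expR (- k * y)) / k], which tends to [y]. Only the mass at [y0] and the
   term [u y * q.[u y]] are kept. *)
have bound (k : R) : 0 < k -> fine (mu [set y0]) * (u y0 * q.[u y0]) * ((1 - expR (- k * y0)) / k) <=
    \sum_(i < size q) q`_i * W i.+1%:R * ((ell i.+1%:R - ell (i.+1%:R + k)) / k).
  move=> k0; rewrite mulrA.
  have -> : \sum_(i < size q) q`_i * W i.+1%:R * ((ell i.+1%:R - ell (i.+1%:R + k)) / k) =
     (\sum_(i < size q) q`_i * W i.+1%:R * ell i.+1%:R -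
      \sum_(i < size q) q`_i * W i.+1%:R * ell (i.+1%:R + k)) / k.
    by rewrite -sumrB mulr_suml; apply: eq_bigr => i _; rewrite mulrA mulrBr.
  rewrite ler_pM2r ?invr_gt0//.
  have lk (i : nat) : 0 < i.+1%:R + k by rewrite addr_gt0.
  have l1 (i : nat) : 0 < i.+1%:R :> R by [].
  have E1 := @laplace_sum (size q) (fun i => q`_i * W i.+1%:R) _ l1.
  have E2 := @laplace_sum (size q) (fun i => q`_i * W i.+1%:R) _ lk.
  cbv beta in E1, E2; rewrite {}E1 {}E2.
  have isum (l : nat -> R) : (forall i, 0 < l i) ->
      mu.-integrable D (EFin \o (fun y => \sum_(i < size q) q`_i * W i.+1%:R * expR (- l i * y))).
    move=> l0; rewrite (_ : _ \o _ = fun y => \sum_(i < size q) (q`_i * W i.+1%:R * expR (- l i * y))%:E)%E.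
      apply: integrable_sum => // i _.
      have H := integrable_exp_on (ltW (l0 i)).
      exact: (@integrableZl _ _ _ mu _ mD (q`_i * W i.+1%:R) _ H).
    by apply/funext => y /=; rewrite sumEFin.
  rewrite -(RintegralB mD (isum _ l1) (isum _ lk)).
  pose c := u y0 * q.[u y0] * (1 - expR (- k * y0)).
  have -> : fine (mu [set y0]) * (u y0 * q.[u y0]) * (1 - expR (- k * y0)) =
      \int[mu]_(y in D) (c * \1_[set y0] y).
    have iind : mu.-integrable D (EFin \o (\1_[set y0] : R -> R)).
      apply: (@integrable_bounded_on _ 1); first by apply: measurable_indic; exact: measurable_set1.
      by move=> y _; rewrite indicE; case: (_ \in _); rewrite ?normr1 ?normr0.
    rewrite (RintegralZl c mD iind).
    have -> : \int[mu]_(y in D) (\1_[set y0] y) = fine (mu [set y0]).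
      have m1 : measurable ([set y0] : set TR) by exact: measurable_set1.
      rewrite /Rintegral integral_indic//.
      by rewrite setIidl// => y ->; rewrite /D/= in_itv/= ltW.
    by rewrite /c -mulrA mulrC.
  apply: le_Rintegral => //.
  - apply: (@integrable_bounded_on _ `|c|).
      by apply: measurable_funM => //; apply: measurable_indic; exact: measurable_set1.
    by move=> y _; rewrite normrM ler_piMr// indicE; case: (_ \in _); rewrite ?normr1 ?normr0.
  - exact: (integrableB mD (isum _ l1) (isum _ lk)).
  move=> y Dy; have y_ge0 : 0 <= y by move: Dy; rewrite /D/= in_itv/= andbT.
  have -> : \sum_(i < size q) q`_i * W i.+1%:R * expR (- i.+1%:R * y) -
      \sum_(i < size q) q`_i * W i.+1%:R * expR (- (i.+1%:R + k) * y) =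
      (u y * q.[u y] + \sum_(i < size q) q`_i * i.+1%:R `^ (- alpha) * expR (- i.+1%:R * y)) *
      (1 - expR (- k * y)).
    rewrite -uq -big_split/= -sumrB mulr_suml; apply: eq_bigr => i _.
    rewrite /W (_ : - (i.+1%:R + k) * y = - i.+1%:R * y + - k * y); last by ring.
    rewrite expRD; move: (q`_i) (_ `^ _) (expR (_ * _)) (expR (- k * y)) => A1 A2 A3 A4; ring.
  have e0 : 0 <= 1 - expR (- k * y).
    by rewrite subr_ge0 -[leRHS]expR0 ler_expR mulNr oppr_le0 mulr_ge0// ltW.
  have w0 := weighted_poly_ge0 alpha_gt0 y_ge0 q0.
  have uq0 : 0 <= u y * q.[u y] by rewrite mulr_ge0 ?expR_ge0// q0// u01.
  rewrite indicE; case: (boolP (y \in _)) => [|_]; last by rewrite mulr0 mulr_ge0// addr_ge0.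
  by rewrite inE => /= yE; rewrite mulr1 /c -yE ler_wpM2r// lerDl.
have Bc : fine (mu [set y0]) * (u y0 * q.[u y0]) * ((1 - expR (- k * y0)) / k) @[k --> 0^'+] -->
    fine (mu [set y0]) * (u y0 * q.[u y0]) * y0.
  apply: cvgM; first exact: cvg_cst.
  have dE : is_derive (0 : R) (1 : R) (fun k : R => 1 - expR (- k * y0)) y0.
    have d1 : is_derive (0 : R) (1 : R) (fun k : R => - k * y0) (- y0).
      have -> : (fun k : R => - k * y0) = (fun k => - y0 * k) by apply/funext => k; rewrite mulNr mulrC mulNr.
      by have := @is_deriveZ _ _ _ id (- y0) (0 : R) 1 1 (is_derive_id _ _); rewrite scaler1.
    have d2 := @is_derive1_comp _ expR (fun k => - k * y0) 0 _ _ (is_derive_expR _) d1.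
    have := is_deriveB (is_derive_cst (1 : R) (0 : R) (1 : R)) d2.
    by rewrite oppr0 mul0r expR0 mul1r sub0r opprK.
  have := derive_right_quotient dE; apply: cvg_trans; apply: near_eq_cvg; near=> k.
  by rewrite add0r oppr0 mul0r expR0 subrr subr0.
have Sc : \sum_(i < size q) q`_i * W i.+1%:R * ((ell i.+1%:R - ell (i.+1%:R + k)) / k) @[k --> 0^'+] -->
    \sum_(i < size q) q`_i * W i.+1%:R * psi' i.+1%:R.
  elim: (size q) => [|n IH].
    by rewrite big_ord0; under eq_fun do rewrite big_ord0; exact: cvg_cst.
  rewrite big_ord_recr/=; under eq_fun do rewrite big_ord_recr/=.
  by apply: cvgD => //; apply: cvgM; [exact: cvg_cst|exact: ell_is_derive].
have H : fine (mu [set y0]) * (u y0 * q.[u y0]) * y0 <= \sum_(i < size q) q`_i * W i.+1%:R * psi' i.+1%:R.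
  apply: (ler_cvg_to Bc Sc); near=> k; apply: bound; near: k; exact: nbhs_right_gt.
apply: (le_trans H).
(* By [psi'E] the difference of the two sides is the sum of [q_i (i + 1)^(- 1 - alpha) ell(i + 1)],
   the integral of a function that is nonnegative by [weighted_poly_ge0]. *)
rewrite -subr_ge0 -sumrB.
rewrite (eq_bigr (fun i : 'I_(size q) => q`_i * i.+1%:R `^ (- (1 + alpha)) * ell i.+1%:R)); last first.
  move=> i _; have := @psi'E i.+1%:R (ltr0Sn _ _); rewrite -/(W _) => E.
  rewrite -mulrA (mulrC (W _)) E mulrA mulrBr mulr1.
  by rewrite opprB addrC subrK.
rewrite (@laplace_sum (size q) (fun i => q`_i * i.+1%:R `^ (- (1 + alpha))) (fun i => i.+1%:R))//.
apply: Rintegral_ge0 => y; rewrite /D/= in_itv/= andbT => y1.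
exact: weighted_poly_ge0.
Unshelve. all: by end_near. Qed.

(** [laplace_atom_bound] is applied to polynomials [q N] equal to 1 at [u0] and peaking there: the
    left side does not depend on [N], while the right side is an integral against Lebesgue measure
    that tends to 0 by dominated convergence. *)
Lemma laplace_atom_pos (y0 : R) : 0 < y0 -> mu [set y0] = 0%E.
Proof.
move=> y00.
have a10 : 0 < 1 + alpha by rewrite addr_gt0.
pose u0 := expR (- y0).
have u00 : 0 < u0 by exact: expR_gt0.
have u01 : u0 < 1 by rewrite /u0 -expR0 ltr_expR oppr_lt0.
(* q N tends to the indicator of u0 on [0, 1]. *)
pose q (N : nat) : {poly R} := (1 - ('X - u0%:P) ^+ 2) ^+ N.
have qE N u : (q N).[u] = (1 - (u - u0) ^+ 2) ^+ N by rewrite /q !hornerE.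
have base u : 0 <= u <= 1 -> 0 <= 1 - (u - u0) ^+ 2 <= 1.
  move=> /andP[h0 h1]; have A : 0 <= 1 - (u - u0) by lra.
  have B : 0 <= 1 + (u - u0) by lra.
  rewrite lerBlDr lerDl sqr_ge0 andbT (_ : 1 - _ = (1 - (u - u0)) * (1 + (u - u0))); last by ring.
  exact: mulr_ge0.
have q01 N u : 0 <= u <= 1 -> 0 <= (q N).[u] <= 1.
  by move=> /base/andP[h0 h1]; rewrite qE exprn_ge0//= exprn_ile1.
have bnd N : fine (mu [set y0]) * u0 * y0 * Gamma (1 + (1 + alpha)) <=
    \int[lebesgue_measure]_(v in `]0%R, +oo[)
      (expR (- v `^ (1 + alpha)^-1) * (q N).[expR (- v `^ (1 + alpha)^-1)]).
  have := laplace_atom_bound y00 (fun u h => proj1 (andP (q01 N u h))).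
  rewrite -/u0 qE subrr expr0n subr0 expr1n mulr1 => H.
  have := @weighted_poly_integral (1 + alpha) 0 (q N) a10 (lexx _).
  rewrite oppr0 expR0 => E.
  have -> : \int[lebesgue_measure]_(v in `]0%R, +oo[)
      (expR (- v `^ (1 + alpha)^-1) * (q N).[expR (- v `^ (1 + alpha)^-1)]) =
      \int[lebesgue_measure]_(v in `]0%R, +oo[)
      (expR (- v `^ (1 + alpha)^-1) * 1 * (q N).[expR (- v `^ (1 + alpha)^-1) * 1]).
    by apply: eq_Rintegral => v _; rewrite mulr1.
  rewrite -E mulrC ler_pM2l ?Gamma1_gt0//; apply: (le_trans H).
  by rewrite le_eqVlt; apply/orP; left; apply/eqP/eq_bigr => k _; rewrite mulr0 expR0 mulr1.
have lim0 : \int[lebesgue_measure]_(v in `]0%R, +oo[)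
      (expR (- v `^ (1 + alpha)^-1) * (q N).[expR (- v `^ (1 + alpha)^-1)]) @[N --> \oo] --> (0 : R).
  have mU := @measurable_strexp _ (1 + alpha) 1.
  have UE : (fun v : R => expR (- 1 * v `^ (1 + alpha)^-1)) = (fun v => expR (- v `^ (1 + alpha)^-1)).
    by apply/funext => v; rewrite mulN1r.
  rewrite UE in mU.
  have iU := @integrable_strexp _ (1 + alpha) a10 1 ltr01.
  have iU' : (@lebesgue_measure R).-integrable `]0%R, +oo[ (EFin \o (fun v => expR (- v `^ (1 + alpha)^-1))).
    by rewrite -UE.
  have mqU (N : nat) : measurable_fun (`]0%R, +oo[%classic : set R) (fun v : R => expR (- v `^ (1 + alpha)^-1) * (q N).[expR (- v `^ (1 + alpha)^-1)]).
    apply: measurable_funTS; apply: measurable_funM => //; apply: measurableT_comp mU.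
    by apply: continuous_measurable_fun; exact: continuous_horner.
  have := @Rintegral_dominated R _ _ lebesgue_measure (`]0%R, +oo[%classic : set R) (fun v => expR (- v `^ (1 + alpha)^-1))
    (measurable_itv _) (measurable_funTS mU) iU' (strexp_null a10) 1
    (fun N v => expR (- v `^ (1 + alpha)^-1) * (q N).[expR (- v `^ (1 + alpha)^-1)]) (fun=> 0) u0.
  rewrite /Rintegral integral0; apply => //.
  - by rewrite u00.
  - move=> N v Dv; have h := strexp_itv (1 + alpha) Dv; have /andP[h0 h1] := h.
    have /andP[k0 k1] := q01 N _ h.
    by rewrite ger0_norm ?mulr_ge0// mul1r ler_piMr.
  - move=> v Dv vu; have h := strexp_itv (1 + alpha) Dv.
    rewrite -[X in _ --> X](mulr0 (expR (- v `^ (1 + alpha)^-1))).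
    apply: cvgM; first exact: cvg_cst.
    under eq_fun do rewrite qE; apply: cvg_expr.
    have /andP[b0 b1] := base _ h; rewrite ger0_norm// ltrBlDr ltrDl.
    by rewrite lt_neqAle sqr_ge0 andbT eq_sym expf_eq0/= subr_eq0.
have m0 : fine (mu [set y0]) * u0 * y0 * Gamma (1 + (1 + alpha)) <= 0.
  by apply: (ler_cvg_to (cvg_cst _) lim0); exact: nearW.
have g0 := Gamma1_gt0 a10.
have mf : mu [set y0] \is a fin_num by apply: fin_num_measure; exact: measurable_set1.
rewrite -(fineK mf); congr EFin; apply/eqP; rewrite eq_le fine_ge0// andbT.
by move: m0; rewrite pmulr_lle0// pmulr_lle0// pmulr_lle0.
Qed.

Lemma laplace_atomless (y : R) : y != 0 -> mu [set y] = 0%E.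
Proof.
have [y0 _|y0 _|//] := ltgtP y 0.
- apply/eqP; rewrite eq_le measure_ge0 andbT -mu_neg; apply: le_measure.
  + by rewrite inE; exact: measurable_set1.
  + by rewrite inE; exact: measurable_itv.
  + by move=> z /= ->; rewrite in_itv.
- exact: laplace_atom_pos.
Qed.

Lemma laplace_integralT (l : R) : 0 < l -> (\int[mu]_y (expR (- l * y))%:E = (ell l)%:E)%E.
Proof.
move=> l0; have mD : measurable (D : set TR) by exact: measurable_itv.
have mN : measurable (`]-oo, 0%R[%classic : set TR) by exact: measurable_itv.
have me : measurable_fun setT (fun y : R => expR (- l * y)).
  by apply: continuous_measurable_fun; exact: continuous_expNM.
rewrite -mu_laplace// /Rintegral fineK; last first.
  by apply: integrable_fin_num => //; apply: integrable_exp_on; exact: ltW.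
have -> : [set: TR] = `]-oo, 0%R[%classic `|` D.
  apply/seteqP; split => // y _ /=; rewrite /D/= !in_itv/= andbT.
  by have [|] := ltP y 0; [left|right].
rewrite ge0_integral_setU//=.
- rewrite null_set_integral ?add0e//.
  by apply/measurable_EFinP; exact: measurable_funTS.
- by apply/measurable_EFinP; exact: measurable_funTS.
- by apply/disj_setPS => y [] /=; rewrite /D/= !in_itv/= andbT => /lt_geF ->.
Qed.

End laplace_atoms.

(** * Atoms, support and transform of convolution powers *)

Section convolution_powers.
Context {R : realType}.
Local Notation TR := (measurableTypeR R).

Lemma ge0_integral_convolution (mu nu : probability TR R) (f : TR -> \bar R) :
  measurable_fun setT f -> (forall y, (0 <= f y)%E) ->
  (\int[convolution mu nu]_z f z = \int[mu]_x \int[nu]_y f (x + y)%R)%E.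
Proof.
move=> mf f0; rewrite /convolution ge0_integral_distribution//.
have mF : measurable_fun setT (f \o pair_sum).
  by apply: measurableT_comp mf _; exact: measurable_pair_sum.
by rewrite (fubini_tonelli1 _ mF)// => z; exact: f0.
Qed.

(** For fixed [x], [nu] charges [z - x] only if [x = z], so the mass at [z] is [nu [set 0] * mu
    [set z]], which is 0. Hence possible atoms at 0 do no harm. *)
Lemma convolution_atomless (mu nu : probability TR R) (z : R) :
  (forall y, y != 0 -> mu [set y] = 0%E) -> (forall y, y != 0 -> nu [set y] = 0%E) ->
  z != 0 -> convolution mu nu [set z] = 0%E.
Proof.
move=> mu0 nu0 z0; have m1 y : measurable ([set y] : set TR) by exact: measurable_set1.
have -> : convolution mu nu [set z] = (\int[convolution mu nu]_y (\1_([set z] : set TR) y)%:E)%E.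
  by rewrite integral_indic// setIT.
rewrite ge0_integral_convolution//; last by apply/measurable_EFinP; exact: measurable_indic.
transitivity (\int[mu]_x (nu [set 0%R] * (\1_([set z] : set TR) x)%:E))%E.
  apply: eq_integral => x _.
  transitivity (\int[nu]_y (\1_([set (z - x)] : set TR) y)%:E)%E.
    apply: eq_integral => y _; rewrite !indicE; congr (_%:R%:E); congr nat_of_bool.
    apply/idP/idP; rewrite !inE /=.
      by move=> <-; ring.
    by move=> ->; ring.
  transitivity (nu [set (z - x)]); first by rewrite integral_indic// setIT.
  rewrite indicE; have [->|xz] := eqVneq x z.
    by rewrite subrr mem_set ?mule1.
  rewrite memNset ?mule0; first by apply: nu0; rewrite subr_eq0 eq_sym.
  by apply/eqP.
rewrite ge0_integralZl//.
- by rewrite integral_indic// setIT; apply/eqP; rewrite mule_eq0; apply/orP; right; apply/eqP; exact: mu0.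
- by apply/measurable_EFinP; exact: measurable_indic.
Qed.

Lemma convolution_neg (mu nu : probability TR R) :
  mu `]-oo, 0%R[%classic = 0%E -> nu `]-oo, 0%R[%classic = 0%E ->
  convolution mu nu `]-oo, 0%R[%classic = 0%E.
Proof.
move=> mu0 nu0; have mN : measurable (`]-oo, 0%R[%classic : set TR) by exact: measurable_itv.
pose A := (`]-oo, 0%R[%classic : set TR) `*` [set: TR].
pose B := [set: TR] `*` (`]-oo, 0%R[%classic : set TR).
have mA : measurable A by exact: measurableX.
have mB : measurable B by exact: measurableX.
have pA : (mu \x nu)%E A = 0%E.
  have -> : ((mu \x nu) A = mu `]-oo, 0%R[%classic * nu setT)%E by exact: product_measure1E.
  by rewrite mu0 mul0e.
have pB : (mu \x nu)%E B = 0%E.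
  have -> : ((mu \x nu) B = mu setT * nu `]-oo, 0%R[%classic)%E by exact: product_measure1E.
  by rewrite nu0 mule0.
apply/eqP; rewrite eq_le measure_ge0 andbT.
have mS : measurable (pair_sum @^-1` (`]-oo, 0%R[%classic : set TR)).
  by rewrite -[X in measurable X]setTI; exact: measurable_pair_sum.
have mAB : measurable (A `|` B) by exact: measurableU.
have sub : pair_sum @^-1` (`]-oo, 0%R[%classic : set TR) `<=` A `|` B.
  move=> [x y] /=; rewrite /pair_sum/= in_itv/= => xy.
  have [x0|x0] := ltP x 0; [left|right]; split => //=; rewrite in_itv//=; lra.
apply: (@le_trans _ _ ((mu \x nu)%E (A `|` B))).
  by apply: (@le_measure _ _ _ (mu \x nu)%E); rewrite ?inE.
apply: (le_trans (measureU2 (mu \x nu)%E mA mB)).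
by have -> : ((mu \x nu) A + (mu \x nu) B = 0)%E by rewrite pA pB adde0.
Qed.

Lemma convolution_laplace (mu nu : probability TR R) (l a b : R) :
  (\int[mu]_y (expR (- l * y))%:E = a%:E)%E -> (\int[nu]_y (expR (- l * y))%:E = b%:E)%E ->
  (\int[convolution mu nu]_y (expR (- l * y))%:E = (a * b)%:E)%E.
Proof.
move=> Ha Hb.
have me : measurable_fun setT (fun y : TR => (expR (- l * y))%:E).
  by apply/measurable_EFinP; apply: continuous_measurable_fun; exact: continuous_expNM.
have e0 (y : R) : (0 <= (expR (- l * y))%:E :> \bar R)%E by rewrite lee_fin expR_ge0.
rewrite ge0_integral_convolution//.
transitivity (\int[mu]_x (b%:E * (expR (- l * x))%:E))%E.
  apply: eq_integral => x _.
  under eq_integral do rewrite mulrDr expRD EFinM.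
  by rewrite ge0_integralZl_EFin ?expR_ge0// Hb muleC.
have b0 : 0 <= b by rewrite -lee_fin -Hb; exact: integral_ge0.
by rewrite ge0_integralZl_EFin// Ha -EFinM mulrC.
Qed.

Lemma convolution_pow_props (mu : probability TR R) (ell : R -> R) (j : nat) :
  (forall y, y != 0 -> mu [set y] = 0%E) -> mu `]-oo, 0%R[%classic = 0%E ->
  (forall l, 0 < l -> (\int[mu]_y (expR (- l * y))%:E = (ell l)%:E)%E) -> (0 < j)%N ->
  [/\ forall y, y != 0 -> convolution_pow mu j [set y] = 0%E,
      convolution_pow mu j `]-oo, 0%R[%classic = 0%E &
      forall l, 0 < l -> (\int[convolution_pow mu j]_y (expR (- l * y))%:E = (ell l ^+ j)%:E)%E].
Proof.
move=> mu1 mu0 mul; case: j => // j _; rewrite /convolution_pow /=.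
elim: j => [|j [IH1 IH2 IH3]] /=; first by split=> // l l0; rewrite expr1 mul.
split.
- by move=> y; exact: convolution_atomless.
- exact: convolution_neg.
- by move=> l l0; rewrite exprS; apply: convolution_laplace; [exact: mul|exact: IH3].
Qed.

Lemma lebesgue_stieltjes_neg (M : cumulativeBounded (0 : R) (1 : R)) :
  (forall y : R, y < 0 -> M y = 0) ->
  lebesgue_stieltjes_measure M `]-oo, 0%R[%classic = 0%E.
Proof.
move=> M0; set mu := lebesgue_stieltjes_measure M.
have mo (a b : R) : a <= b -> b < 0 -> mu `]a, b]%classic = 0%E.
  move=> ab b0; rewrite /mu /lebesgue_stieltjes_measure /measure_extension.
  rewrite measurable_mu_extE/=; last exact: is_ocitv.
  by rewrite wlength_itv_bnd// !M0 ?subrr// (le_lt_trans ab).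
(* The measure of half-open intervals is an increment of [M]. These cover the negative half line and
   stay away from 0, where [M] is not assumed to vanish. *)
pose F (n : nat) : set TR := `]- n%:R - 1, - n.+1%:R^-1]%classic.
have mF n : measurable (F n) by exact: measurable_itv.
have F0 n : mu (F n) = 0%E.
  apply: mo; last by rewrite oppr_lt0 invr_gt0 ltr0n.
  have : n.+1%:R^-1 <= 1 :> R by rewrite invf_le1 ?ler1n// ltr0n.
  have : 0 <= n%:R :> R by [].
  move: (n.+1%:R^-1) => a; lra.
have sub : `]-oo, 0%R[%classic `<=` \bigcup_n F n.
  move=> y /=; rewrite in_itv/= => y0.
  have [n ny] : exists n : nat, (`|y| + `|y|^-1) < n%:R.
    exists (Num.bound (`|y| + `|y|^-1)).
    by apply: archi_boundP; rewrite addr_ge0 ?invr_ge0.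
  exists n => //; rewrite /F /= in_itv/=.
  have yE : `|y| = - y by rewrite ltr0_norm.
  have yp : 0 < `|y| by rewrite normr_gt0 lt_eqF.
  have yi : 0 < `|y|^-1 by rewrite invr_gt0.
  apply/andP; split; first by rewrite yE in ny yi; lra.
  rewrite lerNr -yE -[leRHS]invrK lef_pV2 ?posrE ?ltr0n//.
  by rewrite -natr1; move: ny yp yi => /=; move: (`|y|) (`|y|^-1) (n%:R : R) => a b c; lra.
apply/eqP; rewrite eq_le measure_ge0 andbT.
apply: (@le_trans _ _ (mu (\bigcup_n F n))).
  by apply: le_measure => //; rewrite inE; [exact: measurable_itv|exact: bigcup_measurable].
apply: (le_trans (measure_sigma_subadditive _ mF _ _)); first exact: bigcup_measurable.
- by [].
- by rewrite eseries0// => n _ _; rewrite F0.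
Qed.

End convolution_powers.

(** * Galton-Watson trees *)

Section countable_fibers.
Context {d : measure_display} {T : measurableType d}.

(** Trees are observed through lists of labels, elements of a countable type; for such values,
    measurability of the preimages of points is enough and no sigma-algebra on the type has to be
    chosen. *)
Definition measurable_fibers (I : Type) (V : T -> I) :=
  forall v, measurable (V @^-1` [set v]).

Lemma bigcup_countType (I : countType) (A : set I) (F : I -> set T) :
  (forall i, measurable (F i)) -> measurable (\bigcup_(i in A) F i).
Proof.
move=> mF; rewrite bigcup_mkcond.
rewrite (_ : \bigcup_i _ = \bigcup_(n in [set: nat])
    if (pickle_inv n : option I) is Some i then if i \in A then F i else set0 else set0).
  apply: bigcup_measurable => n _; case: pickle_inv => // i.
  by case: ifP.
apply/seteqP; split => [w [i _ Fi]|w [n _]].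
  by exists (pickle i) => //; rewrite pickleK_inv.
by case E: (pickle_inv n) => [i|//] Fi; exists i.
Qed.

Lemma measurable_fibers_preimage (I : countType) (V : T -> I) (A : set I) :
  measurable_fibers V -> measurable (V @^-1` A).
Proof.
move=> mV; rewrite (_ : V @^-1` A = \bigcup_(i in A) (V @^-1` [set i])).
  exact: bigcup_countType.
by apply/seteqP; split => [w Aw|w [i Ai /= Vi]]; [exists (V w)|rewrite /preimage /= Vi].
Qed.

(** [V] acts as a random index; this is the step that makes recursively grown trees measurable. *)
Lemma measurable_fibers_bind (I : countType) (J : Type) (V : T -> I) (W : I -> T -> J) :
  measurable_fibers V -> (forall i, measurable_fibers (W i)) ->
  measurable_fibers (fun w => W (V w) w).
Proof.
move=> mV mW j; rewrite (_ : _ @^-1` _ =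
    \bigcup_(i in [set: I]) (V @^-1` [set i] `&` W i @^-1` [set j])).
  by apply: bigcup_countType => i; apply: measurableI; [exact: mV|exact: mW].
by apply/seteqP; split => [w /= Wj|w [i _ [/= <- //]]]; exists (V w).
Qed.

Lemma measurable_fibers_cst (I : Type) (i : I) : measurable_fibers (fun _ : T => i).
Proof.
move=> j; have [->|ij] := pselect (i = j).
  by rewrite (_ : _ @^-1` _ = setT)//; apply/seteqP; split => // w _.
by rewrite (_ : _ @^-1` _ = set0)//; apply/seteqP; split.
Qed.

Lemma measurable_fibers_comp (I : countType) (J : Type) (V : T -> I) (F : I -> J) :
  measurable_fibers V -> measurable_fibers (fun w => F (V w)).
Proof.
by move=> mV; apply: (measurable_fibers_bind (W := fun i _ => F i)) => // i;
  exact: measurable_fibers_cst.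
Qed.

Lemma measurable_fibers_fun (I : countType) (V : T -> I) d' (T' : measurableType d')
    (F : I -> T') : measurable_fibers V -> measurable_fun setT (fun w => F (V w)).
Proof.
move=> mV _ A mA; rewrite setTI; exact: (measurable_fibers_preimage (F @^-1` A)).
Qed.

Context {R : realType} (P : probability T R).

Lemma ge0_integral_fibers (I : countType) (V : T -> I) (B : set T) (Y : T -> R) :
  measurable_fibers V -> measurable B -> measurable_fun setT Y -> (forall w, 0 <= Y w) ->
  (\int[P]_(w in B) (Y w)%:E = \sum_(n <oo) if (pickle_inv n : option I) is Some i then
     \int[P]_(w in B `&` V @^-1` [set i]) (Y w)%:E else 0)%E.
Proof.
move=> mV mB mY Y0.
pose F n := if (pickle_inv n : option I) is Some i then
  B `&` V @^-1` [set i] else set0.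
have mF n : measurable (F n).
  rewrite /F; case: pickle_inv => // i; apply: measurableI => //; exact: mV.
have BF : B = \bigcup_n F n.
  apply/seteqP; split => [w Bw|w [n _]].
    by exists (pickle (V w)) => //; rewrite /F pickleK_inv.
  by rewrite /F; case: pickle_inv => // i [].
rewrite {1}BF ge0_integral_bigcup//.
- apply: eq_eseriesr => n _; rewrite /F; case: pickle_inv => // ; exact: integral_set0.
- by apply/measurable_EFinP; exact: measurable_funTS.
- by move=> w _; rewrite lee_fin.
- apply/trivIsetP => a b _ _ ab; apply/seteqP; split => // w [].
  have aP := @pickle_invK I a; have bP := @pickle_invK I b; rewrite /F.
  case: (pickle_inv a) aP => [i /= ia|//] [_ /= Vi].
  case: (pickle_inv b) bP => [k /= kb|//] [_ /= Vk].
  by move: ab; rewrite -ia -kb -Vi -Vk eqxx.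
Qed.

(** Conditioning on a countably valued [V]: an identity between integrals may be checked on each
    event [V = v]. It takes the place of conditional expectations. *)
Lemma eq_integral_fibers (I : countType) (V : T -> I) (B1 B2 : set T) (Y1 Y2 : T -> R) (c : R) :
  measurable_fibers V -> measurable B1 -> measurable B2 ->
  measurable_fun setT Y1 -> measurable_fun setT Y2 ->
  (forall w, 0 <= Y1 w) -> (forall w, 0 <= Y2 w) -> 0 <= c ->
  (forall v, \int[P]_(w in B1 `&` V @^-1` [set v]) (Y1 w)%:E =
     c%:E * \int[P]_(w in B2 `&` V @^-1` [set v]) (Y2 w)%:E)%E ->
  (\int[P]_(w in B1) (Y1 w)%:E = c%:E * \int[P]_(w in B2) (Y2 w)%:E)%E.
Proof.
move=> mV mB1 mB2 mY1 mY2 Y10 Y20 c0 H.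
rewrite (ge0_integral_fibers mV)// (ge0_integral_fibers (B := B2) mV)//.
rewrite -nneseriesZl; last by move=> n _; case: pickle_inv => // i; apply: integral_ge0 => w _; rewrite lee_fin.
apply: eq_eseriesr => n _; case: pickle_inv => [i|]; last by rewrite mule0.
exact: H.
Qed.

End countable_fibers.

(** * Events independent of a family of offspring numbers *)

Section offspring_independence.
Context {d : measure_display} {T : measurableType d} {R : realType}.
Context {P : probability T R}.
Variable xi : seq nat -> {RV P >-> nat}.
Hypothesis xi_indep : mutually_independent xi.

Let p (u : seq nat) (A : set nat) : R := fine (P (xi u @^-1` A)).

Lemma xi_measurable u A : measurable (xi u @^-1` A).
Proof. by rewrite -[X in measurable X]setTI; exact: (measurable_funP (xi u)). Qed.

Lemma p_ge0 u A : 0 <= p u A.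
Proof. by rewrite fine_ge0. Qed.

Lemma pE u A : P (xi u @^-1` A) = (p u A)%:E.
Proof. by rewrite /p fineK// fin_num_measure//; exact: xi_measurable. Qed.

(** Independence of [B] from the variables [xi u], [u] in [S]. The index set is explicit so that
    variables can be moved, one at a time, from the family into the event. *)
Definition indep_of (S : set (seq nat)) (B : set T) := measurable B /\
  forall (s : seq (seq nat)) (A : seq nat -> set nat), uniq s -> [set` s] `<=` S ->
  (P (B `&` \bigcap_(u in [set` s]) (xi u @^-1` A u)) =
   P B * (\prod_(u <- s) p u (A u))%:E)%E.

Lemma bigcap_xi_measurable (s : seq (seq nat)) (A : seq nat -> set nat) :
  measurable (\bigcap_(u in [set` s]) (xi u @^-1` A u)).
Proof.
elim: s => [|u s IH].
  by rewrite (_ : [set` [::]] = set0) ?bigcap_set0//; apply/seteqP; split.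
rewrite (_ : [set` u :: s] = u |` [set` s]).
  by rewrite bigcap_setU1; apply: measurableI => //; exact: xi_measurable.
by apply/seteqP; split => v /=; rewrite inE => /predU1P.
Qed.

Lemma indep_of_setT S : indep_of S setT.
Proof.
split=> // s A us _; rewrite setTI probability_setT mul1e xi_indep//.
by rewrite -prodEFin; apply: eq_bigr => u _; rewrite pE.
Qed.

Lemma indep_of0 S : indep_of S set0.
Proof. by split=> // s A us _; rewrite set0I measure0 mul0e. Qed.

Lemma indep_of_sub S S' B : S' `<=` S -> indep_of S B -> indep_of S' B.
Proof. by move=> S'S [mB H]; split => // s A us /subset_trans /(_ S'S); exact: H. Qed.

Lemma indep_of_event S B u A : indep_of S B -> S u ->
  indep_of (S `\ u) (B `&` xi u @^-1` A) /\
  (P (B `&` xi u @^-1` A) = P B * (p u A)%:E)%E.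
Proof.
move=> [mB H] Su.
have E : (P (B `&` xi u @^-1` A) = P B * (p u A)%:E)%E.
  have := H [:: u] (fun=> A) isT; rewrite set_cons1 bigcap_set1 big_seq1.
  by apply => v /= ->.
split=> //; split; first by apply: measurableI => //; exact: xi_measurable.
move=> s A' us sS.
have us' : u \notin s by apply/negP => /sS [_] /=; exact.
(* [A2] prescribes [A] at [u] and [A'] on [s], so that the hypothesis for [u :: s] yields the factor
   of [u] and those of [s] together. *)
pose A2 v := if v == u then A else A' v.
have := H (u :: s) A2; rewrite /= us us' => /(_ isT).
have E2 : \prod_(v <- s) p v (A2 v) = \prod_(v <- s) p v (A' v).
  by apply: eq_big_seq => v vs; rewrite /A2; case: eqP => // vu; rewrite vu (negbTE us') in vs.
have A2u : A2 u = A by rewrite /A2 eqxx.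
rewrite big_cons E2 A2u EFinM muleA -E => <-.
  rewrite (_ : [set` u :: s] = u |` [set` s]).
    rewrite bigcap_setU1 A2u setIA; congr (P (_ `&` _)).
    by apply: eq_bigcapr => v /= vs; rewrite /A2; case: eqP => // vu; rewrite vu (negbTE us') in vs.
  by apply/seteqP; split => v /=; rewrite inE => /predU1P.
by move=> v /=; rewrite inE => /predU1P[->//|/sS []].
Qed.

Lemma indep_of_fibers (I : countType) (V : T -> I) S B : measurable_fibers V -> measurable B ->
  (forall v, indep_of S (B `&` V @^-1` [set v])) -> indep_of S B.
Proof.
move=> mV mB H; split => // s A us sS.
have P1 (C : set T) : measurable C -> P C = (\int[P]_(w in C) (1 : R)%:E)%E.
  by move=> mC; rewrite integral_cst// mul1e.
have mC := bigcap_xi_measurable s A.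
rewrite (P1 _ (measurableI _ _ mB mC)) (P1 B)// muleC.
apply: (eq_integral_fibers mV) => //.
- exact: measurableI.
- by apply: prodr_ge0 => u _; exact: p_ge0.
move=> v; rewrite -!P1; last 2 first.
- by apply: measurableI => //; exact: mV.
- by apply: measurableI; [exact: measurableI|exact: mV].
by have [_ /(_ s A us sS)] := H v; rewrite muleC setIAC => <-.
Qed.

Lemma measurable_fibers_xi u : measurable_fibers (xi u).
Proof. by move=> k; exact: xi_measurable. Qed.

Lemma measurable_fibers_xis (G : seq (seq nat)) :
  measurable_fibers (fun w => [seq xi u w | u <- G]).
Proof.
elim: G => [|u G IH] /=; first exact: measurable_fibers_cst.
apply: (measurable_fibers_bind (V := xi u) (W := fun k w => k :: [seq xi u w | u <- G])).
  exact: measurable_fibers_xi.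
by move=> k; apply: (measurable_fibers_comp (fun l => k :: l)).
Qed.

Lemma indep_of_xis S B (G : seq (seq nat)) k : indep_of S B -> uniq G -> [set` G] `<=` S ->
  indep_of (S `\` [set` G]) (B `&` (fun w => [seq xi u w | u <- G]) @^-1` [set k]).
Proof.
elim: G S B k => [|u G IH] S B k iB /=.
  move=> _ _; case: k => [|k0 k].
    apply: indep_of_sub (_ : indep_of S _); first by move=> v [].
    by rewrite (_ : _ @^-1` _ = setT) ?setIT//; apply/seteqP; split.
  by rewrite (_ : _ @^-1` _ = set0) ?setI0; [exact: indep_of0|apply/seteqP; split].
move=> /andP[uG unG] GS; case: k => [|k0 k].
  by rewrite (_ : _ @^-1` _ = set0) ?setI0; [exact: indep_of0|apply/seteqP; split].
have Su : S u by apply: GS => /=; rewrite inE eqxx.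
have [iB' _] := indep_of_event [set k0] iB Su.
have := IH (S `\ u) _ k iB' unG.
have GS' : [set` G] `<=` S `\ u.
  move=> v /= vG; split; first by apply: GS => /=; rewrite inE vG orbT.
  by move=> /= vu; rewrite -vu vG in uG.
move=> /(_ GS').
rewrite -setIA (_ : xi u @^-1` [set k0] `&` _ =
  (fun w => xi u w :: [seq xi u0 w | u0 <- G]) @^-1` [set k0 :: k]).
  apply: indep_of_sub => v /= [Sv]; rewrite inE => /negP; rewrite negb_or => /andP[/eqP vu /negP vG].
  by split.
by apply/seteqP; split => w /= [-> ->].
Qed.

(** The offspring numbers in [G] are revealed one by one: on the event [xi u = k] the factor of [u]
    is constant, and by [indep_of_event] the others stay independent of the enlarged event. *)
Lemma integral_prod_indep S B (G : seq (seq nat)) (q : seq nat -> nat -> R) (e : seq nat -> R) :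
  indep_of S B -> uniq G -> [set` G] `<=` S -> (forall u k, 0 <= q u k) ->
  (forall u, \int[P]_w (q u (xi u w))%:E = (e u)%:E)%E ->
  (\int[P]_(w in B) (\prod_(u <- G) q u (xi u w))%:E = P B * (\prod_(u <- G) e u)%:E)%E.
Proof.
move=> iB uG GS q0 qe.
have e0 u : 0 <= e u.
  by rewrite -lee_fin -qe; apply: integral_ge0 => w _; rewrite lee_fin.
have mq u : measurable_fun setT (fun w => q u (xi u w)).
  exact: measurable_fibers_fun (measurable_fibers_xi u).
have mprod (s : seq (seq nat)) : measurable_fun setT (fun w => \prod_(u <- s) q u (xi u w)).
  elim: s => [|u s IH].
    by under eq_fun do rewrite big_nil; exact: measurable_cst.
  by under eq_fun do rewrite big_cons; exact: measurable_funM.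
elim: G S B iB uG GS => [|u G IH] S B iB /=.
  move=> _ _; under eq_integral do rewrite big_nil.
  by rewrite big_nil integral_cst ?mul1e ?mule1//; case: iB.
move=> /andP[uG unG] GS.
have Su : S u by apply: GS => /=; rewrite inE eqxx.
have [mB _] := iB.
have E k : (\int[P]_(w in B `&` xi u @^-1` [set k]) (\prod_(u <- G) q u (xi u w))%:E =
    P (B `&` xi u @^-1` [set k]) * (\prod_(u <- G) e u)%:E)%E.
  have [iB' _] := indep_of_event [set k] iB Su.
  apply: (IH _ _ iB' unG) => v /= vG; split; first by apply: GS => /=; rewrite inE vG orbT.
  by move=> /= vu; rewrite -vu vG in uG.
have mBk k : measurable (B `&` xi u @^-1` [set k]).
  by apply: measurableI => //; exact: xi_measurable.
have c0 : 0 <= \prod_(u <- G) e u by exact: prodr_ge0.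
under eq_integral do rewrite big_cons.
rewrite (@eq_integral_fibers _ _ _ P _ (xi u) B B _ (fun w => q u (xi u w)) (\prod_(u <- G) e u))//.
- rewrite big_cons; suff -> : (\int[P]_(w in B) (q u (xi u w))%:E = P B * (e u)%:E)%E.
    by rewrite EFinM muleCA; congr (_ * _)%E; exact: muleC.
  have -> : (P B * (e u)%:E = (fine (P B))%:E * \int[P]_w (q u (xi u w))%:E)%E.
    by rewrite qe fineK// fin_num_measure.
  apply: (@eq_integral_fibers _ _ _ P _ (xi u)) => //.
  + exact: measurable_fibers_xi.
  + by rewrite fine_ge0.
  move=> k; rewrite setTI.
  rewrite (eq_integral (fun=> (q u k)%:E)); last by move=> w; rewrite inE => -[_ /= ->].
  rewrite integral_cst//.
  rewrite [in RHS](eq_integral (fun=> (q u k)%:E)); last by move=> w; rewrite inE /= => ->.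
  rewrite integral_cst//; last exact: xi_measurable.
  have [_ E1] := indep_of_event [set k] iB Su.
  apply: (etrans (congr1 (fun z => (q u k)%:E * z)%E E1)).
  have PBf : P B \is a fin_num by exact: fin_num_measure.
  by rewrite (fineK PBf) muleCA -pE.
- exact: measurable_fibers_xi.
- by apply: measurable_funM.
- by move=> w; rewrite mulr_ge0// prodr_ge0.
- move=> k.
  rewrite (eq_integral (fun w => (q u k)%:E * (\prod_(u <- G) q u (xi u w))%:E)%E); last first.
    by move=> w; rewrite inE => -[_ /= ->]; rewrite EFinM.
  rewrite ge0_integralZl_EFin//; last 2 first.
  + by move=> w _; rewrite lee_fin prodr_ge0.
  + by apply/measurable_EFinP; exact: measurable_funTS.
  rewrite E (eq_integral (fun=> (q u k)%:E)); last by move=> w; rewrite inE => -[_ /= ->].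
  by rewrite integral_cst// muleA muleC.
Qed.

End offspring_independence.

Section generation_facts.
Variable c : seq nat -> nat.

Lemma generationS n : generation c n.+1 =
  [seq rcons u i | u <- generation c n, i <- iota 0 (c u)].
Proof. by []. Qed.

Lemma mem_generationS n v : v \in generation c n.+1 ->
  exists u i, u \in generation c n /\ v = rcons u i.
Proof. by rewrite generationS => /allpairsPdep[u [i [un _ ->]]]; exists u, i. Qed.

Lemma size_generation n v : v \in generation c n -> size v = n.
Proof.
elim: n v => [|n IH] v; first by rewrite inE => /eqP ->.
by move=> /mem_generationS[u [i [/IH <- ->]]]; rewrite size_rcons.
Qed.

Lemma uniq_generation n : uniq (generation c n).
Proof.
elim: n => // n IH; rewrite generationS; apply: allpairs_uniq_dep => //.
- by move=> u _; exact: iota_uniq.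
- by move=> [u i] [v k] /= _ _ E; move/rcons_inj: E => [uv ik]; subst.
Qed.

Lemma take_generation N m v : v \in generation c (N + m) -> take N v \in generation c N.
Proof.
elim: m v => [|m IH] v.
  by rewrite addn0 => vN; rewrite take_oversize// (size_generation vN).
rewrite addnS => /mem_generationS[u [i [uN ->]]].
rewrite -cats1 takel_cat; first exact: IH.
by rewrite (size_generation uN) leq_addr.
Qed.

End generation_facts.

(** * The branching property and the reduced process *)

Section generation_law.
Context {d : measure_display} {T : measurableType d} {R : realType}.
Context {P : probability T R}.
Variable xi : seq nat -> {RV P >-> nat}.
Hypothesis xi_indep : mutually_independent xi.
Hypothesis xi_ident : identically_distributed xi.

Let f := pgf (xi [::]) : R -> R.
Let gen n w := generation (fun u => xi u w) n.

Let integral_pow_xi_le1 s : 0 <= s <= 1 -> (\int[P]_w (s ^+ xi [::] w)%:E <= 1)%E.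
Proof.
move=> /andP[s0 s1]; apply: (@le_trans _ _ (\int[P]_w (cst 1%:E w))%E).
  apply: ge0_le_integral => //.
  - by move=> w _; rewrite lee_fin exprn_ge0.
  - apply/measurable_EFinP.
    exact: (measurable_fibers_fun (fun k => s ^+ k) (measurable_fibers_xi xi [::])).
  - by move=> w _; rewrite lee_fin exprn_ile1.
by rewrite integral_cst// mul1e; exact: (probability_le1 P measurableT).
Qed.

Lemma integral_pow_xi u s : 0 <= s <= 1 -> (\int[P]_w (s ^+ xi u w)%:E = (f s)%:E)%E.
Proof.
move=> s01; have /andP[s0 s1] := s01.
have ms : measurable_fun setT (fun k : nat => (s ^+ k)%:E : \bar R) by [].
have sk0 (k : nat) : (0 <= (s ^+ k)%:E :> \bar R)%E by rewrite lee_fin exprn_ge0.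
have E v : (\int[P]_w (s ^+ xi v w)%:E = \int[distribution P (xi v)]_k (s ^+ k)%:E)%E.
  by rewrite ge0_integral_distribution.
have E0 : (\int[P]_w (s ^+ xi u w)%:E = \int[P]_w (s ^+ xi [::] w)%:E)%E.
  rewrite !E; apply: eq_measure_integral => A mA _.
  exact: xi_ident.
rewrite E0 /f /pgf unlock fineK// ge0_fin_numE; last first.
  by apply: integral_ge0 => w _; rewrite lee_fin exprn_ge0.
exact: le_lt_trans (integral_pow_xi_le1 s01) (ltry _).
Qed.

Lemma pgf_itv s : 0 <= s <= 1 -> 0 <= f s <= 1.
Proof.
move=> s01; have /andP[s0 s1] := s01.
rewrite -!lee_fin -(integral_pow_xi [::] s01); apply/andP; split.
  by apply: integral_ge0 => w _; rewrite lee_fin exprn_ge0.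
exact: integral_pow_xi_le1.
Qed.

Lemma iter_pgf_itv n s : 0 <= s <= 1 -> 0 <= iter n f s <= 1.
Proof. by move=> s01; elim: n => //= n; exact: pgf_itv. Qed.

Lemma measurable_fibers_gen n : measurable_fibers (gen n).
Proof.
elim: n => [|n IH]; first exact: measurable_fibers_cst.
apply: (measurable_fibers_bind (V := gen n)
  (W := fun G w => [seq rcons u i | u <- G, i <- iota 0 (xi u w)])) => //.
elim=> [|u G IHG]; first exact: measurable_fibers_cst.
apply: (measurable_fibers_bind (V := xi u)
  (W := fun k w => [seq rcons u i | i <- iota 0 k] ++
    [seq rcons u i | u <- G, i <- iota 0 (xi u w)])).
  exact: measurable_fibers_xi.
move=> k; exact: (measurable_fibers_comp (fun l => [seq rcons u i | i <- iota 0 k] ++ l)).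
Qed.

(** One generation step as a function of a list of particles and the list of their offspring
    numbers: conditioning on both makes the next generation constant. *)
Let children (G : seq (seq nat)) (k : seq nat) : seq (seq nat) :=
  flatten [seq [seq rcons ui.1 i | i <- iota 0 ui.2] | ui <- zip G k].

Lemma gen_children (G : seq (seq nat)) w :
  [seq rcons u i | u <- G, i <- iota 0 (xi u w)] = children G [seq xi u w | u <- G].
Proof. by elim: G => //= u G ->. Qed.

(** Generation [n] involves only labels shorter than [n]. Given a generation and its offspring
    numbers, the next one is determined, so each piece of the decomposition is either empty or an
    event to which [indep_of_xis] applies. *)
Lemma indep_of_gen n G : indep_of xi [set u | (n <= size u)%N] (gen n @^-1` [set G]).
Proof.
elim: n G => [|n IH] G.
  have [->|G0] := eqVneq G [:: [::]].
    rewrite (_ : _ @^-1` _ = setT); first exact: indep_of_setT.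
    by apply/seteqP; split.
  rewrite (_ : _ @^-1` _ = set0); first exact: indep_of0.
  by apply/seteqP; split => // w /= E; move: G0; rewrite -E eqxx.
apply: (@indep_of_fibers _ _ _ _ _ _ (gen n)).
- exact: measurable_fibers_gen.
- exact: measurable_fibers_gen.
move=> G0.
have mB := measurableI _ _ (measurable_fibers_gen n.+1 G) (measurable_fibers_gen n G0).
apply: (@indep_of_fibers _ _ _ _ _ _ (fun w => [seq xi u w | u <- G0])) => //.
  exact: measurable_fibers_xis.
move=> k; have [E|E] := eqVneq (children G0 k) G; last first.
  rewrite (_ : _ `&` _ = set0); first exact: indep_of0.
  apply/seteqP; split => // w /= [[E1 E2] E3].
  by move: E; rewrite -E3 -gen_children -E1 -E2 eqxx.
rewrite (_ : _ `&` _ = gen n @^-1` [set G0] `&`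
    (fun w => [seq xi u w | u <- G0]) @^-1` [set k]); last first.
  apply/seteqP; split => w /=; first by move=> [[E1 E2] E3].
  move=> [E2 E3]; split=> //; split=> //.
  by rewrite -E -E3 -gen_children -E2.
have [[w /= wG]|G0N] := pselect (exists w, gen n w = G0); last first.
  rewrite (_ : _ `&` _ = set0); first exact: indep_of0.
  by apply/seteqP; split => // w /= [E2 _]; apply: G0N; exists w.
have sG u : u \in G0 -> size u = n by rewrite -wG; exact: size_generation.
have := @indep_of_xis _ _ _ _ xi _ _ G0 k (IH G0).
rewrite -{1}wG uniq_generation => /(_ isT).
have sub : [set` G0] `<=` [set u | (n <= size u)%N] by move=> u /= /sG ->.
move=> /(_ sub); apply: indep_of_sub => u /= nu; split; first exact: ltnW.
by move=> /sG su; rewrite su ltnn in nu.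
Qed.

Lemma prod_map_const (G : seq (seq nat)) (k : seq nat) (F : seq nat -> R) (n : nat) :
  size k = size G -> {in G, forall u, size u = n} ->
  \prod_(v <- children G k) F (take n v) = \prod_(ui <- zip G k) F ui.1 ^+ ui.2.
Proof.
move=> + Gn; rewrite /children big_flatten big_map.
move=> sk; apply: eq_big_seq => -[u i] /= ui.
have uG : u \in G.
  by have := map_f fst ui; rewrite -/(unzip1 _) unzip1_zip// sk.
rewrite big_map.
under eq_bigr do rewrite -cats1 takel_cat ?(Gn _ uG)// take_oversize ?(Gn _ uG)//.
by rewrite big_const_seq count_predT size_iota iter_mulr_1.
Qed.

(** The branching property with a separate weight for the descendants of each particle of generation
    [N]; distinct weights are what the reduced process needs. The induction on [m] moves the
    starting generation from [N] to [N.+1], children inheriting the weight of their parent. *)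
Lemma integral_gen_prod m N B G (sigma : seq nat -> R) :
  indep_of xi [set u | (N <= size u)%N] B -> (forall w, B w -> gen N w = G) ->
  (forall u, 0 <= sigma u <= 1) ->
  (\int[P]_(w in B) (\prod_(v <- gen (N + m) w) sigma (take N v))%:E =
   P B * (\prod_(u <- G) iter m f (sigma u))%:E)%E.
Proof.
elim: m N B G sigma => [|m IH] N B G sigma iB BG s01.
  rewrite (eq_integral (fun=> (\prod_(u <- G) sigma u)%:E)).
    have [mB _] := iB; rewrite (integral_cst P mB).
    exact: muleC.
  move=> w; rewrite inE => Bw; rewrite addn0 (BG _ Bw); congr EFin.
  rewrite -(BG _ Bw); apply: eq_big_seq => u uG.
  by rewrite take_oversize// (size_generation uG).
have [[w0 Bw0]|B0] := pselect (exists w, B w); last first.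
  rewrite (_ : B = set0) ?integral_set0 ?measure0 ?mul0e//.
  by apply/seteqP; split => // w Bw; apply: B0; exists w.
have GE : G = gen N w0 by rewrite BG.
have uG : uniq G by rewrite GE uniq_generation.
have sG : {in G, forall u, size u = N} by rewrite GE => u; exact: size_generation.
have GS : [set` G] `<=` [set u | (N <= size u)%N] by move=> u /= /sG ->.
have mB : measurable B by case: iB.
have s01' u : 0 <= iter m f (sigma u) <= 1 by exact: iter_pgf_itv.
have zipE w : \prod_(ui <- zip G [seq xi u w | u <- G]) iter m f (sigma ui.1) ^+ ui.2 =
    \prod_(u <- G) iter m f (sigma u) ^+ xi u w.
  elim: (G) => [|u G' IHG]; first by rewrite !big_nil.
  by rewrite /= !big_cons IHG.
(* condition on the offspring numbers of generation N, then compare with the one-step product *)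
transitivity (1%:E * \int[P]_(w in B)
    (\prod_(u <- G) iter m f (sigma u) ^+ xi u w)%:E)%E; last first.
  rewrite mul1e.
  apply: (integral_prod_indep (q := fun u k => iter m f (sigma u) ^+ k)
    (e := fun u => f (iter m f (sigma u))) iB uG GS).
  - by move=> u k; rewrite exprn_ge0//; case/andP: (s01' u).
  - by move=> u; exact: integral_pow_xi.
apply: (@eq_integral_fibers _ _ _ P _ (fun w => [seq xi u w | u <- G])) => //.
- exact: measurable_fibers_xis.
- exact: (measurable_fibers_fun (fun L => \prod_(v <- L) sigma (take N v)) (measurable_fibers_gen _)).
- apply: eq_measurable_fun (fun w _ => zipE w) _.
  exact: (measurable_fibers_fun (fun k => \prod_(ui <- zip G k) iter m f (sigma ui.1) ^+ ui.2)
    (measurable_fibers_xis xi G)).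
- by move=> w; apply: prodr_ge0 => v _; case/andP: (s01 (take N v)).
- by move=> w; apply: prodr_ge0 => v _; rewrite exprn_ge0//; case/andP: (s01' v).
move=> k; rewrite mul1e; set C := B `&` _.
have [sk|sk] := eqVneq (size k) (size G); last first.
  rewrite (_ : C = set0) ?integral_set0//; apply/seteqP; split => // w [_ /= E].
  by move: sk; rewrite -E size_map eqxx.
have iC : indep_of xi [set u | (N.+1 <= size u)%N] C.
  apply: indep_of_sub (indep_of_xis k iB uG GS) => u /= Nu; split; first exact: ltnW.
  by move=> /sG su; rewrite su ltnn in Nu.
have mC : measurable C by case: iC.
have zipG w : C w -> \prod_(u <- G) iter m f (sigma u) ^+ xi u w =
    \prod_(ui <- zip G k) iter m f (sigma ui.1) ^+ ui.2.
  by move=> [_ /= <-]; rewrite zipE.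
have Cgen w : C w -> gen N.+1 w = children G k.
  by move=> [Bw /= <-]; rewrite -gen_children -(BG _ Bw).
have := IH N.+1 C (children G k) (fun u => sigma (take N u)) iC Cgen (fun u => s01 _).
rewrite (prod_map_const (fun u => iter m f (sigma u)) sk sG) addSnnS => E.
transitivity (P C * (\prod_(ui <- zip G k) iter m f (sigma ui.1) ^+ ui.2)%:E)%E.
  rewrite -E; apply: eq_integral => w _; congr EFin; apply: eq_bigr => v _.
  by rewrite take_takel// leqnSn.
rewrite [RHS](eq_integral (fun=> (\prod_(ui <- zip G k) iter m f (sigma ui.1) ^+ ui.2)%:E)).
  by rewrite integral_cst// muleC.
by move=> w; rewrite inE => /zipG ->.
Qed.

Lemma integral_pow_gw_size n s : 0 <= s <= 1 ->
  (\int[P]_w (s ^+ gw_size xi n w)%:E = (iter n f s)%:E)%E.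
Proof.
move=> s01.
have := @integral_gen_prod n 0 setT [:: [::]] (fun=> s) (indep_of_setT xi_indep _)
  (fun _ _ => erefl) (fun=> s01).
rewrite big_seq1 (probability_setT P) mul1e => <-.
apply: eq_integral => w _; congr EFin.
by rewrite big_const_seq count_predT iter_mulr_1.
Qed.

Lemma prod_take_count (G L : seq (seq nat)) N (sigma : seq nat -> R) : uniq G ->
  {in L, forall v, take N v \in G} ->
  \prod_(v <- L) sigma (take N v) = \prod_(u <- G) sigma u ^+ count (fun v => take N v == u) L.
Proof.
move=> uG; elim: L => [|v L IH] LG /=; first by rewrite big_nil big1.
rewrite big_cons IH; last by move=> w wL; apply: LG; rewrite inE wL orbT.
have vG : take N v \in G by apply: LG; rewrite inE eqxx.
under [RHS]eq_bigr do rewrite exprD.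
rewrite big_split/=; congr (_ * _).
rewrite (bigD1_seq (take N v))//= eqxx expr1 big1 ?mulr1// => u uv.
by rewrite eq_sym (negbTE uv).
Qed.

Section reduced.
Variables (N m : nat) (s t : R).
Hypothesis s01 : 0 <= s <= 1.
Hypothesis t01 : 0 <= t <= 1.

Let desc (u : seq nat) (w : T) := count (fun v => take N v == u) (gen (N + m) w).
(** The factor of a particle with [k] descendants: [t * s ^+ k] for [k > 0] and 1 for [k = 0]. It is
    written as a mixture of two powers, of [s] and of 0, because [integral_gen_prod] handles
    powers. *)
Let q (k : nat) : R := t * s ^+ k + (1 - t) * 0 ^+ k.

Lemma q_ge0 k : 0 <= q k.
Proof.
have /andP[s0 _] := s01; have /andP[t0 t1] := t01.
by rewrite addr_ge0// mulr_ge0 ?subr_ge0// exprn_ge0.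
Qed.

Lemma measurable_desc (G1 G2 : seq (seq nat)) (sigma : seq nat -> R) :
  measurable_fun setT (fun w => \prod_(u <- G1) sigma u ^+ desc u w * \prod_(u <- G2) q (desc u w)).
Proof.
exact: (measurable_fibers_fun (fun L =>
  \prod_(u <- G1) sigma u ^+ count (fun v => take N v == u) L *
  \prod_(u <- G2) q (count (fun v => take N v == u) L)) (measurable_fibers_gen _)).
Qed.

(** [q] is split, one particle at a time, into [t] times the weight [s] and [1 - t] times the weight
    0; the particle then moves from [G2] to [G1]. Each contributes [t f_m(s) + (1 - t) f_m(0)]. *)
Lemma integral_desc (B : set T) (G1 G2 : seq (seq nat)) (sigma : seq nat -> R) :
  measurable B ->
  (forall sigma', (forall u, 0 <= sigma' u <= 1) ->
    (\int[P]_(w in B) (\prod_(u <- G1 ++ G2) sigma' u ^+ desc u w)%:E =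
      P B * (\prod_(u <- G1 ++ G2) iter m f (sigma' u))%:E)%E) ->
  uniq (G1 ++ G2) -> (forall u, 0 <= sigma u <= 1) ->
  (\int[P]_(w in B) (\prod_(u <- G1) sigma u ^+ desc u w * \prod_(u <- G2) q (desc u w))%:E =
    P B * (\prod_(u <- G1) iter m f (sigma u) *
      \prod_(u <- G2) (iter m f 0 + t * (iter m f s - iter m f 0)))%:E)%E.
Proof.
move=> mB; elim: G2 G1 sigma => [|u G2 IH] G1 sigma H uG sg.
  have := H sigma sg; rewrite cats0 => E.
  by under eq_integral do rewrite big_nil mulr1; rewrite big_nil mulr1.
have /andP[t0 t1] := t01.
pose sig (a : R) v := if v == u then a else sigma v.
have sigE a v : v \in G1 -> sig a v = sigma v.
  rewrite /sig; case: eqP => // -> uG1.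
  by move: uG; rewrite cat_uniq => /and3P[_ /hasPn/(_ u)/=]; rewrite inE eqxx uG1 => /(_ isT).
have H' sigma' : (forall u, 0 <= sigma' u <= 1) ->
    (\int[P]_(w in B) (\prod_(u <- rcons G1 u ++ G2) sigma' u ^+ desc u w)%:E =
      P B * (\prod_(u <- rcons G1 u ++ G2) iter m f (sigma' u))%:E)%E.
  by rewrite cat_rcons; exact: H.
have uG' : uniq (rcons G1 u ++ G2) by rewrite cat_rcons.
have I a : 0 <= a <= 1 -> (\int[P]_(w in B) (\prod_(v <- G1) sigma v ^+ desc v w * a ^+ desc u w *
      \prod_(v <- G2) q (desc v w))%:E =
    P B * (\prod_(v <- G1) iter m f (sigma v) * iter m f a *
      \prod_(v <- G2) (iter m f 0 + t * (iter m f s - iter m f 0)))%:E)%E.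
  move=> a01; have := IH (rcons G1 u) (sig a) H' uG'.
  have -> : \prod_(v <- rcons G1 u) iter m f (sig a v) = \prod_(v <- G1) iter m f (sigma v) * iter m f a.
    rewrite -cats1 big_cat/= big_seq1 {2}/sig eqxx; congr (_ * _).
    by apply: eq_big_seq => v vG; rewrite sigE.
  move=> <-; last by move=> v; rewrite /sig; case: eqP.
  apply: eq_integral => w _; congr (EFin (_ * _)).
  rewrite -cats1 big_cat/= big_seq1 {2}/sig eqxx; congr (_ * _).
  by apply: eq_big_seq => v vG; rewrite sigE.
have mI a : measurable_fun B (fun w => (\prod_(v <- G1) sigma v ^+ desc v w * a ^+ desc u w *
      \prod_(v <- G2) q (desc v w))%:E).
  apply/measurable_EFinP; apply: measurable_funTS.
  apply: eq_measurable_fun (measurable_desc (rcons G1 u) G2 (sig a)) => w _.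
  rewrite -cats1 big_cat/= big_seq1 {2}/sig eqxx; congr (_ * _ * _).
  by apply: eq_big_seq => v vG; rewrite sigE.
have I0 a w : 0 <= a -> (0 <= (\prod_(v <- G1) sigma v ^+ desc v w * a ^+ desc u w *
      \prod_(v <- G2) q (desc v w))%:E)%E.
  move=> a0; rewrite lee_fin mulr_ge0// ?mulr_ge0 ?exprn_ge0//; apply: prodr_ge0 => v _.
    by rewrite exprn_ge0//; case/andP: (sg v).
  exact: q_ge0.
have /andP[s0 s1] := s01.
rewrite (eq_integral (fun w =>
  t%:E * (\prod_(v <- G1) sigma v ^+ desc v w * s ^+ desc u w * \prod_(v <- G2) q (desc v w))%:E +
  (1 - t)%:E * (\prod_(v <- G1) sigma v ^+ desc v w * 0 ^+ desc u w * \prod_(v <- G2) q (desc v w))%:E)%E);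
  last first.
  move=> w _; rewrite -!EFinM -EFinD big_cons; congr EFin; rewrite /q; ring.
have t1' : 0 <= 1 - t by rewrite subr_ge0.
rewrite ge0_integralD//; last 4 first.
- by move=> w _; rewrite mule_ge0// ?lee_fin// -lee_fin I0.
- by apply: emeasurable_funM => //; exact: mI.
- by move=> w _; rewrite mule_ge0// ?lee_fin// -lee_fin I0.
- by apply: emeasurable_funM => //; exact: mI.
rewrite !ge0_integralZl_EFin//; try exact: mI; try by move=> w _; rewrite I0.
rewrite !I ?lexx ?ler01// -(fineK (fin_num_measure P _ mB)) -!EFinM -EFinD; congr EFin.
by rewrite big_cons; ring.
Qed.

Lemma gw_reduced_desc w :
  t ^+ gw_reduced xi N (N + m) w * s ^+ gw_size xi (N + m) w =
  \prod_(u <- gen N w) q (desc u w).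
Proof.
have uG : uniq (gen N w) by exact: uniq_generation.
have LG : {in gen (N + m) w, forall v, take N v \in gen N w}.
  by move=> v; exact: take_generation.
have -> : s ^+ gw_size xi (N + m) w = \prod_(v <- gen (N + m) w) s.
  by rewrite big_const_seq count_predT iter_mulr_1.
rewrite (prod_take_count (fun=> s) uG LG).
have -> : t ^+ gw_reduced xi N (N + m) w =
    \prod_(u <- gen N w) t ^+ has (prefix u) (gen (N + m) w).
  rewrite /gw_reduced -/(gen N w) -/(gen (N + m) w).
  elim: (gen N w) => [|u G IH]; first by rewrite big_nil.
  by rewrite /= exprD IH big_cons.
rewrite -big_split/=; apply: eq_big_seq => u uG'.
have -> : has (prefix u) (gen (N + m) w) = (0 < desc u w)%N.
  rewrite -has_count; apply: eq_has => v.
  by rewrite prefixE (size_generation uG').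
rewrite /q -/(desc u w); case: (desc u w) => [|k]; first by rewrite !expr0; ring.
by rewrite expr0n /= expr1 mulr0 addr0.
Qed.

(** On each event fixing generation [N], [integral_desc] with [G1] empty gives [a] to the power of
    the size of that generation; this size has generating function [f_N]. *)
Lemma integral_pow_gw_reduced :
  (\int[P]_w (t ^+ gw_reduced xi N (N + m) w * s ^+ gw_size xi (N + m) w)%:E =
   (iter N f (iter m f 0 + t * (iter m f s - iter m f 0)))%:E)%E.
Proof.
have /andP[t0 t1] := t01; have /andP[s0 s1] := s01.
have z01 : 0 <= (0 : R) <= 1 by rewrite lexx ler01.
set a := iter m f 0 + _.
have /andP[F00 F01] := iter_pgf_itv m z01; have /andP[Fs0 Fs1] := iter_pgf_itv m s01.
have a01 : 0 <= a <= 1 by rewrite /a; apply/andP; split; nra.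
rewrite -integral_pow_gw_size// -[RHS]mul1e.
apply: (@eq_integral_fibers _ _ _ P _ (gen N)) => //.
- exact: measurable_fibers_gen.
- apply: eq_measurable_fun (fun w _ => esym (gw_reduced_desc w)) _.
  exact: (measurable_fibers_fun (fun GL => \prod_(u <- GL.1) q (count (fun v => take N v == u) GL.2))
    (measurable_fibers_bind (V := gen N) (W := fun G w => (G, gen (N + m) w))
      (measurable_fibers_gen _)
      (fun G => measurable_fibers_comp (fun L => (G, L)) (measurable_fibers_gen _)))).
- exact: (measurable_fibers_fun (fun L : seq (seq nat) => a ^+ size L) (measurable_fibers_gen _)).
- by move=> w; rewrite mulr_ge0// exprn_ge0.
- by move=> w; rewrite exprn_ge0//; case/andP: a01.
move=> G; rewrite !setTI mul1e.
have [[w0 /= wG]|G0] := pselect (exists w, gen N w = G); last first.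
  rewrite (_ : _ @^-1` _ = set0) ?integral_set0//; apply/seteqP; split => // w /= E.
  by apply: G0; exists w.
have mG := measurable_fibers_gen N G.
have uG : uniq ([::] ++ G) by rewrite -wG; exact: uniq_generation.
have iG := indep_of_gen N G.
have := @integral_desc (gen N @^-1` [set G]) [::] G (fun=> 0) mG _ uG (fun=> z01).
move=> E; rewrite (eq_integral (fun w => (\prod_(u <- [::]) 0 ^+ desc u w * \prod_(u <- G) q (desc u w))%:E)).
  rewrite E.
    rewrite big_nil mul1r big_const_seq count_predT iter_mulr_1.
    rewrite (eq_integral (fun=> (a ^+ size G)%:E)); first by rewrite integral_cst// muleC.
    by move=> w; rewrite inE /= => <-.
  move=> sigma' sg'.
  rewrite -(integral_gen_prod m iG (fun w => id) sg'); apply: eq_integral => w; rewrite inE /= => wG'.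
  congr EFin; rewrite (prod_take_count sigma' (G := G))//.
  by move=> v vL; rewrite -wG'; exact: take_generation vL.
by move=> w; rewrite inE /= => <-; rewrite gw_reduced_desc big_nil mul1r.
Qed.

End reduced.

Lemma gw_reduced_gt0 N n w : (0 < gw_reduced xi N n w)%N -> (0 < gw_size xi n w)%N.
Proof.
rewrite /gw_reduced /gw_size -has_count => /hasP[u _ /hasP[v vn _]].
by case: (generation _ n) vn.
Qed.

End generation_law.

(** Multiplying the induction hypothesis by [b] leaves the surplus
    [(c - b) (b - a) (c^k - a^k) >= 0]. *)
Lemma exprn_convex (R : realDomainType) (a b c : R) k : 0 <= a -> a <= b -> b <= c ->
  b ^+ k * (c - a) <= a ^+ k * (c - b) + c ^+ k * (b - a).
Proof.
move=> a0 ab bc; elim: k => [|k IH]; first by rewrite !expr0 !mul1r; lra.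
have b0 : 0 <= b := le_trans a0 ab.
have ac : a ^+ k <= c ^+ k by rewrite lerXn2r ?nnegrE// ?(le_trans ab)// (le_trans b0).
have := ler_wpM2l b0 IH; rewrite mulrA -exprS => /le_trans; apply.
have : 0 <= (c - b) * (b - a) * (c ^+ k - a ^+ k) by rewrite !mulr_ge0 ?subr_ge0.
rewrite !exprS; move: (a ^+ k) (c ^+ k) => A C; nra.
Qed.

(** * Convexity and regular variation of the gap [f(1 - z) - (1 - z)] *)

Section critical_pgf.
Context {d : measure_display} {T : measurableType d} {R : realType}.
Context {P : probability T R}.
Variable xi : seq nat -> {RV P >-> nat}.
Hypothesis xi_ident : identically_distributed xi.

Let f := pgf (xi [::]) : R -> R.
Let X := xi [::].

Let fE s : 0 <= s <= 1 -> \int[P]_w (s ^+ X w) = f s.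
Proof. by move=> s01; rewrite /Rintegral (integral_pow_xi xi_ident). Qed.

Let integrable_pow (s : R) : 0 <= s <= 1 -> P.-integrable setT (EFin \o (fun w => s ^+ X w)).
Proof.
move=> s01; have /andP[s0 s1] := s01; apply: (@bounded_integrable _ _ _ _ _ 1) => [|w].
  exact: (measurable_fibers_fun (fun k => s ^+ k) (measurable_fibers_xi xi [::])).
by rewrite ger0_norm ?exprn_ge0// exprn_ile1.
Qed.

Lemma pgf_homo (a b : R) : 0 <= a <= b -> b <= 1 -> f a <= f b.
Proof.
move=> /andP[a0 ab] b1.
have a01 : 0 <= a <= 1 by rewrite a0 (le_trans ab).
have b01 : 0 <= b <= 1 by rewrite b1 (le_trans a0).
rewrite -!fE//; apply: le_Rintegral => //; [exact: integrable_pow|exact: integrable_pow|].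
by move=> w _; rewrite lerXn2r ?nnegrE//; case/andP: b01.
Qed.

Lemma pgf_convex (a b c : R) : 0 <= a <= b -> b <= c <= 1 ->
  f b * (c - a) <= f a * (c - b) + f c * (b - a).
Proof.
move=> /andP[a0 ab] /andP[bc c1].
have a01 : 0 <= a <= 1 by lra.
have b01 : 0 <= b <= 1 by lra.
have c01 : 0 <= c <= 1 by lra.
have ia := integrable_pow a01; have ib := integrable_pow b01; have ic := integrable_pow c01.
rewrite -!fE// -!RintegralZr//.
have iZ (s r : R) : 0 <= s <= 1 -> P.-integrable setT (EFin \o (fun w => s ^+ X w * r)).
  move=> s01; have := integrableZr measurableT r (integrable_pow s01).
  by apply: eq_integrable.
rewrite -RintegralD//; [|exact: iZ|exact: iZ].
apply: le_Rintegral => //; [exact: iZ| |by move=> w _; exact: exprn_convex].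
have := integrableD measurableT (iZ a (c - b) a01) (iZ c (b - a) c01).
by apply: eq_integrable.
Qed.

Variables (alpha : R) (L : R -> R).
Hypothesis alpha_gt0 : 0 < alpha.
Hypothesis L_slow : slowly_varying_at0 L.
Hypothesis f_form : forall s : R, 0 <= s <= 1 ->
  f s = s + (1 - s) `^ (1 + alpha) * L (1 - s).

Let h (z : R) := f (1 - z) - (1 - z).

Lemma pgf_gapE z : 0 <= z <= 1 -> h z = z `^ (1 + alpha) * L z.
Proof. by move=> z01; rewrite /h f_form; [rewrite subKr; ring|lra]. Qed.

(** The power vanishes at 0, whatever the value of [L] there. *)
Lemma pgf_gap0 : h 0 = 0.
Proof.
have z01 : 0 <= (0 : R) <= (1 : R) by rewrite lexx ler01.
by rewrite (pgf_gapE z01) powR0 ?mul0r// gt_eqF// addr_gt0.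
Qed.

Lemma pgf_gap_gt0 z : 0 < z <= 1 -> 0 < h z.
Proof.
move=> /andP[z0 z1]; rewrite pgf_gapE ?(ltW z0)// mulr_gt0 ?powR_gt0//.
by have [+ _ _] := L_slow; apply; rewrite z0.
Qed.

Lemma pgf_gap_rv c : 0 < c -> h (c * z) / h z @[z --> 0^'+] --> c `^ (1 + alpha).
Proof.
move=> c0; have [L0 _ Lc] := L_slow.
have H : c `^ (1 + alpha) * (L (c * z) / L z) @[z --> 0^'+] --> c `^ (1 + alpha).
  by rewrite -[X in _ --> X]mulr1; apply: cvgM; [exact: cvg_cst|exact: Lc].
apply: cvg_trans H; apply: near_eq_cvg; near=> z.
have z0 : 0 < z by near: z; exact: nbhs_right_gt.
have z1 : z < 1 by near: z; exact: nbhs_right_lt.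
have cz1 : z < c^-1 by near: z; apply: nbhs_right_lt; rewrite invr_gt0.
have cz : 0 < c * z <= 1.
  by rewrite mulr_gt0//= -(divff (lt0r_neq0 c0)) ler_pM2l// ltW.
have /andP[cz0 _] := cz.
rewrite !pgf_gapE ?(ltW z0) ?(ltW z1)//; last by rewrite (ltW cz0); case/andP: cz.
rewrite powRM ?(ltW c0) ?(ltW z0)//.
have Lz : L z != 0 by rewrite gt_eqF// L0// z0 ltW.
have pz : z `^ (1 + alpha) != 0 by rewrite gt_eqF// powR_gt0.
by field; rewrite pz Lz.
Unshelve. all: by end_near. Qed.

(* Without branching, f = 1 and h would be the identity, of the wrong index of variation. *)
Lemma pgf_gap1_lt1 : h 1 < 1.
Proof.
rewrite /h subrr subr0 ltNge; apply/negP => f0.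
have f1 s : 0 <= s <= 1 -> f s = 1.
  move=> s01; apply/eqP; rewrite eq_le; have /andP[_ ->] := pgf_itv xi_ident s01 => /=.
  by apply: (le_trans f0); apply: pgf_homo; case/andP: s01 => // ->; rewrite lexx.
have H : (fun=> 2 : R) z @[z --> (0 : R)^'+] --> 2 `^ (1 + alpha).
  have K := pgf_gap_rv (ltr0Sn R 1); apply: cvg_trans K; apply: near_eq_cvg; near=> z.
  have z0 : 0 < z by near: z; exact: nbhs_right_gt.
  have z1 : z < 2^-1 by near: z; exact: nbhs_right_lt.
  rewrite /h !f1; [|lra|lra].
  by rewrite !subKr mulfK ?gt_eqF.
have : 2 `^ (1 + alpha) = 2 :> R.
  by apply: (cvg_unique (@norm_hausdorff _ R)) H _; exact: cvg_cst.
move/eqP; rewrite powRD ?(gt_eqF (ltr0Sn R 1)) ?implybT// powRr1//.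
rewrite -subr_eq0 -[X in _ - X]mulr1 -mulrBr mulf_eq0 pnatr_eq0/= subr_eq0 => /eqP E.
have : (1 : R) `^ alpha < 2 `^ alpha by rewrite gt0_ltr_powR ?nnegrE ?ltr1n.
by rewrite powR1 E ltxx.
Unshelve. all: by end_near. Qed.

Lemma pgf_gap_convex a b c : 0 <= a <= b -> b <= c <= 1 ->
  h b * (c - a) <= h a * (c - b) + h c * (b - a).
Proof.
move=> ab bc.
have := @pgf_convex (1 - c) (1 - b) (1 - a); rewrite /h.
by move=> /(_ _ _); nra.
Qed.

Lemma pgf_gap_homo a b : 0 <= a <= b -> b <= 1 -> a - h a <= b - h b.
Proof.
move=> ab b1; have := @pgf_homo (1 - b) (1 - a); rewrite /h => H.
have : f (1 - b) <= f (1 - a) by apply: H; lra.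
lra.
Qed.

Lemma iter_pgfE n s : iter n f s = 1 - iter n (fun z => z - h z) (1 - s).
Proof.
elim: n => [|n IH] /=; first by rewrite subKr.
by rewrite IH /h; ring.
Qed.

End critical_pgf.

Section bounded_count.
Context {d : measure_display} {T : measurableType d} {R : realType}.
Variables (P : probability T R) (N : T -> nat) (W : T -> R).
Hypothesis mN : measurable_fibers N.
Hypothesis mW : measurable_fun setT W.
Hypothesis W01 : forall w, 0 <= W w <= 1.

Lemma integrable_count (F : nat -> R) (K : R) : (forall k, `|F k| <= K) ->
  P.-integrable setT (EFin \o (fun w => W w * F (N w))).
Proof.
move=> FK; apply: (@bounded_integrable _ _ _ _ _ (1 * K)) => [|w].
  apply: measurable_funM => //; exact: (measurable_fibers_fun F mN).
have /andP[w0 w1] := W01 w.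
by rewrite normrM ler_pM// ger0_norm.
Qed.

Let eq_le1 (k i : nat) : `|(k == i)%:R : R| <= 1.
Proof. by case: eqP; rewrite ?normr1 ?normr0. Qed.

Let pow_le1 (t : R) k : 0 < t <= 1 -> `|t ^+ k| <= 1.
Proof. by move=> /andP[t0 t1]; rewrite ger0_norm ?exprn_ge0 ?exprn_ile1// ltW. Qed.

Let partial (t : R) (n k : nat) : R := \sum_(i < n) (k == i)%:R * t ^+ i.

Let partialE (t : R) n k : partial t n k = if (k < n)%N then t ^+ k else 0.
Proof.
rewrite /partial; case: ltnP => kn.
  rewrite (bigD1 (Ordinal kn))//= eqxx mul1r big1 ?addr0// => i ik.
  suff -> : (k == i) = false by rewrite mul0r.
  by apply/eqP => E; move/eqP: ik; apply; apply: val_inj.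
apply: big1 => i _; suff -> : (k == i) = false by rewrite mul0r.
by apply/eqP => E; move: (ltn_ord i); rewrite -E ltnNge kn.
Qed.

Let partial_le1 (t : R) n k : 0 < t <= 1 -> `|partial t n k| <= 1.
Proof. by move=> t01; rewrite partialE; case: ifP; rewrite ?normr0// pow_le1. Qed.

Let integral_partial (t : R) n : 0 < t <= 1 ->
  \sum_(i < n) (\int[P]_w (W w * (N w == i)%:R)) * t ^+ i =
  \int[P]_w (W w * partial t n (N w)).
Proof.
move=> t01; elim: n => [|n IH].
  rewrite big_ord0 /partial; under eq_Rintegral do rewrite big_ord0 mulr0.
  by rewrite Rintegral_cst// mul0r.
rewrite big_ord_recr/= IH -RintegralZr//; last first.
  by apply: (@integrable_count (fun k => (k == n)%:R) 1) => k; exact: eq_le1.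
rewrite -RintegralD//.
- by apply: eq_Rintegral => w _; rewrite /partial big_ord_recr/= mulrDr mulrA.
- by apply: (@integrable_count (partial t n) 1) => k; exact: partial_le1.
- have : P.-integrable setT (EFin \o (fun w => W w * ((N w == n)%:R * t ^+ n))).
    apply: (@integrable_count (fun k => (k == n)%:R * t ^+ n) 1) => k.
    by rewrite normrM -[X in _ <= X]mulr1 ler_pM ?eq_le1 ?pow_le1.
  by apply: eq_integrable => // w _ /=; rewrite mulrA.
Qed.

(** For [k > j], [t^k = (t / t0)^k t0^k <= (t / t0)^(j + 1) t0^k]. This is the tail bound that
    [coef_extraction] asks for. *)
Lemma integral_pow_partial (t t0 : R) j : 0 < t <= t0 -> t0 <= 1 ->
  \sum_(i < j.+1) (\int[P]_w (W w * (N w == i)%:R)) * t ^+ i <= \int[P]_w (W w * t ^+ N w) <=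
  \sum_(i < j.+1) (\int[P]_w (W w * (N w == i)%:R)) * t ^+ i +
    (t / t0) ^+ j.+1 * \int[P]_w (W w * t0 ^+ N w).
Proof.
move=> /andP[tp tt0] t01.
have t0p : 0 < t0 := lt_le_trans tp tt0.
have t_itv : 0 < t <= 1 by rewrite tp (le_trans tt0).
have t0_itv : 0 < t0 <= 1 by rewrite t0p.
have r0 : 0 <= t / t0 by rewrite divr_ge0 ?ltW.
have r1 : t / t0 <= 1 by rewrite ler_pdivrMr// mul1r.
have ip : P.-integrable setT (EFin \o (fun w => W w * partial t j.+1 (N w))).
  by apply: (@integrable_count (partial t j.+1) 1) => k; exact: partial_le1.
have it : P.-integrable setT (EFin \o (fun w => W w * t ^+ N w)).
  by apply: (@integrable_count (fun k => t ^+ k) 1) => k; exact: pow_le1.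
have it0 : P.-integrable setT (EFin \o (fun w => W w * t0 ^+ N w)).
  by apply: (@integrable_count (fun k => t0 ^+ k) 1) => k; exact: pow_le1.
have it0' : P.-integrable setT (EFin \o (fun w => (t / t0) ^+ j.+1 * (W w * t0 ^+ N w))).
  by have := integrableZl measurableT ((t / t0) ^+ j.+1) it0; exact: eq_integrable.
have W0 w : 0 <= W w by case/andP: (W01 w).
rewrite integral_partial//; apply/andP; split.
  apply: le_Rintegral => // w _; rewrite ler_wpM2l// partialE.
  by case: ifP => // _; rewrite exprn_ge0// ltW.
rewrite -RintegralZl// -RintegralD//; apply: le_Rintegral => //.
  by have := integrableD measurableT ip it0'; exact: eq_integrable.
move=> w _; rewrite mulrCA -mulrDr ler_wpM2l// partialE; case: ltnP => jN.
  by rewrite lerDl mulr_ge0// exprn_ge0// ltW.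
rewrite add0r -[X in X ^+ N w](divfK (lt0r_neq0 t0p)) exprMn ler_wpM2r ?exprn_ge0 ?(ltW t0p)//.
exact: ler_wiXn2l.
Qed.

End bounded_count.

Section survival_moments.
Context {d : measure_display} {T : measurableType d} {R : realType}.
Context {P : probability T R}.
Variable xi : seq nat -> {RV P >-> nat}.
Hypothesis xi_indep : mutually_independent xi.
Hypothesis xi_ident : identically_distributed xi.

Let f := pgf (xi [::]) : R -> R.

Lemma measurable_fibers_size n : measurable_fibers (gw_size xi n).
Proof. exact: (measurable_fibers_comp size (measurable_fibers_gen xi n)). Qed.

Lemma measurable_fibers_reduced N n : measurable_fibers (gw_reduced xi N n).
Proof.
apply: (measurable_fibers_bind (V := fun w => generation (fun u => xi u w) n)
  (W := fun L w => count (fun u => has (prefix u) L) (generation (fun u => xi u w) N))).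
  exact: measurable_fibers_gen.
move=> L; apply: (measurable_fibers_comp (count (fun u => has (prefix u) L))).
exact: measurable_fibers_gen.
Qed.

Let integrable_pair (N n : nat) (F : nat -> nat -> R) : (forall k l, `|F k l| <= 1) ->
  P.-integrable setT (EFin \o (fun w => F (gw_reduced xi N n w) (gw_size xi n w))).
Proof.
move=> F1; apply: (@bounded_integrable _ _ _ _ _ 1) => //.
have mp : measurable_fibers (fun w => (gw_reduced xi N n w, gw_size xi n w)).
  apply: (measurable_fibers_bind (V := gw_reduced xi N n) (W := fun k w => (k, gw_size xi n w))).
    exact: measurable_fibers_reduced.
  by move=> k; apply: (measurable_fibers_comp (pair k)); exact: measurable_fibers_size.
exact: (measurable_fibers_fun (fun kl => F kl.1 kl.2) mp).
Qed.

Let norm_pow (s : R) k : 0 <= s <= 1 -> `|s ^+ k| <= 1.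
Proof. by move=> /andP[s0 s1]; rewrite ger0_norm ?exprn_ge0 ?exprn_ile1. Qed.

Let pos_pow (k : nat) (s : R) : (0 < k)%N%:R * s ^+ k = s ^+ k - 0 ^+ k.
Proof. by case: k => [|k]; rewrite ?expr0 ?subrr ?mul0r// expr0n mul1r subr0. Qed.

Lemma integral_size_pow n s : 0 <= s <= 1 ->
  \int[P]_w ((0 < gw_size xi n w)%N%:R * s ^+ gw_size xi n w) = iter n f s - iter n f 0.
Proof.
move=> s01; have i01 : 0 <= (0 : R) <= (1 : R) by rewrite lexx ler01.
have I r : 0 <= r <= 1 -> \int[P]_w (r ^+ gw_size xi n w) = iter n f r.
  by move=> r01; rewrite /Rintegral (integral_pow_gw_size xi_indep xi_ident).
rewrite -!I// -RintegralB//.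
- by apply: eq_Rintegral => w _; rewrite pos_pow.
- by apply: (@integrable_pair 0 n (fun _ l => s ^+ l)) => k l; exact: norm_pow.
- by apply: (@integrable_pair 0 n (fun _ l => 0 ^+ l)) => k l; exact: norm_pow.
Qed.

(** At [t = 0] only extinction remains, as [0 ^+ k] is 1 for [k = 0] and 0 otherwise; subtracting
    this value restricts the expectation to survival. *)
Lemma integral_reduced_pow N m s t : 0 <= s <= 1 -> 0 <= t <= 1 ->
  \int[P]_w (((0 < gw_reduced xi N (N + m) w)%N%:R * s ^+ gw_size xi (N + m) w) *
             t ^+ gw_reduced xi N (N + m) w) =
  iter N f (iter m f 0 + t * (iter m f s - iter m f 0)) - iter (N + m) f 0.
Proof.
move=> s01 t01; have i01 : 0 <= (0 : R) <= (1 : R) by rewrite lexx ler01.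
have I r : 0 <= r <= 1 ->
    \int[P]_w (r ^+ gw_reduced xi N (N + m) w * s ^+ gw_size xi (N + m) w) =
    iter N f (iter m f 0 + r * (iter m f s - iter m f 0)).
  by move=> r01; rewrite /Rintegral (integral_pow_gw_reduced xi_indep xi_ident).
rewrite -I// iterD -[iter m f 0 in X in _ - X]addr0.
rewrite -[X in iter m f 0 + X](mul0r (iter m f s - iter m f 0)) -I// -RintegralB//.
- by apply: eq_Rintegral => w _; rewrite mulrAC pos_pow mulrBl.
- apply: (@integrable_pair N (N + m) (fun k l => t ^+ k * s ^+ l)) => k l.
  by rewrite normrM -[X in _ <= X]mulr1 ler_pM ?norm_pow.
- apply: (@integrable_pair N (N + m) (fun k l => 0 ^+ k * s ^+ l)) => k l.
  by rewrite normrM -[X in _ <= X]mulr1 ler_pM ?norm_pow.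
Qed.

End survival_moments.

(** * Conditional limits *)

Lemma one_sub_expR_cvg {R : realType} (l : R) (y : R^nat) : 0 < l -> y @ \oo --> 0^'+ ->
  (1 - expR (- l * y n)) @[n --> \oo] --> 0^'+ /\
  (1 - expR (- l * y n)) / y n @[n --> \oo] --> l.
Proof.
move=> l0 y0; have yc := right0_cvg y0.
have yp : \forall n \near \oo, 0 < y n by exact: (y0 _ (nbhs_right_gt 0)).
have ratio : (1 - expR (- l * y n)) / y n @[n --> \oo] --> l.
  (* Both bounds come from [1 + v <= exp(v)], applied at [l * y n] and at [- l * y n]. *)
  apply: (@squeeze_cvgr _ _ _ _ (fun n => l / (1 + l * y n)) (fun _ => l)).
  - near=> n; have yn : 0 < y n by near: n; exact: yp.
    have ly : 0 < l * y n by exact: mulr_gt0.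
    have e1 := expR_ge1Dx (l * y n); have e2 := expR_ge1Dx (- l * y n).
    have e3 : expR (- l * y n) <= (1 + l * y n)^-1.
      by rewrite mulNr expRN lef_pV2 ?posrE ?expR_gt0// addr_gt0.
    rewrite ler_pdivlMr// ler_pdivrMr//; apply/andP; split; last by lra.
    apply: (@le_trans _ _ (1 - (1 + l * y n)^-1)); last by lra.
    rewrite le_eqVlt; apply/orP; left; apply/eqP; field; lra.
  - have H : l / (1 + l * y n) @[n --> \oo] --> l / (1 + l * 0).
      apply: cvgM; first by exact: cvg_cst.
      apply: cvgV; first by rewrite mulr0 addr0 oner_neq0.
      by apply: cvgD; [exact: cvg_cst|apply: cvgM => //; exact: cvg_cst].
    by rewrite mulr0 addr0 divr1 in H.
  - exact: cvg_cst.
split => //; apply: cvg_to_right0.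
  near=> n; have yn : 0 < y n by near: n; exact: yp.
  by rewrite subr_gt0 expR_lt1 mulNr oppr_lt0 mulr_gt0.
have H : (1 - expR (- l * y n)) / y n * y n @[n --> \oo] --> l * 0 by exact: cvgM.
rewrite mulr0 in H; apply: cvg_trans H; apply: near_eq_cvg; near=> n.
have yn : 0 < y n by near: n; exact: yp.
by rewrite divfK// gt_eqF.
Unshelve. all: by end_near. Qed.

Lemma ge0_integral_half_line {R : realType} (mu : probability (measurableTypeR R) R) (F : R -> R) :
  mu `]-oo, 0%R[%classic = 0%E -> measurable_fun setT F -> (forall y, 0 <= F y) ->
  \int[mu]_(y in `[0, +oo[) F y = \int[mu]_y F y.
Proof.
move=> mu0 mF F0; have mN : measurable (`]-oo, 0%R[%classic : set (measurableTypeR R)).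
  exact: measurable_itv.
rewrite /Rintegral [in RHS](@ge0_negligible_integral _ _ _ mu setT _ _ mN)//.
- congr (fine (integral mu _ _)); apply/seteqP; split => y /=.
    by rewrite !in_itv/= andbT => y0; split => //; rewrite ltNge y0.
  by rewrite !in_itv/= andbT => -[_ /negP]; rewrite -leNgt.
- exact/measurable_EFinP.
- by move=> y _; rewrite lee_fin.
Qed.

Section conditional_limits.
Context {d : measure_display} {T : measurableType d} {R : realType}.
Context {P : probability T R}.
Variable xi : seq nat -> {RV P >-> nat}.
Hypothesis xi_indep : mutually_independent xi.
Hypothesis xi_ident : identically_distributed xi.
Let f := pgf (xi [::]) : R -> R.
Variables (alpha : R) (L : R -> R).
Hypothesis alpha_gt0 : 0 < alpha.
Hypothesis L_slow : slowly_varying_at0 L.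
Hypothesis f_form : forall s : R, 0 <= s <= 1 ->
  f s = s + (1 - s) `^ (1 + alpha) * L (1 - s).
Variable phi : nat -> R.
Hypothesis phi_infty : phi n @[n --> \oo] --> +oo.
Hypothesis phi_small : phi n / n%:R @[n --> \oo] --> (0 : R).

Let h (z : R) := f (1 - z) - (1 - z).
Let g (z : R) := z - h z.
Let h0 : h 0 = 0 := pgf_gap0 alpha_gt0 f_form.
Let h_gt0 := pgf_gap_gt0 L_slow f_form : forall z, 0 < z <= 1 -> 0 < h z.
Let h1 := pgf_gap1_lt1 xi_ident alpha_gt0 L_slow f_form : h 1 < 1.
Let h_convex := pgf_gap_convex xi_ident : forall a b c : R, 0 <= a <= b -> b <= c <= 1 ->
  h b * (c - a) <= h a * (c - b) + h c * (b - a).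
Let g_homo := pgf_gap_homo xi_ident : forall a b : R, 0 <= a <= b -> b <= 1 -> a - h a <= b - h b.
Let h_rv := pgf_gap_rv L_slow f_form :
  forall c, 0 < c -> h (c * z) / h z @[z --> 0^'+] --> c `^ (1 + alpha).
Let fE n s : iter n f s = 1 - iter n g (1 - s) := iter_pgfE xi n s.

(* h (iter n g 1) = P(Z(n) > 0, Z(n+1) = 0); P(H(n)) is of the order of phi(n) times this. *)
Definition survival_rate (n : nat) : R := `|phi n * h (iter n g 1)|^-1.

Definition laplace_point (l : R) (n : nat) : R :=
  expR (- l * (1 - iter (Num.truncn (phi n)) f 0)).

Lemma survival_rate_ge0 n : 0 <= survival_rate n.
Proof. by rewrite invr_ge0. Qed.

Lemma near_survival_rate :
  \forall n \near \oo, 0 < survival_rate n /\ survival_rate n = (phi n * h (iter n g 1))^-1.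
Proof.
near=> n; have pn : 0 < phi n by near: n; exact: near_phi_gt0.
have D0 : 0 < phi n * h (iter n g 1) by rewrite mulr_gt0//; exact: hQ_gt0.
by rewrite /survival_rate gtr0_norm ?invr_gt0.
Unshelve. all: by end_near. Qed.

Lemma laplace_point_itv l n : 0 < l -> 0 <= laplace_point l n <= 1.
Proof.
move=> l0; rewrite expR_ge0/= -expR0 ler_expR mulNr oppr_le0 mulr_ge0 ?(ltW l0)//.
have z01 : 0 <= (0 : R) <= (1 : R) by rewrite lexx ler01.
by rewrite subr_ge0; case/andP: (iter_pgf_itv xi_ident (Num.truncn (phi n)) z01).
Qed.

Lemma survival_gt0 n : 0 < 1 - iter n f 0.
Proof.
have i01 : 0 < (1 : R) <= 1 by rewrite ltr01 lexx.
by rewrite fE subr0 subKr; case/andP: (iter_g_itv h0 h_gt0 h1 h_convex n i01).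
Qed.

Let Q_along : iter (Num.truncn (phi n)) g 1 @[n --> \oo] --> 0^'+.
Proof.
have Qc : iter n g 1 @[n --> \oo] --> 0^'+ by exact: Q_cvg.
have := truncn_phi_infty phi_infty ltr01.
under eq_fun do rewrite mul1r.
by move=> H; exact: cvg_comp H Qc.
Qed.

Let laplace_pointE l n :
  laplace_point l n = expR (- l * iter (Num.truncn (phi n)) g 1).
Proof. by rewrite /laplace_point fE subr0 subKr. Qed.

Let z_cvg0 l : 0 < l -> (1 - laplace_point l n) @[n --> \oo] --> 0^'+.
Proof.
move=> l0; under eq_fun do rewrite laplace_pointE.
by have [] := one_sub_expR_cvg l0 Q_along.
Qed.

Let z_ratio l : 0 < l ->
  (1 - laplace_point l n) / iter (Num.truncn (phi n)) g 1 @[n --> \oo] --> l.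
Proof.
move=> l0; under eq_fun do rewrite laplace_pointE.
by have [] := one_sub_expR_cvg l0 Q_along.
Qed.

Let gapE (a b : R) : a - b = 1 - b - (1 - a).
Proof. by ring. Qed.

Lemma size_moment_cvg l : 0 < l ->
  survival_rate n * (iter n f (laplace_point l n) - iter n f 0) @[n --> \oo] -->
  l `^ (- alpha).
Proof.
move=> l0; have H := iter_diff_cvg alpha_gt0 h0 h_gt0 h1 h_convex g_homo h_rv phi_infty phi_small
  l0 (z_cvg0 l0) (z_ratio l0).
apply: cvg_trans H; apply: near_eq_cvg; near=> n.
have [_ ->] : 0 < survival_rate n /\ survival_rate n = (phi n * h (iter n g 1))^-1.
  by near: n; exact: near_survival_rate.
by rewrite [_^-1 * _]mulrC !fE subr0; congr (_ / _); exact: gapE.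
Unshelve. all: by end_near. Qed.

Variable x : R.
Hypothesis x_gt0 : 0 < x.

Let m n := Num.truncn (x * phi n).
Let ell l := 1 - ((1 + l `^ (- alpha) / x) `^ alpha^-1)^-1.

Lemma reduced_moment_cvg l t : 0 < l -> 0 <= t <= 1 ->
  survival_rate n * (iter (n - m n) f (iter (m n) f 0 +
    t * (iter (m n) f (laplace_point l n) - iter (m n) f 0)) - iter n f 0) @[n --> \oo] -->
  x * ((1 - t * ell l) `^ (- alpha) - 1).
Proof.
move=> l0 t01; have H := iter_mix_diff_cvg alpha_gt0 h0 h_gt0 h1 h_convex g_homo h_rv phi_infty
  phi_small l0 (z_cvg0 l0) (z_ratio l0) x_gt0 t01.
apply: cvg_trans H; apply: near_eq_cvg; near=> n.
have [_ ->] : 0 < survival_rate n /\ survival_rate n = (phi n * h (iter n g 1))^-1.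
  by near: n; exact: near_survival_rate.
rewrite [_^-1 * _]mulrC; congr (_ / _).
have -> : iter (m n) f 0 + t * (iter (m n) f (laplace_point l n) - iter (m n) f 0) =
    1 - ((1 - t) * iter (m n) g 1 + t * iter (m n) g (1 - laplace_point l n)).
  by rewrite !fE subr0; ring.
by rewrite !fE subr0 subKr; exact: gapE.
Unshelve. all: by end_near. Qed.

Let Z n w := gw_size xi n w.
Let Zr n w := gw_reduced xi (n - m n) n w.
Let c n := survival_rate n.
Let s l n := laplace_point l n.
Let W l n w : R := (0 < Zr n w)%N%:R * s l n ^+ Z n w.

Let W01 l n w : 0 < l -> 0 <= W l n w <= 1.
Proof.
move=> l0; have /andP[s0 s1] := laplace_point_itv n l0.
rewrite /W; case: (0 < _)%N; rewrite ?mul0r ?mul1r ?lexx ?ler01//.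
by rewrite exprn_ge0// exprn_ile1.
Qed.

Let mpair n : measurable_fibers (fun w => (Zr n w, Z n w)).
Proof.
apply: (measurable_fibers_bind (V := Zr n) (W := fun k w => (k, Z n w))).
  exact: measurable_fibers_reduced.
by move=> k; apply: (measurable_fibers_comp (pair k)); exact: measurable_fibers_size.
Qed.

Let mW l n : measurable_fun setT (W l n).
Proof.
exact: (measurable_fibers_fun (fun kl : nat * nat => (0 < kl.1)%N%:R * s l n ^+ kl.2) (mpair n)).
Qed.

(** The limit [x ((1 - t ell)^(- alpha) - 1)] is expanded in [t]; the [- 1] cancels the constant
    term, whence the case [i = 0]. The radius 1/2 keeps [t ell] in the range of
    [neg_binomial_taylor]. *)
Lemma reduced_coef_cvg l i : 0 < l ->
  c n * \int[P]_w (W l n w * (Zr n w == i)%:R) @[n --> \oo] -->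
  (if i == 0%N then 0 else x * neg_binomial alpha i * ell l ^+ i).
Proof.
move=> l0; have half : 0 < 2^-1 :> R by rewrite invr_gt0.
have half1 : 2^-1 <= 1 :> R by lra.
have /andP[el0 el1] := ell_lt1 alpha_gt0 l0 x_gt0.
pose a n i : R := c n * \int[P]_w (W l n w * (Zr n w == i)%:R).
pose A n t : R := c n * \int[P]_w (W l n w * t ^+ Zr n w).
pose Alim t : R := x * ((1 - t * ell l) `^ (- alpha) - 1).
pose cf i : R := if i == 0%N then 0 else x * neg_binomial alpha i * ell l ^+ i.
apply: (@coef_extraction _ a A Alim cf 2^-1) => //.
- move=> n t k t0.
  have := integral_pow_partial P (measurable_fibers_reduced xi (n - m n) n) (mW l n)
    (fun w => W01 n w l0) k t0 half1.
  have c0 : 0 <= c n := survival_rate_ge0 n.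
  have -> : \sum_(i < k.+1) a n i * t ^+ i =
      c n * \sum_(i < k.+1) (\int[P]_w (W l n w * (Zr n w == i)%:R)) * t ^+ i.
    by rewrite mulr_sumr; apply: eq_bigr => i' _; rewrite mulrA.
  rewrite /A => /andP[H1 H2]; rewrite ler_wpM2l//=.
  by rewrite [X in _ + X]mulrCA -mulrDr ler_wpM2l.
- move=> t /andP[t0 t1].
  have t01 : 0 <= t <= 1 by rewrite (ltW t0) (le_trans t1).
  have H := reduced_moment_cvg l0 t01.
  apply: cvg_trans H; apply: near_eq_cvg; near=> n.
  have mn : (m n <= n)%N.
    have : (2 * m n <= n)%N by near: n; exact: near_m_half.
    by apply: leq_trans; rewrite leq_pmull.
  have := integral_reduced_pow xi_indep xi_ident (n - m n) (m n)
    (laplace_point_itv n l0) t01.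
  by rewrite subnK// /A => <-.
- move=> k; have [K K0 HK] := neg_binomial_taylor k.+1 alpha_gt0.
  exists (x * K); first by rewrite mulr_ge0// ltW.
  move=> t /andP[t0 t1].
  have u01 : 0 <= t * ell l <= 2^-1.
    rewrite mulr_ge0 ?(ltW t0) ?(ltW el0)//=.
    by rewrite -[leRHS]mulr1 ler_pM// ?(ltW t0) ?(ltW el0) ?(ltW el1).
  have -> : Alim t - \sum_(i < k.+1) cf i * t ^+ i =
      x * ((1 - t * ell l) `^ (- alpha) -
        \sum_(i < k.+1) neg_binomial alpha i * (t * ell l) ^+ i).
    rewrite /Alim !big_ord_recl/= /cf/= mul0r add0r !expr0 mulr1.
    have -> : neg_binomial alpha 0 = 1 :> R.
      by rewrite /neg_binomial /rising big_ord0 fact0 divr1.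
    rewrite opprD addrA [RHS]mulrBr; congr (_ - _).
    rewrite mulr_sumr; apply: eq_bigr => i' _; rewrite exprMn; ring.
  rewrite normrM (gtr0_norm x_gt0) -mulrA ler_pM2l//.
  apply: (le_trans (HK _ u01)); rewrite ler_wpM2l//.
  case/andP: u01 => u0 _; rewrite exprMn ler_piMr// ?exprn_ge0 ?exprn_ile1// ?ltW//.
Unshelve. all: by end_near. Qed.

Lemma integral_event (b : T -> bool) (k : R) : measurable_fibers b ->
  \int[P]_w (k * (b w)%:R) = k * fine (P [set w | b w]).
Proof.
move=> mb; have mB : measurable [set w | b w] by exact: mb true.
have E (w : T) : (b w)%:R = \1_[set w | b w] w :> R.
  by rewrite indicE; congr (_%:R); congr nat_of_bool; apply/idP/idP; rewrite inE.
under eq_Rintegral do rewrite E.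
rewrite RintegralZl//; last exact: integrable_indic.
by rewrite /Rintegral integral_indic// setIT.
Qed.

Let H n := [set w | 0 < (1 - iter (Num.truncn (phi n)) f 0) * (Z n w)%:R <= 1].

(** Powers of the point for [l = 1] are the points for integer [l]: transforms at the positive
    integers are moments of one variable. *)
Let s_pow i n : s 1 n ^+ i = s i%:R n.
Proof. by rewrite /s /laplace_point -expRM_natl; congr expR; ring. Qed.

Let size_pow_pow i n w : (s 1 n ^+ Z n w) ^+ i = s i%:R n ^+ Z n w.
Proof. by rewrite -exprM mulnC exprM s_pow. Qed.

Let s_itv i n : (0 < i)%N -> 0 <= s i%:R n <= 1.
Proof. by move=> i0; apply: laplace_point_itv; rewrite ?ltr0n. Qed.

Let U01 n w : 0 <= s 1 n ^+ Z n w <= 1.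
Proof.
have /andP[s0 s1] := laplace_point_itv n (ltr01 : 0 < (1 : R)).
by rewrite exprn_ge0// exprn_ile1.
Qed.

Let mU n : measurable_fun setT (fun w => s 1 n ^+ Z n w).
Proof. exact: (measurable_fibers_fun (fun k => s 1 n ^+ k) (measurable_fibers_size xi n)). Qed.

(** With [Q = 1 - f_(phi(n))(0)] and [s = exp(- Q)], the condition [s^Z >= exp(- 1)] says
    [Q Z <= 1]; this fixes the threshold for [moment_convergence]. *)
Let eventE n w : (0 < Z n w)%N && (expR (-1) <= s 1 n ^+ Z n w) =
  (0 < (1 - iter (Num.truncn (phi n)) f 0) * (Z n w)%:R <= 1).
Proof.
have q0 := survival_gt0 (Num.truncn (phi n)).
rewrite s_pow pmulr_rgt0// ltr0n; congr (_ && _).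
by rewrite /s /laplace_point ler_expR mulNr lerN2 mulrC.
Qed.

Let m1_itv : 0 < (expR (-1) : R) < 1.
Proof. by rewrite expR_gt0 expR_lt1 oppr_lt0 ltr01. Qed.

Let W_itv (b : bool) n : 0 <= c n * b%:R <= c n.
Proof.
have c0 : 0 <= c n := survival_rate_ge0 n.
by case: b; rewrite ?mulr1 ?mulr0 ?lexx c0.
Qed.

(** The limit measure is Lebesgue measure divided by [Gamma (1 + alpha)], with variable
    [exp(- v^(1/alpha))]; the variable is at least [exp(- 1)] exactly on []0, 1]], of length 1. *)
Lemma size_event_cvg : c n * fine (P (H n)) @[n --> \oo] --> (Gamma (1 + alpha))^-1.
Proof.
have G0 : Gamma (1 + alpha) != 0 by rewrite gt_eqF// Gamma1_gt0.
have E1 : (fun v : R => expR (- v `^ alpha^-1)) = (fun v => expR (- 1 * v `^ alpha^-1)).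
  by apply/funext => v; rewrite mulN1r.
have mV : measurable_fun (`]0%R, +oo[%classic : set R) (fun v : R => expR (- v `^ alpha^-1)).
  by rewrite E1; apply: measurable_funTS; exact: measurable_strexp.
have intV : (@lebesgue_measure R).-integrable `]0%R, +oo[
    (EFin \o (fun v : R => expR (- v `^ alpha^-1))).
  by rewrite E1; exact: (integrable_strexp alpha_gt0 ltr01).
have moments i : (0 < i)%N ->
    \int[P]_w (c n * (0 < Z n w)%N%:R * (s 1 n ^+ Z n w) ^+ i) @[n --> \oo] -->
    (Gamma (1 + alpha))^-1 *
      \int[lebesgue_measure]_(v in `]0%R, +oo[) (expR (- v `^ alpha^-1)) ^+ i.
  move=> i0; have i0' : 0 < i%:R :> R by rewrite ltr0n.
  under eq_Rintegral do rewrite strexp_pow.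
  rewrite Rintegral_strexp// mulrC mulfK//.
  have K := size_moment_cvg i0'.
  apply: cvg_trans K; apply: near_eq_cvg; apply: nearW => n.
  rewrite -(integral_size_pow xi_indep xi_ident) ?s_itv// -RintegralZl//.
    by apply: eq_Rintegral => w _; rewrite size_pow_pow mulrA.
  apply: (@bounded_integrable _ _ _ _ _ 1) => [|w].
    exact: (measurable_fibers_fun (fun k => (0 < k)%N%:R * s i%:R n ^+ k)
      (measurable_fibers_size xi n)).
  have /andP[s0 s1] := s_itv n i0.
  rewrite ger0_norm; last by rewrite mulr_ge0// exprn_ge0.
  by case: (0 < _)%N; rewrite ?mul0r ?ler01// mul1r exprn_ile1.
have mW1 n : measurable_fun setT (fun w => c n * (0 < Z n w)%N%:R).
  exact: (measurable_fibers_fun (fun k => c n * (0 < k)%N%:R) (measurable_fibers_size xi n)).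
have K := @moment_convergence _ _ _ _ _ _ _ mW1 (fun n w => W_itv (0 < Z n w)%N n) mU U01
  _ _ (@lebesgue_measure R) `]0%R, +oo[%classic (fun v => expR (- v `^ alpha^-1)) _ (measurable_itv _) mV
  (strexp_itv alpha) intV (strexp_null alpha_gt0) moments _ m1_itv.
have L1 : (Gamma (1 + alpha))^-1 * \int[lebesgue_measure]_(v in `]0, +oo[)
    (expR (-1) <= expR (- v `^ alpha^-1))%R%:R = (Gamma (1 + alpha))^-1 :> R.
  have -> : \int[lebesgue_measure]_(v in `]0, +oo[) (expR (-1) <= expR (- v `^ alpha^-1))%R%:R =
      \int[@lebesgue_measure R]_(v in `]0, +oo[) \1_(`]0%R, 1%R]%classic) v :> R; last first.
    rewrite /Rintegral integral_indic//.
    have -> : (`]0%R, 1%R]%classic : set R) `&` `]0%R, +oo[%classic = `]0%R, 1%R]%classic.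
      by apply/seteqP; split => v /=; rewrite !in_itv/= ?andbT; [case|case/andP=> -> ->].
    have LE : (@lebesgue_measure R) `]0%R, 1%R]%classic = 1%:E.
      by rewrite lebesgue_measure_itv/= lte_fin ltr01 oppr0 adde0.
    transitivity ((Gamma (1 + alpha))^-1 * fine (1%:E : \bar R)); last by rewrite mulr1.
    by congr (_ * fine _); exact: LE.
  apply: eq_Rintegral.
  move=> v; rewrite inE/= in_itv/= andbT => v0; rewrite indicE mem_setE in_itv/= v0/=.
  rewrite ler_expR lerN2; congr (_%:R); congr nat_of_bool.
  have p1 : (1 : R) `^ alpha^-1 = 1 by rewrite powR1.
  have ai : 0 < alpha^-1 by rewrite invr_gt0.
  have [v1|v1] := leP v 1.
    by rewrite -p1 ge0_ler_powR ?nnegrE ?(ltW ai) ?(ltW v0).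
  by apply/negbTE; rewrite -ltNge -p1 gt0_ltr_powR ?nnegrE ?(ltW v0).
rewrite L1 in K; apply: cvg_trans K; apply: near_eq_cvg; apply: nearW => n.
rewrite -integral_event; last first.
  exact: (measurable_fibers_comp (fun k => 0 < _ * k%:R <= 1) (measurable_fibers_size xi n)).
apply: eq_Rintegral => w _; rewrite -eventE -mulrA; congr (_ * _).
by case: (0 < _)%N; case: (expR _ <= _)%R; rewrite ?mulr1 ?mulr0.
Qed.

Local Notation TR := (measurableTypeR R).
Variables (mu : probability TR R) (j : nat).
Hypothesis j_gt0 : (0 < j)%N.
Hypothesis mu_atomless : forall y : R, y != 0 -> mu [set y] = 0%E.
Hypothesis mu_neg : mu `]-oo, 0%R[%classic = 0%E.
Hypothesis mu_laplace : forall l : R, 0 < l -> (\int[mu]_y (expR (- l * y))%:E =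
  ((1 - ((1 + l `^ (- alpha)) `^ alpha^-1)^-1) ^+ j)%:E)%E.

Lemma reduced_event_cvg :
  c n * fine (P ([set w | Zr n w = j] `&` H n)) @[n --> \oo] -->
  x * neg_binomial alpha j * fine (mu `]-oo, x `^ (- alpha^-1)]%classic).
Proof.
(* Scaling by [k] absorbs [x]: as [(i k)^(- alpha) = i^(- alpha) / x], the power [ell i ^+ j] is the
   transform of [mu] at [i k]. Also, [exp(- k y) >= exp(- 1)] means [y <= x^(- 1/alpha)]. *)
pose k := x `^ alpha^-1; have k0 : 0 < k by rewrite powR_gt0.
have mV : measurable_fun setT (fun y : TR => expR (- k * y)).
  by apply: continuous_measurable_fun; exact: continuous_expNM.
have mVD : measurable_fun (`[0%R, +oo[%classic : set TR) (fun y : TR => expR (- k * y)).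
  exact: measurable_funTS.
have V01 (y : TR) : `[0%R, +oo[%classic y -> 0 <= expR (- k * y) <= 1.
  rewrite /= in_itv/= andbT => y0.
  by rewrite expR_ge0/= -expR0 ler_expR mulNr oppr_le0 mulr_ge0// ltW.
have intV : mu.-integrable `[0%R, +oo[%classic (EFin \o (fun y : TR => expR (- k * y))).
  apply: (@integrable_bounded_on _ _ _ 1) => // y Dy.
  by have /andP[e0 e1] := V01 y Dy; rewrite ger0_norm.
have V_null (b : R) : 0 < b < 1 ->
    mu (`[0%R, +oo[%classic `&` (fun y : TR => expR (- k * y)) @^-1` [set b]) = 0%E.
  move=> /andP[b0 b1]; apply/eqP; rewrite eq_le measure_ge0 andbT.
  (* The only point of the fibre is nonzero since [b < 1], away from a possible atom at 0. *)
  have ln0 : - ln b / k != 0.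
    by rewrite mulf_neq0 ?oppr_eq0 ?invr_eq0 ?(gt_eqF k0)// lt_eqF// ln_lt0// b0.
  rewrite -(mu_atomless ln0); apply: le_measure; rewrite ?inE.
  - by apply: measurableI; [exact: measurable_itv|rewrite -[X in measurable X]setTI; exact: mV].
  - exact: measurable_set1.
  - by move=> y [_ /= <-]; rewrite expRK; field; rewrite gt_eqF.
have V_pow i (y : R) : expR (- k * y) ^+ i = expR (- (i%:R * k) * y).
  by rewrite -expRM_natl; congr expR; ring.
have moments i : (0 < i)%N ->
    \int[P]_w (c n * (Zr n w == j)%:R * (s 1 n ^+ Z n w) ^+ i) @[n --> \oo] -->
    x * neg_binomial alpha j * \int[mu]_(y in `[0%R, +oo[) (expR (- k * y)) ^+ i.
  move=> i0; have i0' : 0 < i%:R :> R by rewrite ltr0n.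
  have ik0 : 0 < i%:R * k by rewrite mulr_gt0.
  have -> : \int[mu]_(y in `[0%R, +oo[) (expR (- k * y)) ^+ i = ell i%:R ^+ j.
    under eq_Rintegral do rewrite V_pow.
    rewrite ge0_integral_half_line//; last first.
      by apply: continuous_measurable_fun; exact: continuous_expNM.
    rewrite /Rintegral mu_laplace//=; congr ((1 - (_ `^ _)^-1) ^+ j); congr (1 + _).
    by rewrite powRM ?(ltW i0') ?(ltW k0)// -powRrM mulrN mulVf ?gt_eqF// powR_inv1// ltW.
  have K := @reduced_coef_cvg i%:R j i0'.
  rewrite (gtn_eqF j_gt0) in K.
  apply: cvg_trans K; apply: near_eq_cvg; apply: nearW => n.
  rewrite -RintegralZl//.
    apply: eq_Rintegral => w _; rewrite size_pow_pow /W -[RHS]mulrA; congr (_ * _).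
    have [E|_] := eqVneq (Zr n w) j; last by rewrite mulr0 mul0r.
    by rewrite E j_gt0 !mul1r mulr1.
  apply: (@integrable_count _ _ _ P (Zr n) (W i%:R n) _ (mW _ _) (fun w => W01 n w i0')
    (fun k => (k == j)%:R) 1); first exact: measurable_fibers_reduced.
  by move=> k'; case: eqP; rewrite ?normr1 ?normr0.
have mW1 n : measurable_fun setT (fun w => c n * (Zr n w == j)%:R).
  exact: (measurable_fibers_fun (fun k => c n * (k == j)%:R)
    (measurable_fibers_reduced xi (n - m n) n)).
have K := @moment_convergence _ _ _ _ _ _ _ mW1 (fun n w => W_itv (Zr n w == j) n) mU U01
  _ _ mu `[0%R, +oo[%classic (fun y => expR (- k * y)) _ (measurable_itv _) mVD
  V01 intV V_null moments _ m1_itv.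
have L1 : \int[mu]_(y in `[0%R, +oo[) (expR (-1) <= expR (- k * y))%R%:R =
    fine (mu `]-oo, x `^ (- alpha^-1)]%classic).
  have E (y : TR) : (expR (-1) <= expR (- k * y))%R%:R =
      \1_(`]-oo, x `^ (- alpha^-1)]%classic : set TR) y :> R.
    rewrite indicE mem_setE in_itv/= ler_expR mulNr lerN2; congr (_%:R); congr nat_of_bool.
    by rewrite powRN -/k -[X in y <= X]mul1r ler_pdivlMr// mulrC.
  have mI : measurable (`]-oo, x `^ (- alpha^-1)]%classic : set TR) by exact: measurable_itv.
  under eq_Rintegral do rewrite E.
  rewrite ge0_integral_half_line//.
  by rewrite /Rintegral integral_indic// setIT.
rewrite L1 in K; apply: cvg_trans K; apply: near_eq_cvg; apply: nearW => n.
have -> : [set w | Zr n w = j] `&` H n = [set w | (Zr n w == j) &&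
    (0 < (1 - iter (Num.truncn (phi n)) f 0) * (Z n w)%:R <= 1)].
  apply/seteqP; split => w /=; first by move=> [-> w01]; rewrite eqxx.
  by move=> /andP[/eqP ? ?]; split.
rewrite -integral_event; last first.
  exact: (measurable_fibers_comp (fun kl : nat * nat =>
    (kl.1 == j) && (0 < _ * kl.2%:R <= 1)) (mpair n)).
apply: eq_Rintegral => w _; rewrite -eventE -mulrA; congr (_ * _).
have [E|] := eqVneq (Zr n w) j; last by rewrite mul0r.
(* A positive value [j] of the reduced process forces survival, so the positivity in [H n] is
   automatic. *)
have -> : (0 < Z n w)%N by apply: (@gw_reduced_gt0 _ _ _ _ xi (n - m n)); rewrite -/(Zr n w) E.
by rewrite mul1r.
Qed.

End conditional_limits.

Lemma rising_Gamma {R : realType} (a : R) i : 0 < a -> rising a i * Gamma a = Gamma (i%:R + a).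
Proof.
move=> a0; elim: i => [|i IH]; first by rewrite /rising big_ord0 mul1r add0r.
have ia : 0 < i%:R + a by rewrite ltr_wpDl.
have -> : i.+1%:R + a = 1 + (i%:R + a) by rewrite -natr1 addrAC addrC.
rewrite Gamma1// -IH /rising big_ord_recr/= [a + _]addrC.
by rewrite mulrAC mulrC.
Qed.

Theorem theorem2 (R : realType) (d : measure_display) (T : measurableType d)
    (P : probability T R) (alpha : R) (alpha01 : 0 < alpha < 1)
    (xi : seq nat -> {RV P >-> nat})
    (xi_indep : mutually_independent xi)
    (xi_ident : identically_distributed xi)
    (f : R -> R) (f_pgf : f = pgf (xi [::]))
    (xi_mean : 'E_P[fun w => ((xi [::] w)%:R)%R]%E = 1%E)
    (L : R -> R) (L_slow : slowly_varying_at0 L)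
    (f_form : forall s : R, 0 <= s <= 1 ->
       f s = s + (1 - s) `^ (1 + alpha) * L (1 - s))
    (phi : nat -> R) (phi_gt0 : forall n : nat, (0 < n)%N -> 0 < phi n)
    (phi_infty : phi n @[n --> \oo] --> +oo)
    (phi_small : phi n / n%:R @[n --> \oo] --> (0 : R))
    (M : cumulativeBounded (0 : R) (1 : R))
    (M_supp : forall y : R, y < 0 -> M y = 0)
    (M_laplace : forall lambda : R, 0 < lambda ->
       \int[lebesgue_stieltjes_measure M]_(y in `[0, +oo[) expR (- lambda * y)
       = 1 - ((1 + lambda `^ (- alpha)) `^ alpha^-1)^-1)
    (x : R) (x_gt0 : 0 < x) (j : nat) (j_ge1 : (1 <= j)%N) :
  let H (n : nat) : set T :=
    [set w | 0 < (1 - iter (Num.truncn (phi n)) f 0) * (gw_size xi n w)%:R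
             <= 1] in
  cond_prob P
    [set w | gw_reduced xi (n - Num.truncn (x * phi n)) n w = j] (H n)
    @[n --> \oo] -->
  alpha * Gamma (j%:R + alpha) / j`!%:R * x
    * df_convolution_pow M j (x `^ (- alpha^-1)).
Proof.
move=> H; have /andP[alpha_gt0 _] := alpha01; rewrite f_pgf in f_form.
pose mu : probability (measurableTypeR R) R := lebesgue_stieltjes_measure M.
pose ell (l : R) := 1 - ((1 + l `^ (- alpha)) `^ alpha^-1)^-1.
have mu_neg : mu `]-oo, 0%R[%classic = 0%E by exact: lebesgue_stieltjes_neg.
have mu_laplace l : 0 < l -> \int[mu]_(y in `[0, +oo[) expR (- l * y) = ell l.
  exact: M_laplace.
have mu_atomless := laplace_atomless alpha_gt0 mu_neg (fun l => erefl (ell l)) mu_laplace.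
have [nu_atomless nu_neg nu_laplace] := convolution_pow_props mu_atomless mu_neg
  (laplace_integralT mu_neg mu_laplace) j_ge1.
have num := reduced_event_cvg xi_indep xi_ident alpha_gt0 L_slow f_form phi_infty phi_small x_gt0
  j_ge1 nu_atomless nu_neg nu_laplace.
have den := size_event_cvg xi_indep xi_ident alpha_gt0 L_slow f_form phi_infty phi_small.
have G0 := Gamma1_gt0 alpha_gt0.
have Gi0 : (Gamma (1 + alpha))^-1 != 0 by rewrite invr_eq0 gt_eqF.
(* The denominator brings [Gamma (1 + alpha) = alpha * Gamma alpha], and
   [rising alpha j * Gamma alpha] is [Gamma (j + alpha)]. *)
have E : x * neg_binomial alpha j * fine (convolution_pow mu j `]-oo, x `^ (- alpha^-1)]%classic) *
    ((Gamma (1 + alpha))^-1)^-1 =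
    alpha * Gamma (j%:R + alpha) / j`!%:R * x * df_convolution_pow M j (x `^ (- alpha^-1)).
  rewrite invrK Gamma1// -(rising_Gamma j alpha_gt0) /df_convolution_pow /neg_binomial -/mu.
  move: (fine _) (rising _ _) (Gamma _) (j`!%:R^-1) => A B C D.
  ring.
have lim : survival_rate xi phi n *
      fine (P ([set w | gw_reduced xi (n - Num.truncn (x * phi n)) n w = j] `&` H n)) *
    (survival_rate xi phi n * fine (P (H n)))^-1 @[n --> \oo] -->
    alpha * Gamma (j%:R + alpha) / j`!%:R * x * df_convolution_pow M j (x `^ (- alpha^-1)).
  by rewrite -E /H f_pgf; exact: cvgM num (cvgV Gi0 den).
have rate_gt0 : \forall n \near \oo, 0 < survival_rate xi phi n.
  apply: filterS (near_survival_rate xi_ident alpha_gt0 L_slow f_form phi_infty).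
  by move=> n [].
(* Numerator and denominator carry the same eventually positive rate, which cancels in the
   conditional probability. *)
apply: cvg_trans lim.
apply: near_eq_cvg; near=> n; rewrite /cond_prob.
have c0 : 0 < survival_rate xi phi n by near: n; exact: rate_gt0.
by rewrite invfM mulrACA divff ?mul1r// gt_eqF.
Unshelve. all: by end_near.
Qed.
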